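(* Let $X=\mathrm{GP}(8,3)$ be the Möbius–Kantor graph, and let $p$ be an odd prime. All voltage assignments $\zeta$ below are trivial on the spanning tree $T$ and satisfy $\zeta(x)$, $\zeta(x_1),\dots,\zeta(x_8)$ as displayed. In each of the cases below, the listed derived projections $\wp_\zeta\colon\mathrm{Cov}(X;\zeta)\to X$ (which have connected covering graphs) are minimal semisymmetric, and every minimal semisymmetric $p$-elementary abelian regular covering projection of $X$ with connected covering graph is isomorphic to one of them. Projections from different families (A1), (A2), (A3), (B1), (B2), (C), (D) are nonisomorphic. **(A)** Let $p\equiv 1\pmod 4$ and fix $i\in\mathbb Z_p$ with $i^2=-1$. For $s\in\mathbb Z_p$ let $\zeta_s$ be the assignment with values in $\mathbb Z_p^{2,1}$: $$\zeta_s(x)=\begin{pmatrix}0\\0\end{pmatrix},\ \zeta_s(x_1)=\begin{pmatrix}s\\1+(1+s)i\end{pmatrix},\ \zeta_s(x_2)=\begin{pmatrix}1\\-1-s-si\end{pmatrix},\ \zeta_s(x_3)=\begin{pmatrix}si\\1+s-i\end{pmatrix},\ \zeta_s(x_4)=\begin{pmatrix}i\\-s+(1+s)i\end{pmatrix},$$ $$\zeta_s(x_{j+4})=-\zeta_s(x_j)\quad (j=1,2,3,4).$$ (A1) If $p\equiv 5\pmod 8$: the projections $\wp_{\zeta_s}$ with $s\in\mathbb Z_p$, $s\ne -1,i$. The largest group that lifts is $H$. (A2) If $p\equiv 1\pmod 8$: the projections $\wp_{\zeta_s}$ with $s\in\mathbb Z_p$, $s\notin\{-1,\,i,\,\nu,\,-\nu,\,-1+\nu-\nu^2,\,-1-\nu-\nu^2\}$,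 where $\nu\in\mathbb Z_p$, $\nu^2=-i$. The largest group that lifts is $H$. (A3) If $p\equiv 1\pmod 8$: the single projection $\wp_{\zeta_s}$ with $s=-1+\nu-\nu^2$, where $\nu^2=-i$. The largest group that lifts is $M$. In (A1) and (A2), two projections $\wp_{\zeta_s},\wp_{\zeta_{s'}}$ are isomorphic if and only if $s,s'$ lie in the same orbit $$\Big\{s,\ -\tfrac{i}{s},\ \tfrac{((i-1)/2)s+i}{s-(i-1)/2},\ \tfrac{(i-1)s+i}{s-(i-1)}\Big\}$$ of an action of $\mathbb Z_2\times\mathbb Z_2$ on $\mathbb Z_p\cup\{\infty\}$; these orbits have size four. **(B)** Let $p\equiv -1\pmod 4$. For $\alpha,\beta\in\mathbb Z_p$ with $\alpha^2+\beta^2=-1$ let $\zeta_{\alpha,\beta}$ be the assignment with values in $\mathbb Z_p^{2,1}$: $$\zeta_{\alpha,\beta}(x)=\begin{pmatrix}0\\0\end{pmatrix},\ \zeta_{\alpha,\beta}(x_1)=\begin{pmatrix}\alpha+1\\\beta\end{pmatrix},\ \zeta_{\alpha,\beta}(x_2)=\begin{pmatrix}-1\\1\end{pmatrix},\ \zeta_{\alpha,\beta}(x_3)=\begin{pmatrix}\beta\\-(\alpha+1)\end{pmatrix},\ \zeta_{\alpha,\beta}(x_4)=\begin{pmatrix}1\\1\end{pmatrix},$$ $$\zeta_{\alpha,\beta}(x_{j+4})=-\zeta_{\alpha,\beta}(x_j)\quad(j=1,2,3,4).$$ (B1) The projections $\wp_{\zeta_{\alpha,\beta}}$ with $\alpha^2+\beta^2=-1$,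 where in case $p\equiv 7\pmod 8$ all such $(\alpha,\beta)$ are taken, and in case $p\equiv 3\pmod 8$ those with $(\alpha,\beta)\ne(\pm1,\pm\sqrt{-2})$ (all sign combinations excluded; this is empty if $p=3$). The largest group that lifts is $H$. Two of these are isomorphic if and only if their parameters lie in the same orbit (of size four) $\{(\alpha,\beta),(\tfrac1\alpha,-\tfrac\beta\alpha),(\alpha,-\beta),(\tfrac1\alpha,\tfrac\beta\alpha)\}$ of an action of $\mathbb Z_2\times\mathbb Z_2$ on the solutions of $\alpha^2+\beta^2=-1$. (B2) If $p\equiv 3\pmod 8$: the single projection $\wp_{\zeta_{\alpha,\beta}}$ with $(\alpha,\beta)=(1,\sqrt{-2})$. The largest group that lifts is $M$. **(C)** If $p\equiv 1\pmod{24}$: one additional projection $\wp_\zeta$, with values in $\mathbb Z_p^{3,1}$, where $i^2=-1$, $\nu^2=-i$ and $\theta\in\mathbb Z_p$, $\theta^2=-3$: $$\zeta(x)=\begin{pmatrix}-4\\0\\0\end{pmatrix},\ \zeta(x_1)=\begin{pmatrix}1+\theta\\\nu\\1+(1+\nu)i\end{pmatrix},\ \zeta(x_2)=\begin{pmatrix}-3-\theta\\1\\-1-\nu-\nu i\end{pmatrix},\ \zeta(x_3)=\begin{pmatrix}1+\theta\\\nu i\\1+\nu-i\end{pmatrix},\ \zeta(x_4)=\begin{pmatrix}1-\theta\\i\\-\nu+(1+\nu)i\end{pmatrix},$$ $$\zeta(x_5)=\begin{pmatrix}-3+\theta\\-\nu\\-1-(1+\nu)i\end{pmatrix},\ \zeta(x_6)=\begin{pmatrix}1-\theta\\-1\\1+\nu+\nu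 i\end{pmatrix},\ \zeta(x_7)=\begin{pmatrix}1+\theta\\-\nu i\\-1-\nu+i\end{pmatrix},\ \zeta(x_8)=\begin{pmatrix}-3-\theta\\-i\\\nu-(1+\nu)i\end{pmatrix}.$$ The largest group that lifts is $H$. **(D)** If $p\equiv 19\pmod{24}$: one additional projection $\wp_\zeta$, with values in $\mathbb Z_p^{3,1}$, where $\theta,\delta\in\mathbb Z_p$, $\theta^2=-3$, $\delta^2=-2$: $$\zeta(x)=\begin{pmatrix}-4\\0\\0\end{pmatrix},\ \zeta(x_1)=\begin{pmatrix}1+\theta\\0\\\delta\end{pmatrix},\ \zeta(x_2)=\begin{pmatrix}-3-\theta\\-1\\1\end{pmatrix},\ \zeta(x_3)=\begin{pmatrix}1+\theta\\\delta\\0\end{pmatrix},\ \zeta(x_4)=\begin{pmatrix}1-\theta\\1\\1\end{pmatrix},$$ $$\zeta(x_5)=\begin{pmatrix}-3+\theta\\0\\-\delta\end{pmatrix},\ \zeta(x_6)=\begin{pmatrix}1-\theta\\1\\-1\end{pmatrix},\ \zeta(x_7)=\begin{pmatrix}1+\theta\\-\delta\\0\end{pmatrix},\ \zeta(x_8)=\begin{pmatrix}-3-\theta\\-1\\-1\end{pmatrix}.$$ The largest group that lifts is $H$. Moreover, the projections in (A) and (B) are also minimal edge-transitive, and there are, up to isomorphism, $(p-1)/4$ of them if $p\equiv1\pmod 4$ and $(p+1)/4$ of them if $p\equiv-1\pmod 4$; the projections in (C) and (D) are not minimal edge-transitive.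
   Context: **Graphs.** Graphs are finite and simple; an arc is an ordered pair of adjacent vertices; a morphism is an adjacency-preserving map on vertices. A subgroup of $\mathrm{Aut}\,X$ is vertex-transitive (edge-transitive) if it acts transitively on vertices (edges) of $X$. **The graph $\mathrm{GP}(8,3)$, tree and arcs.** Vertex set $\{1,\dots,16\}$. Edges: the outer edges $\{i,i+1\}$ for $1\le i\le 7$ and $\{8,1\}$; the spokes $\{i,8+i\}$ for $1\le i\le 8$; and the inner edges $\{8+i,8+j\}$ where $i,j\in\{1,\dots,8\}$, $j\equiv i+3\pmod 8$. $T$ is the spanning tree consisting of all spokes and all inner edges except $\{11,16\}$. Let $x$ be the arc $(16,11)$, let $x_i$ be the arc $(i,i+1)$ for $1\le i\le 7$, and $x_8=(8,1)$. **The groups $H$ and $M$.** As permutations of $\{1,\dots,16\}$ let $\rho=(1,2,3,4,5,6,7,8)(9,10,11,12,13,14,15,16)$, $\omega=(2,8,9)(3,16,14)(4,13,6)(7,12,10)$, $\sigma=(1,14,7,12,5,10,3,16)(2,11,8,9,6,15,4,13)$; these are automorphisms of $\mathrm{GP}(8,3)$. Put $H=\langle\rho^2,\omega\rangle$ (order 24) and $M=\langle H,\sigma\rangle$ (order 48). **Regular covering projections.** An epimorphism $\wp\colon\tilde X\to X$ of graphs is a regular covering projection if there is a subgroup $\mathrm{CT}(\wp)\le\mathrm{Aut}\,\tilde X$ acting semiregularly (all vertex stabilizers trivial) on $V(\tilde X)$ whose vertex orbits are exactly the fibres $\wp^{-1}(v)$, $v\in V(X)$, and whose arc and edge orbits are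 exactly the fibres over the arcs and over the edges of $X$. It is nontrivial if $\mathrm{CT}(\wp)\ne1$, and $p$-elementary abelian if $\mathrm{CT}(\wp)$ is a (nontrivial) elementary abelian $p$-group. Two regular covering projections $\wp\colon\tilde X\to X$, $\wp'\colon\tilde X'\to X$ are isomorphic if there are $\alpha\in\mathrm{Aut}\,X$ and a graph isomorphism $\tilde\alpha\colon\tilde X\to\tilde X'$ with $\alpha\circ\wp=\wp'\circ\tilde\alpha$. **Voltages.** $\mathbb Z_p^{d,1}$ is the additive group of column vectors of length $d$ over the field $\mathbb Z_p$. A voltage assignment is a map $\zeta$ from arcs of $X$ to $N=\mathbb Z_p^{d,1}$ with $\zeta(v,u)=-\zeta(u,v)$; it is trivial on $T$ if it is $0$ on all arcs of $T$. The derived graph $\mathrm{Cov}(X;\zeta)$ has vertex set $V(X)\times N$ and adjacencies $(u,a)\sim(v,a+\zeta(u,v))$ for $u\sim v$ in $X$; $\wp_\zeta\colon\mathrm{Cov}(X;\zeta)\to X$ is the projection onto the first coordinate, a regular $N$-covering projection. **Lifting and symmetry.** $\alpha\in\mathrm{Aut}\,X$ lifts along $\wp\colon\tilde X\to X$ if there is $\tilde\alpha\in\mathrm{Aut}\,\tilde X$ with $\alpha\circ\wp=\wp\circ\tilde\alpha$; a subgroup lifts if each of its elements lifts; the largest group that lifts is the group of all automorphisms of $X$ that lift. $\wp$ is vertex-transitive (edge-transitive) if some vertex-transitive (edge-transitive) subgroup of $\mathrm{Aut}\,X$ lifts along $\wp$, and semisymmetric if it is edge-transitive but not vertex-transitive.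 **Minimality.** A projection $\wp\colon\tilde X\to X$ is minimal semisymmetric (minimal edge-transitive) if it is semisymmetric (edge-transitive) and there is no decomposition $\wp=\wp'\circ\wp''$ into two nontrivial regular covering projections $\wp''\colon\tilde X\to Y$, $\wp'\colon Y\to X$ with $\wp'$ semisymmetric (edge-transitive). **Conventions.** $\sqrt{-2}$ denotes a fixed square root of $-2$ in $\mathbb Z_p$ (existing when $p\equiv3\pmod 8$). In fractions with parameters in $\mathbb Z_p\cup\{\infty\}$ the usual conventions for Möbius transformations apply. *)

(* Defs.v *)
From HB Require Import structures.
From mathcomp Require Import all_boot all_order all_algebra all_fingroup all_solvable.

Set Implicit Arguments.
Unset Strict Implicit.
Unset Printing Implicit Defensive.

Import GRing.Theory.

Local Open Scope nat_scope.

Record sgraph := SGraph {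
  vertex :> finType;
  adj : rel vertex;
  adj_sym : symmetric adj;
  adj_irrefl : irreflexive adj }.

Definition arcs (X : sgraph) : {set X * X} := [set u | adj u.1 u.2].

Definition edges (X : sgraph) : {set {set X}} :=
  [set [set u.1; u.2] | u in arcs X].

Definition connected_graph (X : sgraph) : Prop :=
  forall u v : X, connect (@adj X) u v.

Definition Aut_graph (X : sgraph) : {set {perm X}} :=
  [set a : {perm X} | [forall u : X, forall v : X, adj (a u) (a v) == adj u v]].

Definition graph_iso (X Y : sgraph) (f : X -> Y) : Prop :=
  bijective f /\ (forall u v, adj (f u) (f v) = adj u v).

Record projection (X : sgraph) := Projection {
  cover_graph : sgraph;
  proj :> cover_graph -> X }.

Section Coverings.

Variable X : sgraph.
Implicit Types P Q : projection X.

Definition epimorphism P : Prop :=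
  {homo P : u v / adj u v} /\ (forall x, exists u, P u = x).

Definition arc_orbit (Y : sgraph) (C : {set {perm Y}}) (a : Y * Y) :
  {set Y * Y} := [set (c a.1, c a.2) | c : {perm Y} in C].

Definition arc_fibre P (b : X * X) : {set cover_graph P * cover_graph P} :=
  [set a in arcs (cover_graph P) | (P a.1, P a.2) == b].

Definition edge_fibre P (e : {set X}) : {set {set cover_graph P}} :=
  [set e' in edges (cover_graph P) | P @: e' == e].

Definition covering_group P (C : {group {perm (cover_graph P)}}) : Prop :=
  [/\ C \subset Aut_graph (cover_graph P),
      (forall v, 'C_C[v | 'P] = 1)%g,
      [set orbit 'P C v | v : cover_graph P] = [set P @^-1: [set x] | x : X],
      [set arc_orbit C a | a in arcs (cover_graph P)]
        = [set arc_fibre P b | b in arcs X] &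
      [set orbit ('P^*) C e | e in edges (cover_graph P)]
        = [set edge_fibre P e | e in edges X]].

Definition nontrivial_regular_covering P : Prop :=
  epimorphism P /\
  exists C : {group {perm (cover_graph P)}}, covering_group C /\ C :!=: 1%g.

Definition elementary_abelian_covering (p : nat) P : Prop :=
  epimorphism P /\
  exists C : {group {perm (cover_graph P)}},
    [/\ covering_group C, C :!=: 1%g & (p.-abelem C)%g].

Definition isomorphic_projections P Q : Prop :=
  exists2 a : {perm X}, a \in Aut_graph X &
  exists2 b : cover_graph P -> cover_graph Q, graph_iso b & forall u, a (P u) = Q (b u).

Definition lifts P (a : {perm X}) : bool :=
  [exists b : {perm (cover_graph P)} in Aut_graph (cover_graph P), [forall u, a (P u) == P (b u)]].

Definition largest_lifting_group P : {set {perm X}} :=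
  [set a in Aut_graph X | lifts P a].

Definition vertex_transitive P : Prop :=
  exists G : {group {perm X}},
    [/\ G \subset Aut_graph X, [transitive G, on [set: X] | 'P]
      & forall a, a \in G -> lifts P a].

Definition edge_transitive P : Prop :=
  exists G : {group {perm X}},
    [/\ G \subset Aut_graph X, [transitive G, on edges X | ('P^*)]
      & forall a, a \in G -> lifts P a].

Definition semisymmetric P : Prop := edge_transitive P /\ ~ vertex_transitive P.

End Coverings.

Definition minimal_for (X : sgraph) (Phi : projection X -> Prop)
    (P : projection X) : Prop :=
  Phi P /\
  ~ exists (Y : sgraph) (g : cover_graph P -> Y) (f : Y -> X),
      [/\ nontrivial_regular_covering (Projection g),
          nontrivial_regular_covering (Projection f),
          P =1 f \o g & Phi (Projection f)].

Definition minimal_semisymmetric (X : sgraph) (P : projection X) : Prop :=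
  minimal_for (@semisymmetric X) P.

Definition minimal_edge_transitive (X : sgraph) (P : projection X) : Prop :=
  minimal_for (@edge_transitive X) P.

Definition number_up_to_iso (X : sgraph) (S : projection X -> Prop) (n : nat) :
    Prop :=
  exists f : 'I_n -> projection X,
    [/\ forall k, S (f k),
        forall k l, isomorphic_projections (f k) (f l) -> k = l &
        forall P, S P -> exists k, isomorphic_projections P (f k)].

(* Only the values of zeta on arcs matter; the values on pairs of nonadjacent
   vertices are irrelevant. *)
Record voltage (X : sgraph) (N : finZmodType) := Voltage {
  volt :> X -> X -> N;
  voltN : forall u v, adj u v -> volt v u = (- volt u v)%R }.

Section Derived.

Variables (X : sgraph) (N : finZmodType) (zeta : voltage X N).

Definition cov_adj : rel (X * N) :=
  [rel a b | adj a.1 b.1 && (b.2 == a.2 + zeta a.1 b.1)%R].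

Lemma cov_adj_sym : symmetric cov_adj.
Proof.
suff sub a b : cov_adj a b -> cov_adj b a by move=> a b; apply/idP/idP; apply: sub.
rewrite /cov_adj /= => /andP[ab /eqP->].
by rewrite adj_sym ab (voltN zeta ab) addrK eqxx.
Qed.

Lemma cov_adj_irrefl : irreflexive cov_adj.
Proof. by move=> a; rewrite /cov_adj /= adj_irrefl. Qed.

Definition Cov : sgraph := SGraph cov_adj_sym cov_adj_irrefl.

Definition derived_projection : projection X :=
  @Projection X Cov (fun a : X * N => a.1).

End Derived.

(* The vertex labelled k, for 1 <= k <= 16, is the ordinal k.-1; the label of
   the ordinal u is thus u.+1. *)
Definition vtx (k : nat) : 'I_16 := inZp k.-1.

Definition outer_edges : seq (nat * nat) :=
  rcons [seq (k, k.+1) | k <- iota 1 7] (8, 1).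
Definition spokes : seq (nat * nat) := [seq (k, 8 + k) | k <- iota 1 8].
Definition inner_edges : seq (nat * nat) :=
  [seq (8 + i, 8 + j) | i <- iota 1 8,
                        j <- [seq j <- iota 1 8 | j == i + 3 %[mod 8]]].

Definition edge_in (E : seq (nat * nat)) : rel 'I_16 :=
  [rel u v : 'I_16 | ((u.+1, v.+1) \in E) || ((v.+1, u.+1) \in E)].

Definition GP_adj : rel 'I_16 :=
  edge_in (outer_edges ++ spokes ++ inner_edges).

Lemma GP_adj_sym : symmetric GP_adj.
Proof. by move=> u v; rewrite /GP_adj /edge_in /= orbC. Qed.

Lemma GP_adj_irrefl : irreflexive GP_adj.
Proof. by case; do 16?[case=> //]. Qed.

Definition GP83 : sgraph := SGraph GP_adj_sym GP_adj_irrefl.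

Definition T_edges : rel 'I_16 :=
  [rel u v | edge_in (spokes ++ inner_edges) u v
             && ([set u; v] != [set vtx 11; vtx 16])].

(* The arcs x, x_1, ..., x_8 outside T, in this order. *)
Definition cotree_arcs : seq (nat * nat) := (16, 11) :: outer_edges.

Section TreeVoltage.

Variables (N : finZmodType) (vals : seq N).

(* The voltage assignment that is trivial on T and takes the values vals
   (of length 9) on x, x_1, ..., x_8; see the two lemmas below. *)
Definition tree_volt (u v : 'I_16) : N :=
  (vals`_(index (u.+1, v.+1) cotree_arcs)
   - vals`_(index (v.+1, u.+1) cotree_arcs))%R.

Lemma tree_voltN (u v : GP83) : adj u v -> tree_volt v u = (- tree_volt u v)%R.
Proof. by rewrite /tree_volt opprB. Qed.

Definition tree_voltage : voltage GP83 N := @Voltage GP83 N tree_volt tree_voltN.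

Lemma T_edges_cotree (u v : 'I_16) :
  T_edges u v -> (u.+1, v.+1) \notin cotree_arcs.
Proof.
move=> /andP[uvE uvT].
have {uvT} uvT : ~~ ((u.+1 == 16) && (v.+1 == 11)).
  apply: contra uvT => /andP[/eqP[u15] /eqP[v10]].
  have -> : u = vtx 16 by apply: val_inj.
  have -> : v = vtx 11 by apply: val_inj.
  by rewrite setUC.
pose E := spokes ++ inner_edges.
have /allP/(_ u.+1) chk : all (fun a => all (fun b =>
    ((a, b) \in E) || ((b, a) \in E) ==> ~~ ((a == 16) && (b == 11))
    ==> ((a, b) \notin cotree_arcs)) (iota 1 16)) (iota 1 16) by vm_compute.
have /chk/allP/(_ v.+1) : u.+1 \in iota 1 16.
  by rewrite mem_iota /= add1n; exact: ltn_ord u.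
rewrite mem_iota /= add1n => /(_ (ltn_ord v)).
by move/implyP/(_ uvE)/implyP; apply.
Qed.

Lemma tree_voltage_T (u v : GP83) :
  size vals = 9 -> T_edges u v -> tree_voltage u v = 0%R.
Proof.
move=> szv uvT.
have vuT : T_edges v u.
  by move: uvT; rewrite /T_edges /= /edge_in /= orbC setUC.
by rewrite /= /tree_volt !memNindex ?T_edges_cotree // nth_default ?szv ?subrr.
Qed.

Lemma tree_voltage_cotree k : size vals = 9 -> k < 9 ->
  let a := nth (0, 0) cotree_arcs k in
  tree_voltage (vtx a.1) (vtx a.2) = (vals`_k)%R.
Proof.
move=> szv; rewrite /= /tree_volt.
by do 9?[case: k => [|k] //]; move=> _ /=; rewrite [(vals`_9)%R]nth_default ?szv // subr0.
Qed.

End TreeVoltage.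

Definition cycle_perm (c : seq 'I_16) (Uc : uniq c) : {perm 'I_16} :=
  perm (can_inj (prev_next Uc)).

Notation cyc s := (@cycle_perm (map vtx s%N) isT).

Section Groups.

Local Open Scope group_scope.

Definition rho : {perm 'I_16} :=
  cyc [:: 1; 2; 3; 4; 5; 6; 7; 8] * cyc [:: 9; 10; 11; 12; 13; 14; 15; 16].
Definition omega : {perm 'I_16} :=
  cyc [:: 2; 8; 9] * cyc [:: 3; 16; 14] * cyc [:: 4; 13; 6]
  * cyc [:: 7; 12; 10].
Definition sigma : {perm 'I_16} :=
  cyc [:: 1; 14; 7; 12; 5; 10; 3; 16] * cyc [:: 2; 11; 8; 9; 6; 15; 4; 13].

Definition grpH : {set {perm GP83}} := <<[set rho ^+ 2; omega]>>.
Definition grpM : {set {perm GP83}} := <<sigma |: grpH>>.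

End Groups.

Section Families.

Local Open Scope ring_scope.

Variable p : nat.
Local Notation F := 'F_p.

Definition colv d (l : seq F) : 'cV[F]_d := \col_k l`_k.

(* The values on x, x_1, ..., x_8 when the one on x is 0 and those on
   x_5, ..., x_8 are the opposites of those on x_1, ..., x_4. *)
Definition antipodal_values d (c1 c2 c3 c4 : 'cV[F]_d) : seq 'cV[F]_d :=
  [:: 0; c1; c2; c3; c4; - c1; - c2; - c3; - c4].

Definition projA (i s : F) : projection GP83 :=
  derived_projection (tree_voltage (antipodal_values
    (colv 2 [:: s; 1 + (1 + s) * i])
    (colv 2 [:: 1; - 1 - s - s * i])
    (colv 2 [:: s * i; 1 + s - i])
    (colv 2 [:: i; - s + (1 + s) * i]))).

Definition projB (ab : F * F) : projection GP83 :=
  let: (a, b) := ab in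
  derived_projection (tree_voltage (antipodal_values
    (colv 2 [:: a + 1; b])
    (colv 2 [:: - 1; 1])
    (colv 2 [:: b; - (a + 1)])
    (colv 2 [:: 1; 1]))).

Definition projC (i nu theta : F) : projection GP83 :=
  derived_projection (tree_voltage
    [:: colv 3 [:: - 4%:R; 0; 0];
        colv 3 [:: 1 + theta; nu; 1 + (1 + nu) * i];
        colv 3 [:: - 3%:R - theta; 1; - 1 - nu - nu * i];
        colv 3 [:: 1 + theta; nu * i; 1 + nu - i];
        colv 3 [:: 1 - theta; i; - nu + (1 + nu) * i];
        colv 3 [:: - 3%:R + theta; - nu; - 1 - (1 + nu) * i];
        colv 3 [:: 1 - theta; - 1; 1 + nu + nu * i];
        colv 3 [:: 1 + theta; - (nu * i); - 1 - nu + i];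
        colv 3 [:: - 3%:R - theta; - i; nu - (1 + nu) * i]]).

Definition projD (theta delta : F) : projection GP83 :=
  derived_projection (tree_voltage
    [:: colv 3 [:: - 4%:R; 0; 0];
        colv 3 [:: 1 + theta; 0; delta];
        colv 3 [:: - 3%:R - theta; - 1; 1];
        colv 3 [:: 1 + theta; delta; 0];
        colv 3 [:: 1 - theta; 1; 1];
        colv 3 [:: - 3%:R + theta; 0; - delta];
        colv 3 [:: 1 - theta; 1; - 1];
        colv 3 [:: 1 + theta; - delta; 0];
        colv 3 [:: - 3%:R - theta; - 1; - 1]]).

Definition paramA1 (i s : F) : bool :=
  (p == 5 %[mod 8]) && (s \notin [:: -1; i]).

Definition paramA2 (i nu s : F) : bool :=
  (p == 1 %[mod 8]) &&
  (s \notin [:: -1; i; nu; - nu; - 1 + nu - nu ^+ 2; - 1 - nu - nu ^+ 2]).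

Definition solutionB (ab : F * F) : bool := ab.1 ^+ 2 + ab.2 ^+ 2 == -1.

Definition paramB1 (r : F) (ab : F * F) : bool :=
  [&& p == 3 %[mod 4], solutionB ab &
      (p == 3 %[mod 8]) ==>
        (ab \notin [:: (1, r); (1, - r); (-1, r); (-1, - r)])].

Inductive cover_family := FamA1 | FamA2 | FamA3 | FamB1 | FamB2 | FamC | FamD.

Definition in_A (f : cover_family) : bool :=
  match f with FamA1 | FamA2 | FamA3 => true | _ => false end.
Definition in_B (f : cover_family) : bool :=
  match f with FamB1 | FamB2 => true | _ => false end.

Definition family_group (f : cover_family) : {set {perm GP83}} :=
  match f with FamA3 | FamB2 => grpM | _ => grpH end.

Definition listed (i nu theta r delta : F) (f : cover_family)
    (P : projection GP83) : Prop :=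
  match f with
  | FamA1 => exists2 s, paramA1 i s & P = projA i s
  | FamA2 => exists2 s, paramA2 i nu s & P = projA i s
  | FamA3 => p = 1 %[mod 8] /\ P = projA i (- 1 + nu - nu ^+ 2)
  | FamB1 => exists2 ab, paramB1 r ab & P = projB ab
  | FamB2 => p = 3 %[mod 8] /\ P = projB (1, r)
  | FamC => p = 1 %[mod 24] /\ P = projC i nu theta
  | FamD => p = 19 %[mod 24] /\ P = projD theta delta
  end.

(* z |-> (a z + b) / (c z + d) on the projective line, with None for oo. *)
Definition mobius (a b c d : F) (z : option F) : option F :=
  match z with
  | Some z => if c * z + d == 0 then None else Some ((a * z + b) / (c * z + d))
  | None => if c == 0 then None else Some (a / c)
  end.

Definition orbitA (i : F) (z : option F) : {set option F} :=
  [set z; mobius 0 (- i) 1 0 z;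
       mobius ((i - 1) / 2%:R) i 1 (- ((i - 1) / 2%:R)) z;
       mobius (i - 1) i 1 (- (i - 1)) z].

Definition orbitB (ab : F * F) : {set F * F} :=
  let: (a, b) := ab in
  [set (a, b); (1 / a, - (b / a)); (a, - b); (1 / a, b / a)].

End Families.

(* Main.v *)
(* A connected p-elementary abelian cover of X is derived from a matrix Z over F_p
   with independent rows, whose columns are the voltages on the nine cotree arcs.
   An automorphism a lifts if and only if the row space of Z is stable under the
   9 x 9 matrix by which a acts on the voltages modulo coboundaries; isomorphic covers
   correspond to row spaces in the same orbit of Aut X, and the intermediate covers
   to the proper subspaces. Every edge-transitive group of automorphisms contains H,
   and Aut X is the union of the cosets of H by 1, kappa, rho and rho * kappa, the
   last one containing sigma. Hence semisymmetric means stable under H but neither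
   under kappa nor under rho.

   The central involution rho ^+ 4 splits the space into a 5-dimensional part, where
   it is trivial, and a 4-dimensional part, where it is -1. On the former kappa acts
   as an element of the group algebra of H, so a semisymmetric row space contains an
   H-stable plane U of the latter that is not stable under kappa. Either U is not
   stable under rho, and is minimal, or the row space also contains an H-eigenvector
   chi theta with theta ^+ 2 = -3, and then chi theta and U span a minimal space.
   The planes U are parametrized by the projective line if p = 1 mod 4 and by the
   conic a ^+ 2 + b ^+ 2 = -1 if p = 3 mod 4, where kappa and rho act as commuting
   involutions: the points without stabilizer give (A1), (A2) and (B1), those fixed
   by rho * kappa give (A3) and (B2), and those fixed by rho give (C) and (D). *)

From HB Require Import structures.
Require Import Defs.
From mathcomp Require Import all_boot all_algebra all_fingroup all_solvable.
From mathcomp Require Import mxabelem finfield.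
From mathcomp Require Import ring zify.

Set Implicit Arguments.
Unset Strict Implicit.
Unset Printing Implicit Defensive.

Import GRing.Theory.

Local Open Scope ring_scope.

(** * Regular coverings and voltages *)

(** The definitions quantify over arbitrary deck groups, lifting groups and intermediate graphs.
    Unique lifting makes all of this linear: a lift of the identity to a connected derived graph is
    a translation, an additive map over a prime field is a matrix, and a coboundary vanishes as soon
    as both voltages are trivial on the spanning tree [T]. The decomposition under H is not taken
    from character theory, because H has order 24 and [p = 3] is allowed. Every projection is an
    explicit identity in the group algebra whose only denominators are 2 and 4, checked on nine
    coordinates. Once a square root of -1 is available, the 4-dimensional part is two copies of a
    single plane. This is why its stable planes form a projective line; without that root the line
    appears as a conic, again with [p + 1] points. Since kappa and rho normalise H, they permute
    these planes. The congruences in the list say when the fixed points of these permutations, and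
    the eigenvector [chi theta], exist over [F_p]. *)

Definition locally_bijective (X : sgraph) (P : projection X) : Prop :=
  [/\ {homo P : u v / adj u v},
      (forall u x, adj (P u) x -> exists2 v, adj u v & P v = x) &
      (forall u v w, adj u v -> adj u w -> P v = P w -> v = w)].

(** With [locally_bijective] this is the working form of [covering_group]: the orbit conditions on
    arcs and edges become unique lifting of arcs, and the one on vertices becomes sharp transitivity
    on fibres. *)
Definition fibre_regular (X : sgraph) (P : projection X)
    (C : {set {perm cover_graph P}}) : Prop :=
  [/\ forall c u v, c \in C -> adj (c u) (c v) = adj u v,
      forall c v, c \in C -> c v = v -> c = 1%g &
      forall u v, P u = P v <-> exists2 c, c \in C & c u = v].

Lemma in_Aut_graph (X : sgraph) (a : {perm X}) :
  reflect (forall u v, adj (a u) (a v) = adj u v) (a \in Aut_graph X).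
Proof.
rewrite inE; apply: (iffP forallP) => [h u v | h u].
  by have /forallP/(_ v)/eqP := h u.
by apply/forallP => v; rewrite h.
Qed.

Section RegularCoverings.

Variables (X : sgraph) (P : projection X) (C : {group {perm cover_graph P}}).

Lemma orbit_permE (v w : cover_graph P) :
  reflect (exists2 c, c \in C & c v = w) (w \in orbit 'P C v).
Proof.
apply: (iffP idP) => [/orbitP[c cC <-] | [c cC <-]]; first by exists c.
by apply/orbitP; exists c.
Qed.

Lemma covering_group_fibre_regular :
  covering_group C -> fibre_regular (P := P) C.
Proof.
case=> [/subsetP sCA semi orb _ _]; split.
- by move=> c u v /sCA/in_Aut_graph.
- move=> c v cC cv; have : c \in ('C_C[v | 'P])%g.
    by rewrite in_setI cC; apply/astab1P.
  by rewrite semi => /set1gP.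
- move=> u v; split=> [Puv | [c cC <-]].
  + have : P @^-1: [set P v] \in [set P @^-1: [set x] | x : X] by exact: imset_f.
    rewrite -orb => /imsetP[w _ def_w].
    have : v \in orbit 'P C w by rewrite -def_w !inE.
    have : u \in orbit 'P C w by rewrite -def_w !inE Puv.
    move=> /orbit_permE[c cC <-] /orbit_permE[d dC <-].
    by exists (c^-1 * d)%g; rewrite ?groupM ?groupV // permM permK.
  + have : orbit 'P C u \in [set P @^-1: [set x] | x : X].
      by rewrite -orb; exact: imset_f.
    case/imsetP=> x _ def_x.
    have : u \in orbit 'P C u by exact: orbit_refl.
    have : c u \in orbit 'P C u by apply/orbit_permE; exists c.
    by rewrite def_x !inE => /eqP-> /eqP->.
Qed.

(** The fibre over an arc is a single orbit, so a lift found at one vertex can be moved to any other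
    vertex of the fibre. Two lifts starting at [u] differ by an element fixing [u], that is, by the
    identity. *)
Lemma covering_group_locally_bijective :
  epimorphism P -> covering_group C -> locally_bijective P.
Proof.
move=> [homP surjP] cgC; have [CA Cfree Cfib] := covering_group_fibre_regular cgC.
case: cgC => [_ _ _ arcC _].
have arc_trans u v u' v' : adj u v -> adj u' v' -> P u = P u' -> P v = P v' ->
    exists2 c, c \in C & (c u, c v) = (u', v').
  move=> uv uv' Pu Pv.
  have : arc_fibre P (P u, P v) \in [set arc_fibre P b | b in arcs X].
    by apply: imset_f; rewrite inE /=; exact: homP.
  rewrite -arcC => /imsetP[[x y] _ def_xy].
  have : (u, v) \in arc_orbit C (x, y) by rewrite -def_xy !inE /= uv eqxx.
  have : (u', v') \in arc_orbit C (x, y) by rewrite -def_xy !inE /= uv' Pu Pv eqxx.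
  case/imsetP=> c cC [-> ->] /imsetP[d dC [-> ->]].
  by exists (d^-1 * c)%g; rewrite ?groupM ?groupV // !permM !permK.
split=> // [u x ux | u v w uv uw Pvw].
- have : arc_fibre P (P u, x) \in [set arc_fibre P b | b in arcs X].
    by apply: imset_f; rewrite inE.
  rewrite -arcC => /imsetP[[y z] yz def_yz].
  have : (y, z) \in arc_orbit C (y, z).
    by apply/imsetP; exists 1%g; rewrite ?group1 // !perm1.
  rewrite -def_yz !inE /= => /andP[adj_yz /eqP[Py Pz]].
  have [c cC cy] : exists2 c, c \in C & c y = u by apply/Cfib.
  exists (c z); first by rewrite -cy CA.
  by rewrite -Pz; symmetry; apply/Cfib; exists c.
- have [c cC [cu cv]] := arc_trans _ _ _ _ uv uw erefl Pvw.
  by rewrite -cv (Cfree c u) // perm1.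
Qed.

(** An element of [C] that matches the tails of two lifts of one arc must match their heads, by
    unique lifting; hence arc and edge orbits fill whole fibres. *)
Lemma covering_group_intro :
  epimorphism P -> locally_bijective P -> fibre_regular (P := P) C ->
  covering_group C.
Proof.
move=> [homP surjP] [_ liftP uniqP] [CA Cfree Cfib].
have Cuniq c u v w : c \in C -> adj u v -> adj (c u) w -> P v = P w -> c v = w.
  move=> cC uv cuw Pvw; apply: (uniqP (c u)) => //; first by rewrite CA.
  by rewrite -Pvw; symmetry; apply/Cfib; exists c.
have CP c u : c \in C -> P (c u) = P u.
  by move=> cC; symmetry; apply/Cfib; exists c.
have orbE v : orbit 'P C v = P @^-1: [set P v].
  apply/setP => w; rewrite !inE; apply/orbit_permE/eqP => [[c cC <-]|].
    exact: CP.
  by move=> Pwv; apply/Cfib.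
split.
- by apply/subsetP => c cC; apply/in_Aut_graph => u v; exact: CA.
- move=> v; apply/trivgP/subsetP => c; rewrite inE => /andP[cC /astab1P cv].
  by rewrite (Cfree c v) ?group1.
- apply/setP => A; apply/imsetP/imsetP => [[v _ ->] | [x _ ->]].
    by exists (P v); rewrite ?orbE.
  by have [v <-] := surjP x; exists v; rewrite ?orbE.
- have arcE u v : adj u v -> arc_orbit C (u, v) = arc_fibre P (P u, P v).
    move=> uv; apply/setP => [[u' v']]; rewrite !inE /=; apply/imsetP/andP.
      by case=> c cC [-> ->]; rewrite CA // !CP.
    case=> uv' /eqP[Pu Pv].
    have [c cC cu] : exists2 c, c \in C & c u = u' by apply/Cfib.
    exists c => //=; rewrite cu; congr (_, _); symmetry.
    by apply: Cuniq uv _ _ => //; rewrite ?cu.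
  apply/setP => A; apply/imsetP/imsetP => [[[u v]] | [[x y]]].
    rewrite inE /= => uv ->; exists (P u, P v); rewrite ?arcE // inE.
    exact: homP.
  rewrite inE /= => xy ->; have [u Pu] := surjP x.
  have [|v uv Pv] := liftP u y; first by rewrite Pu.
  by exists (u, v); rewrite ?inE // arcE // Pu Pv.
- have edgeE u v : adj u v -> orbit ('P^*) C [set u; v] = edge_fibre P [set P u; P v].
    move=> uv; apply/setP => e; rewrite !inE; apply/orbitP/andP.
      case=> c cC <-; rewrite /= /setact imsetU1 imset_set1 /= !apermE; split.
        by apply/imsetP; exists (c u, c v); rewrite ?inE /= ?CA.
      by rewrite imsetU1 imset_set1 !CP.
    case=> /imsetP[[u' v']]; rewrite inE /= => uv' -> /eqP.
    rewrite imsetU1 imset_set1 => PP.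
    (* The lifted edge can be read in two directions. The ends of its image are distinct because [X]
       has no loops, so exactly one direction matches. *)
    wlog [Pu Pv] : u' v' uv' PP / P u' = P u /\ P v' = P v.
      move=> IH; have : P u' \in [set P u; P v] by rewrite -PP set21.
      have : P v' \in [set P u; P v] by rewrite -PP set22.
      have : P u' != P v' by apply: contraTneq (homP _ _ uv') => ->; rewrite adj_irrefl.
      rewrite !inE => ne /orP[]/eqP Pv /orP[]/eqP Pu; first by rewrite Pu Pv eqxx in ne.
      - by rewrite (setUC [set u']); apply: IH => //; rewrite 1?adj_sym // setUC.
      - exact: IH.
      - by rewrite Pu Pv eqxx in ne.
    have [c cC cu] : exists2 c, c \in C & c u = u' by apply/Cfib.
    exists c => //; rewrite /= /setact imsetU1 imset_set1 /= !apermE cu.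
    by congr [set _; _]; apply: Cuniq uv _ _ => //; rewrite ?cu.
  apply/setP => A; apply/imsetP/imsetP => [[e /imsetP[[u v]]] | [e /imsetP[[x y]]]].
    rewrite inE /= => uv -> ->; exists [set P u; P v]; rewrite ?edgeE //.
    by apply/imsetP; exists (P u, P v); rewrite ?inE //; exact: homP.
  rewrite inE /= => xy -> ->; have [u Pu] := surjP x.
  have [|v uv Pv] := liftP u y; first by rewrite Pu.
  exists [set u; v]; last by rewrite edgeE // Pu Pv.
  by apply/imsetP; exists (u, v); rewrite ?inE.
Qed.

End RegularCoverings.

(** The subset [K] is a parameter because the deck group of a quotient of a derived graph consists
    only of the translations by a kernel. Membership in [C] is returned explicitly, so that
    nontriviality and exponent can be read off. *)
Lemma covering_group_of_action (X : sgraph) (P : projection X)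
    (N : finZmodType) (t : N -> cover_graph P -> cover_graph P) (K : {set N}) :
  epimorphism P -> locally_bijective P ->
  (forall m n u, t (m + n) u = t m (t n u)) ->
  (forall n u v, adj (t n u) (t n v) = adj u v) ->
  (forall n u, t n u = u <-> n = 0) ->
  0 \in K -> (forall m n, m \in K -> n \in K -> m + n \in K) ->
  (forall u v, P u = P v <-> exists2 n, n \in K & t n u = v) ->
  exists2 C : {group {perm cover_graph P}}, covering_group C &
    forall c, c \in C <-> exists2 n, n \in K & c =1 t n.
Proof.
move=> epiP locP tD tadj tfree K0 KD tP.
have t0 u : t 0 u = u by apply/tfree.
have tK n : cancel (t n) (t (- n)) by move=> u; rewrite -tD addNr.
pose s n := perm (can_inj (tK n)).
pose C0 := [set s n | n in K].
have inC c : c \in C0 <-> exists2 n, n \in K & c =1 t n.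
  split=> [/imsetP[n nK ->] | [n nK cE]].
    by exists n => // u; rewrite permE.
  by apply/imsetP; exists n => //; apply/permP => u; rewrite permE cE.
have grpC : group_set C0.
  apply/group_setP; split; first by apply/inC; exists 0 => // u; rewrite perm1 t0.
  move=> c d /inC[m mK cE] /inC[n nK dE]; apply/inC; exists (n + m); first exact: KD.
  by move=> u; rewrite permM cE dE tD.
exists (Group grpC) => //; apply: covering_group_intro => //; split.
- by move=> c u v /inC[n _ cE]; rewrite !cE tadj.
- move=> c v /inC[n _ cE]; rewrite cE => /tfree n0.
  by apply/permP => u; rewrite cE n0 t0 perm1.
- move=> u v; split=> [/tP[n nK tu] | [c /inC[n nK cE] cu]].
    by exists (s n); rewrite ?permE //; apply/inC; exists n => // w; rewrite permE.
  by apply/tP; exists n => //; rewrite -cE.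
Qed.

(** Isomorphism over the identity of [X]. It preserves the lifting group itself and not only its
    conjugacy class, so lifting, transitivity and minimality transfer along it. *)
Definition equivalent_projections (X : sgraph) (P Q : projection X) : Prop :=
  exists2 b : cover_graph P -> cover_graph Q,
    graph_iso b & forall u, P u = Q (b u).

Lemma graph_iso_inv (X Y : sgraph) (b : X -> Y) : graph_iso b ->
  exists c : Y -> X, [/\ cancel b c, cancel c b & graph_iso c].
Proof.
move=> [[c bK cK] badj]; exists c; split=> //; split; first by exists b.
by move=> u v; rewrite -badj !cK.
Qed.

Lemma graph_iso_comp (X Y Z : sgraph) (b : X -> Y) (c : Y -> Z) :
  graph_iso b -> graph_iso c -> graph_iso (c \o b).
Proof.
move=> [bb ba] [cb ca]; split; first exact: bij_comp.
by move=> u v; rewrite /= ca ba.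
Qed.

Lemma graph_iso_connected (X Y : sgraph) (b : X -> Y) :
  graph_iso b -> connected_graph X -> connected_graph Y.
Proof.
move=> bI conX; have [c [bK cK [_ cadj]]] := graph_iso_inv bI.
case: bI => _ badj u v; rewrite -(cK u) -(cK v).
have /connectP[s + ->] := conX (c u) (c v).
elim: s (c u) => [x _ | y s IH x /andP[xy ys]] /=; first exact: connect0.
by apply: connect_trans (IH _ ys); apply: connect1; rewrite badj.
Qed.

Lemma connected_ind (X : sgraph) (S : X -> Prop) (u0 : X) :
  connected_graph X -> S u0 -> (forall u v, adj u v -> S u -> S v) ->
  forall u, S u.
Proof.
move=> con S0 step u; have /connectP[s + ->] := con u0 u.
by elim: s u0 S0 => //= y s IH x Sx /andP[xy]; apply: IH; apply: step Sx.
Qed.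

Lemma equivalent_sym (X : sgraph) (P Q : projection X) :
  equivalent_projections P Q -> equivalent_projections Q P.
Proof.
move=> [b bI PQ]; have [c [bK cK cI]] := graph_iso_inv bI.
by exists c => // u; rewrite PQ cK.
Qed.

Lemma equivalent_lifts (X : sgraph) (P Q : projection X) a :
  equivalent_projections P Q -> lifts P a -> lifts Q a.
Proof.
move=> [b bI PQ] /existsP[l /andP[/in_Aut_graph ladj /forallP lP]].
have [c [bK cK [cb cadj]]] := graph_iso_inv bI; case: bI => _ badj.
have inj_blc : injective (b \o l \o c).
  move=> u v /(can_inj bK)/perm_inj; exact: (can_inj cK).
apply/existsP; exists (perm inj_blc); apply/andP; split.
  by apply/in_Aut_graph => u v; rewrite !permE /= badj ladj cadj.
by apply/forallP => u; rewrite permE /= -PQ -(eqP (lP _)) PQ cK.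
Qed.

Lemma equivalent_edge_transitive (X : sgraph) (P Q : projection X) :
  equivalent_projections P Q -> edge_transitive P -> edge_transitive Q.
Proof.
move=> PQ [G [GA Gt Gl]]; exists G; split=> // a /Gl; exact: equivalent_lifts.
Qed.

Lemma equivalent_vertex_transitive (X : sgraph) (P Q : projection X) :
  equivalent_projections P Q -> vertex_transitive P -> vertex_transitive Q.
Proof.
move=> PQ [G [GA Gt Gl]]; exists G; split=> // a /Gl; exact: equivalent_lifts.
Qed.

Lemma equivalent_semisymmetric (X : sgraph) (P Q : projection X) :
  equivalent_projections P Q -> semisymmetric P -> semisymmetric Q.
Proof.
move=> PQ [eP nvP]; split; first exact: equivalent_edge_transitive eP.
by move=> vQ; apply: nvP; apply: equivalent_vertex_transitive (equivalent_sym PQ) vQ.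
Qed.

Lemma equivalent_trans_iso (X : sgraph) (P Q R : projection X) :
  equivalent_projections P Q -> isomorphic_projections Q R ->
  isomorphic_projections P R.
Proof.
move=> [b bI PQ] [a aA [c cI QR]]; exists a => //; exists (c \o b).
  exact: graph_iso_comp.
by move=> u; rewrite PQ QR.
Qed.

Lemma isomorphic_sym (X : sgraph) (P Q : projection X) :
  isomorphic_projections P Q -> isomorphic_projections Q P.
Proof.
move=> [a aA [b bI ab]]; have [c [bK cK cI]] := graph_iso_inv bI.
exists a^-1%g.
  by apply/in_Aut_graph => u v; rewrite -(in_Aut_graph _ aA) !permKV.
by exists c => // u; rewrite -[u in LHS]cK -ab permK.
Qed.

Lemma isomorphic_refl (X : sgraph) (P : projection X) : isomorphic_projections P P.
Proof.
exists 1%g; first by apply/in_Aut_graph => u v; rewrite !perm1.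
by exists id => [|u]; rewrite ?perm1 //; split=> //; exists id.
Qed.

Lemma isomorphic_trans (X : sgraph) (P Q R : projection X) :
  isomorphic_projections P Q -> isomorphic_projections Q R ->
  isomorphic_projections P R.
Proof.
move=> [a aA [b bI ab]] [a' aA' [b' bI' ab']]; exists (a * a')%g.
  by apply/in_Aut_graph => u v; rewrite !permM (in_Aut_graph _ aA') (in_Aut_graph _ aA).
exists (b' \o b); first exact: graph_iso_comp.
by move=> u; rewrite permM ab ab'.
Qed.

Lemma lifts1 (X : sgraph) (P : projection X) : lifts P 1%g.
Proof.
apply/existsP; exists 1%g; apply/andP; split.
  by apply/in_Aut_graph => u v; rewrite !perm1.
by apply/forallP => u; rewrite !perm1.
Qed.

Lemma liftsM (X : sgraph) (P : projection X) a b :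
  lifts P a -> lifts P b -> lifts P (a * b)%g.
Proof.
move=> /existsP[l /andP[/in_Aut_graph lA /forallP al]].
move=> /existsP[m /andP[/in_Aut_graph mA /forallP bm]].
apply/existsP; exists (l * m)%g; apply/andP; split.
  by apply/in_Aut_graph => u v; rewrite !permM mA lA.
by apply/forallP => u; rewrite !permM (eqP (al u)) (eqP (bm _)).
Qed.

Lemma Aut_graph1 (X : sgraph) : 1%g \in Aut_graph X.
Proof. by apply/in_Aut_graph => u v; rewrite !perm1. Qed.

Lemma Aut_graphM (X : sgraph) a b :
  a \in Aut_graph X -> b \in Aut_graph X -> (a * b)%g \in Aut_graph X.
Proof.
by move=> /in_Aut_graph aA /in_Aut_graph bA; apply/in_Aut_graph => u v; rewrite !permM bA aA.
Qed.

Lemma lifts_group_set (X : sgraph) (P : projection X) :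
  group_set (largest_lifting_group P).
Proof.
apply/group_setP; split; first by apply/setIdP; rewrite Aut_graph1 lifts1.
by move=> a b /setIdP[aA la] /setIdP[bA lb]; apply/setIdP; rewrite liftsM ?Aut_graphM.
Qed.

Section Derived.

Variables (X : sgraph) (N : finZmodType) (zeta : voltage X N).

Let P := derived_projection zeta.

Lemma cov_adjE (a b : Cov zeta) :
  adj a b = adj a.1 b.1 && (b.2 == a.2 + zeta a.1 b.1).
Proof. by []. Qed.

Lemma derived_epimorphism : epimorphism P.
Proof. by split=> [a b /andP[] | x] //; exists (x, 0). Qed.

Lemma derived_locally_bijective : locally_bijective P.
Proof.
split=> [a b /andP[] // | u x ux | [u a] [v b] [w c]].
  by exists (x, u.2 + zeta u.1 x); rewrite // cov_adjE /= ux eqxx.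
by rewrite !cov_adjE /= => /andP[_ /eqP->] /andP[_ /eqP->] ->.
Qed.

Definition transl (n : N) (a : Cov zeta) : Cov zeta := (a.1, n + a.2).

Lemma transl_adj n a b : adj (transl n a) (transl n b) = adj a b.
Proof. by rewrite !cov_adjE /= -addrA (inj_eq (addrI n)). Qed.

Lemma derived_elementary_abelian (x0 : X) p : prime p ->
  (exists n : N, n != 0) -> (forall n : N, n *+ p = 0) ->
  elementary_abelian_covering p P.
Proof.
move=> pr_p [n n0] Np; split; first exact: derived_epimorphism.
have [||||||C cC inC] := @covering_group_of_action X P N transl [set: N]
   derived_epimorphism derived_locally_bijective.
- by move=> m k [u a]; rewrite /transl /= addrA.
- exact: transl_adj.
- move=> m [u a]; rewrite /transl /=; split=> [[] /(canRL (addrK a)) | ->].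
    by rewrite subrr.
  by rewrite add0r.
- by rewrite inE.
- by move=> m k _ _; rewrite inE.
- move=> [u a] [v b]; split=> /= [-> | [m _ [-> //]]].
  by exists (b - a); rewrite ?inE // /transl /= subrK.
have trI (m : N) : exists2 c, c \in C & c =1 transl m.
  have tK : cancel (transl m) (transl (- m)).
    by move=> [u a]; rewrite /transl /= addKr.
  exists (perm (can_inj tK)); last by move=> u; rewrite permE.
  by apply/inC; exists m; rewrite ?inE // => u; rewrite permE.
exists C; split=> //.
  have [c cC' cE] := trI n; apply: contra n0 => /eqP C1; move: cC'.
  rewrite C1 => /set1gP c1; move: cE; rewrite c1.
  by move=> /(_ (x0, 0)); rewrite perm1 /transl /= addr0 => -[<-].
rewrite abelemE //; apply/andP; split.
  apply/centsP => c /inC[m _ cE] d /inC[k _ dE]; apply/permP => u.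
  by rewrite !permM !cE !dE /transl /= addrCA.
apply/exponentP => c /inC[m _ cE]; apply/permP => -[u a]; rewrite perm1.
have cX k : (c ^+ k)%g (u, a) = (u, m *+ k + a).
  elim: k => [|k IH]; first by rewrite expg0 perm1 mulr0n add0r.
  by rewrite expgSr permM IH cE /transl /= mulrS addrA.
by rewrite cX Np add0r.
Qed.

End Derived.

(** Uniqueness of the lift of one arc propagates along paths from [y0]. *)
Lemma lift_unique (X Y : sgraph) (P : projection X)
    (h k : Y -> cover_graph P) (y0 : Y) :
  locally_bijective P -> connected_graph Y ->
  {homo h : u v / adj u v} -> {homo k : u v / adj u v} ->
  (forall y, P (h y) = P (k y)) -> h y0 = k y0 -> h =1 k.
Proof.
move=> [_ _ uniqP] conY homh homk Phk hk0.
apply: (connected_ind (u0 := y0)) => // u v uv hku.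
by apply: (uniqP (h u)); [exact: homh | rewrite hku; exact: homk | exact: Phk].
Qed.

(** The covering group is conjugated by [b]. This carries a decomposition over to an equivalent
    projection. *)
Lemma nontrivial_covering_comp (X Y : sgraph) (P : projection X)
    (b : Y -> cover_graph P) :
  graph_iso b -> nontrivial_regular_covering P ->
  nontrivial_regular_covering (Projection (P \o b)).
Proof.
move=> bI [epiP [C [cgC C1]]].
have [CA Cfree Cfib] := covering_group_fibre_regular cgC.
have [homP liftP uniqP] := covering_group_locally_bijective epiP cgC.
have [b' [bK b'K [_ b'adj]]] := graph_iso_inv bI; case: bI => _ badj.
pose D0 := [set c : {perm Y} | [exists d in C, [forall u, b (c u) == d (b u)]]].
have inD (c : {perm Y}) : reflect (exists2 d : {perm cover_graph P}, d \in C & forall u, b (c u) = d (b u)) (c \in D0).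
  rewrite inE; apply: (iffP existsP) => [[d /andP[dC /forallP h]] | [d dC h]].
    by exists d => // u; exact/eqP.
  by exists d; rewrite dC; apply/forallP => u; rewrite h.
have conj d : d \in C -> exists2 c : {perm Y}, c \in D0 & forall u, b (c u) = d (b u).
  move=> dC; have inj : injective (b' \o d \o b).
    by move=> u v /(can_inj b'K)/perm_inj/(can_inj bK).
  have cE u : b (perm inj u) = d (b u) by rewrite permE /= b'K.
  by exists (perm inj) => //; apply/inD; exists d.
have grpD : group_set D0.
  apply/group_setP; split.
    by apply/inD; exists 1%g => [|u]; rewrite ?group1 ?perm1.
  move=> c d /inD[c' cC cE] /inD[d' dC dE]; apply/inD; exists (c' * d')%g.
    exact: groupM.
  by move=> u; rewrite !permM dE cE.
have epi : epimorphism (Projection (P \o b)).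
  split=> [u v uv | x] /=; first by apply: homP; rewrite badj.
  by have [_ /(_ x)[u <-]] := epiP; exists (b' u); rewrite b'K.
split=> //; exists (Group grpD); split.
  apply: covering_group_intro => //.
    split; first by case: epi.
      move=> u x /liftP[v uv <-]; exists (b' v); last by rewrite /= b'K.
      by rewrite -[u]bK b'adj.
    move=> u v w uv uw /= Pvw; apply: (can_inj bK).
    by apply: (uniqP (b u)); rewrite ?badj.
  split.
  - by move=> c u v /inD[d dC cE]; rewrite -badj !cE CA // badj.
  - move=> c v /inD[d dC cE] cv; have d1 : d = 1%g.
      by apply: (Cfree d (b v)) => //; rewrite -cE cv.
    by apply/permP => u; apply: (can_inj bK); rewrite cE d1 !perm1.
  - move=> u v; split=> /= [/Cfib[d /conj[c cD cE] du] | [c /inD[d dC cE] <-]].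
      by exists c => //; apply: (can_inj bK); rewrite cE.
    by apply/Cfib; exists d; rewrite // cE.
apply: contra C1 => /eqP D1; rewrite -subG1; apply/subsetP => d /conj[c + cE].
rewrite -[D0]/(gval (Group grpD)) D1 => /set1gP c1.
by apply/set1gP/permP => u; rewrite perm1 -[u]b'K -cE c1 perm1.
Qed.

(** * Isomorphisms and quotients of derived graphs *)

Section CompareDerived.

Variables (X : sgraph) (N N' : finZmodType).
Variables (zeta : voltage X N) (zeta' : voltage X N').

(** An isomorphism over [a] carries translations to translations, so it is determined by an additive
    map [g] and by the images [f] of the zero section; the equation between voltages then holds up
    to the coboundary of [f]. *)
Lemma derived_iso_cocycle (x0 : X) (a : X -> X) (b : Cov zeta -> Cov zeta') :
  connected_graph (Cov zeta) -> graph_iso b ->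
  (forall u : Cov zeta, a u.1 = (b u).1) ->
  exists g : N -> N', exists f : X -> N',
    [/\ forall m n, g (m + n) = g m + g n, injective g &
        forall u v, adj u v -> zeta' (a u) (a v) = g (zeta u v) + f v - f u].
Proof.
move=> con [bb badj] ab; have bE u n : b (u, n) = (a u, (b (u, n)).2).
  by rewrite [in RHS](ab (u, n)); case: (b _).
pose g n := (b (x0, n)).2 - (b (x0, 0)).2; pose f u := (b (u, 0)).2.
(* Both sides lift the same map to [X] and agree at [(x0, 0)], so [lift_unique] identifies them. *)
have key n (u : Cov zeta) : b (transl n u) = transl (g n) (b u).
  apply: (@lift_unique _ _ (derived_projection zeta')
    (fun u => b (transl n u)) (fun u => transl (g n) (b u)) (x0, 0)) => //.
  - exact: derived_locally_bijective.
  - by move=> v w vw; rewrite badj transl_adj.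
  - by move=> v w vw; rewrite transl_adj badj.
  - by move=> [v m]; rewrite /= -!ab.
  - by rewrite /transl /= addr0 /g subrK -ab -bE.
have bg u n : (b (u, n)).2 = g n + f u.
  by have /(congr1 snd) := key n (u, 0); rewrite /transl /= addr0.
have g0 n : g n = (b (x0, n)).2 - f x0 by [].
exists g, f; split.
- move=> m n; have := congr1 snd (key m (x0, n)).
  by rewrite /transl /= bg [in RHS]bg addrA => /addIr.
- move=> m n gmn; have : b (x0, m) = b (x0, n) by rewrite bE [RHS]bE !bg gmn.
  by move/(bij_inj bb) => [].
- move=> u v uv; have : adj (b (u, 0)) (b (v, zeta u v)).
    by rewrite badj cov_adjE /= uv add0r eqxx.
  rewrite cov_adjE -!ab /= => /andP[_ /eqP]; rewrite bg => ->.
  by rewrite /f addrC addKr.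
Qed.

(** The isomorphism sends [(u, n)] to [(a u, g n + f u)]. *)
Lemma cocycle_derived_iso (a : {perm X}) (g : N -> N') (f : X -> N') :
  a \in Aut_graph X -> (forall m n, g (m + n) = g m + g n) -> bijective g ->
  (forall u v, adj u v -> zeta' (a u) (a v) = g (zeta u v) + f v - f u) ->
  exists2 b : Cov zeta -> Cov zeta', graph_iso b &
    forall u : Cov zeta, a u.1 = (b u).1.
Proof.
move=> /in_Aut_graph aA gD [g' gK g'K] eqz.
exists (fun u : Cov zeta => (a u.1, g u.2 + f u.1)) => //; split.
  exists (fun w : Cov zeta' => (a^-1%g w.1, g' (w.2 - f (a^-1%g w.1)))).
    by move=> [u n] /=; rewrite permK addrK gK.
  by move=> [w n] /=; rewrite permKV g'K subrK.
move=> [u m] [v n]; rewrite !cov_adjE /= aA; apply: andb_id2l => uv.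
by rewrite eqz // -addrA [f u + _]addrC subrK addrA (inj_eq (addIr _)) -gD (can_eq gK).
Qed.

(** The deck transformations are the translations by the kernel of [g], which is nonzero by
    hypothesis. *)
Lemma derived_quotient (x0 : X) (g : N -> N') :
  (forall m n, g (m + n) = g m + g n) -> (forall w, exists n, g n = w) ->
  (exists2 n, n != 0 & g n = 0) ->
  (forall u v, adj u v -> zeta' u v = g (zeta u v)) ->
  nontrivial_regular_covering (@Projection (Cov zeta') (Cov zeta)
     (fun u : Cov zeta => (u.1, g u.2))).
Proof.
move=> gD gsurj [n n0 gn] eqz; have g0 : g 0 = 0.
  by apply: (addrI (g 0)); rewrite -gD !addr0.
set Q := Projection _; have epi : epimorphism Q.
  split=> [u v /andP[uv /eqP E] | [x w]] /=.
    by apply/andP; rewrite /= uv E eqz // gD.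
  by have [m <-] := gsurj w; exists (x, m).
have loc : locally_bijective Q.
  split; first by case: epi.
    move=> [u m] [v w] /andP[/= uv /eqP->].
    by exists (v, m + zeta u v); [apply/andP; rewrite /= uv eqxx | rewrite /= gD eqz].
  by move=> [u m] [v k] [w l] /andP[_ /eqP/= ->] /andP[_ /eqP/= ->] [->].
have [||||||C cC inC] := @covering_group_of_action _ Q N (@transl X N zeta) [set m | g m == 0] epi loc.
- by move=> m k [u l]; rewrite /transl /= addrA.
- exact: transl_adj.
- move=> m [u l]; rewrite /transl /=; split=> [[] /(canRL (addrK l)) | ->].
    by rewrite subrr.
  by rewrite add0r.
- by rewrite inE g0.
- by move=> m k; rewrite !inE gD => /eqP-> /eqP->; rewrite addr0.
- move=> [u l] [v k]; split=> /= [[-> gE] | [m]].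
    exists (k - l); last by rewrite /transl /= subrK.
    by rewrite inE; apply/eqP/(addIr (g l)); rewrite -gD subrK add0r.
  by rewrite inE => /eqP gm [-> <-]; rewrite gD gm add0r.
split=> //; exists C; split=> //.
have tK : cancel (@transl X N zeta n) (@transl X N zeta (- n)).
  by move=> [u l]; rewrite /transl /= addKr.
have cC' : perm (can_inj tK) \in C.
  by apply/inC; exists n; [rewrite inE gn | move=> u; rewrite permE].
apply: contra n0 => /eqP C1; move: cC'; rewrite C1 => /set1gP /permP/(_ (x0, 0)).
by rewrite permE perm1 /transl /= addr0 => -[->].
Qed.

End CompareDerived.

Lemma inj_surj_bij (S T : finType) (f : S -> T) :
  injective f -> (forall y, exists x, f x = y) -> bijective f.
Proof.
move=> injf surjf; have ex y : exists x, f x == y.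
  by have [x <-] := surjf y; exists x.
exists (fun y => xchoose (ex y)) => [x | y]; last exact/eqP/(xchooseP (ex y)).
by apply: injf; exact/eqP/(xchooseP (ex (f x))).
Qed.

(** A base vertex [s x] is chosen in every fibre; the voltage of an arc from [x] to [y] is the
    unique [n] for which [s x] is adjacent to [t n (s y)]. *)
Lemma derived_of_action (X : sgraph) (P : projection X)
    (N : finZmodType) (t : N -> cover_graph P -> cover_graph P) :
  epimorphism P -> locally_bijective P ->
  (forall m n u, t (m + n) u = t m (t n u)) ->
  (forall n u v, adj (t n u) (t n v) = adj u v) ->
  (forall n u, t n u = u -> n = 0) -> (forall u, t 0 u = u) ->
  (forall u v, P u = P v <-> exists n, t n u = v) ->
  exists zeta : voltage X N, equivalent_projections P (derived_projection zeta).
Proof.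
move=> [homP surjP] [_ liftP uniqP] tD tadj tfree t0 tP.
have ex x : exists u, P u == x by have [u <-] := surjP x; exists u.
pose s x := xchoose (ex x); have Ps x : P (s x) = x by exact/eqP/(xchooseP (ex x)).
have Pt n u : P (t n u) = P u by symmetry; apply/tP; exists n.
have tinj m n u : t m u = t n u -> m = n.
  move=> mn; apply/eqP; rewrite -subr_eq0; apply/eqP/(tfree _ (t n u)).
  by rewrite -tD subrK mn.
(* The default 0 is used only for nonadjacent [x] and [y], where voltages are irrelevant. *)
pose z x y := odflt 0 [pick n | adj (s x) (t n (s y))].
have zP x y : adj x y -> adj (s x) (t (z x y) (s y)).
  move=> xy; rewrite /z; case: pickP => //= no.
  have [|v sv Pv] := liftP (s x) y; first by rewrite Ps.
  have [n def_v] : exists n, t n (s y) = v by apply/tP; rewrite Ps.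
  by rewrite -def_v in sv; rewrite no in sv.
have zU x y n : adj x y -> adj (s x) (t n (s y)) -> n = z x y.
  move=> xy an; apply: (tinj _ _ (s y)); apply: uniqP an (zP _ _ xy) _.
  by rewrite !Pt.
have zN x y : adj x y -> z y x = - z x y.
  move=> xy; symmetry; apply: zU; first by rewrite adj_sym.
  by rewrite -(tadj (z x y)) -tD subrr t0 adj_sym zP.
exists (Voltage zN); apply: equivalent_sym.
exists (fun u : Cov (Voltage zN) => t u.2 (s u.1)); last by move=> u; rewrite Pt Ps.
split.
  apply: inj_surj_bij => [[x m] [y n] /= mn | v].
    have /= xy := congr1 (@proj _ P) mn; rewrite !Pt !Ps in xy; rewrite -xy in mn *.
    by rewrite (tinj _ _ _ mn).
  have [n <-] : exists n, t n (s (P v)) = v by apply/tP; rewrite Ps.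
  by exists (P v, n).
move=> [x m] [y n] /=; apply/idP/andP => /= [a | [xy /eqP->]]; last first.
  by rewrite tD tadj zP.
have xy : adj x y by have := homP _ _ a; rewrite !Pt !Ps.
split=> //; rewrite -(zU x y (n - m)) //; first by rewrite addrC subrK.
by rewrite -(tadj m) -tD addrC subrK.
Qed.

Lemma elementary_abelian_derived (p : nat) (X : sgraph) (P : projection X) :
  prime p -> elementary_abelian_covering p P ->
  exists d (zeta : voltage X 'cV['F_p]_d),
    equivalent_projections P (derived_projection zeta).
Proof.
move=> pr_p [epiP [C [cgC C1 abC]]].
have [CA Cfree Cfib] := covering_group_fibre_regular cgC.
have locP := covering_group_locally_bijective epiP cgC.
exists ('dim C)%g; pose t (n : 'cV['F_p]_('dim C)) := rVabelem abC C1 n^T.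
have tC n : t n \in C by exact: mem_rVabelem.
have tD m n : t (m + n) = (t m * t n)%g by rewrite /t linearD /= rVabelemD.
have t0 : t 0 = 1%g by rewrite /t trmx0 rVabelem0.
apply: (@derived_of_action X P _ t) => //.
- by move=> m n u; rewrite addrC tD permM.
- by move=> n u v; exact: CA.
- move=> n u tn; have : t n = 1%g by exact: Cfree tn.
  by rewrite -t0 => /rVabelem_inj/trmx_inj.
- by move=> u; rewrite t0 perm1.
- move=> u v; split=> [/Cfib[c cC <-] | [n <-]].
    exists (abelem_rV abC C1 c)^T; rewrite /t trmxK.
    by rewrite abelem_rV_K.
  by apply/Cfib; exists (t n).
Qed.

(** * Intermediate covers as quotients by subspaces *)

Section PrimeField.

Variable p : nat.
Local Notation F := 'F_p.

Lemma additive_mulmx (d d' : nat) (g : 'cV[F]_d -> 'cV[F]_d') :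
  (forall m n, g (m + n) = g m + g n) -> exists A : 'M[F]_(d', d), g =1 mulmx A.
Proof.
move=> gD; have g0 : g 0 = 0 by apply: (addrI (g 0)); rewrite -gD !addr0.
have gMn x n : g (x *+ n) = g x *+ n.
  by elim: n => [|n IH]; rewrite ?mulr0n // !mulrS gD IH.
have gZ c x : g (c *: x) = c *: g x by rewrite -[c]natr_Zp !scaler_nat gMn.
exists (\matrix_(i, j) g (delta_mx j 0) i 0) => x.
rewrite [x in LHS]matrix_sum_delta (big_morph g gD g0); apply/colP => i.
rewrite summxE mxE; apply: eq_bigr => j _.
by rewrite big_ord_recl big_ord0 addr0 gZ !mxE mulrC.
Qed.

(** Over a prime field closure under addition already gives a subspace. The rows of [B] are a basis
    of its annihilator, so its kernel is exactly [K]. *)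
Lemma additive_subgroup_kernel (d : nat) (K : {set 'cV[F]_d}) :
  0 \in K -> (forall m n, m \in K -> n \in K -> m + n \in K) ->
  exists d' (B : 'M[F]_(d', d)), row_free B /\ forall n, (B *m n == 0) = (n \in K).
Proof.
move=> K0 KD; pose M : 'M[F]_(#|K|, d) := \matrix_(k, j) (enum_val k : 'cV[F]_d) j 0.
pose B0 := (cokermx M)^T; exists (\rank B0), (row_base B0).
split=> [|n]; first exact: row_base_free.
have KZ c m : m \in K -> c *: m \in K.
  move=> mK; rewrite -[c]natr_Zp scaler_nat; elim: (c : nat) => [|k IH].
    by rewrite mulr0n.
  by rewrite mulrS KD.
have BE (m : 'cV[F]_d) : (row_base B0 *m m == 0) = (B0 *m m == 0).
  apply/eqP/eqP => [h | h].
    have /submxP[D ->] : (B0 <= row_base B0)%MS by rewrite eq_row_base.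
    by rewrite -mulmxA h mulmx0.
  have /submxP[D ->] : (row_base B0 <= B0)%MS by rewrite eq_row_base.
  by rewrite -mulmxA h mulmx0.
rewrite BE; have -> : (B0 *m n == 0) = (n^T <= M)%MS.
  by rewrite submxE -(inj_eq trmx_inj) trmx0 trmx_mul trmxK.
apply/idP/idP => [/submxP[D def_n] | nK].
  have -> : n = \sum_k D 0 k *: (enum_val k : 'cV[F]_d).
    rewrite -[n]trmxK def_n; apply/colP => j; rewrite mxE mxE summxE.
    by apply: eq_bigr => k _; rewrite !mxE.
  apply: (big_ind (fun m => m \in K)) => // k _; exact/KZ/enum_valP.
have -> : n^T = row (enum_rank_in nK n) M.
  by apply/rowP => j; rewrite !mxE enum_rankK_in.
exact: row_sub.
Qed.

(** An arbitrary graph [Y] between [Cov zeta] and [X] is shown to be a derived graph: the deck group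
    of [g] is the translation group of a subspace, and [Y] is the quotient by it. Nontriviality of
    [f] and of [g] gives the two strict bounds on [d']. *)
Lemma derived_decomposition (X : sgraph) (x0 : X) (d : nat) (zeta : voltage X 'cV[F]_d)
    (Y : sgraph) (g : Cov zeta -> Y) (f : Y -> X) :
  connected_graph (Cov zeta) ->
  nontrivial_regular_covering (Projection g) ->
  nontrivial_regular_covering (Projection f) ->
  derived_projection zeta =1 f \o g ->
  exists d' (B : 'M[F]_(d', d)), [/\ row_free B, (0 < d' < d)%N &
    forall zeta' : voltage X 'cV[F]_d',
      (forall u v, adj u v -> zeta' u v = B *m zeta u v) ->
      equivalent_projections (Projection f) (derived_projection zeta')].
Proof.
move=> con [epig [Cg [cgCg Cg1]]] [epif [Cf [cgCf Cf1]]] fg.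
have [CgA Cgfree Cgfib] := covering_group_fibre_regular cgCg.
have [homg liftg uniqg] := covering_group_locally_bijective epig cgCg.
have [CfA Cffree Cffib] := covering_group_fibre_regular cgCf.
have fgE u : f (g u) = u.1 := esym (fg u).
(* A deck transformation of [g] covers the identity of [X], so unique lifting makes it the
   translation by the displacement of [(x0, 0)]. *)
have CgT c : c \in Cg -> c =1 transl (c (x0, 0)).2.
  move=> cC; have c1 u : (c u).1 = u.1.
    by rewrite -!fgE; congr f; symmetry; apply/(Cgfib u (c u)); exists c.
  apply: (@lift_unique X (Cov zeta) (derived_projection zeta)
    (fun u => c u) (transl (c (x0, 0)).2) (x0, 0)) => //.
  - exact: derived_locally_bijective.
  - by move=> u v uv; rewrite CgA.
  - by move=> u v uv; rewrite transl_adj.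
  - by rewrite /transl /= addr0 [LHS]surjective_pairing c1.
pose K := [set n : 'cV[F]_d | [exists c in Cg, [forall u, c u == transl n u]]].
have inK n : reflect (exists2 c : {perm Cov zeta}, c \in Cg & c =1 transl n) (n \in K).
  rewrite inE; apply: (iffP existsP) => [[c /andP[cC /forallP h]] | [c cC h]].
    by exists c => // u; exact/eqP.
  by exists c; rewrite cC; apply/forallP => u; rewrite h.
have gE u v : g u = g v <-> u.1 = v.1 /\ v.2 - u.2 \in K.
  split=> [/Cgfib[c cC <-] | [uv1 /inK[c cC cE]]].
    rewrite (CgT c cC) /transl /= addrK; split=> //.
    by apply/inK; exists c => //; exact: CgT.
  apply/Cgfib; exists c => //; rewrite cE /transl subrK uv1.
  by rewrite -surjective_pairing.
have [||d' [B [freeB BK]]] := @additive_subgroup_kernel d K.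
- by apply/inK; exists 1%g; rewrite ?group1 // => -[u a]; rewrite perm1 /transl /= add0r.
- move=> m n /inK[c cC cE] /inK[e eC eE]; apply/inK; exists (e * c)%g.
    exact: groupM.
  by move=> [u a]; rewrite permM eE cE /transl /= addrA.
have gB u v : g u = g v <-> u.1 = v.1 /\ B *m u.2 = B *m v.2.
  split=> [/gE[-> k] | [uv1 uv2]]; [split=> // | apply/gE; split=> //].
    by symmetry; apply/eqP; rewrite -subr_eq0 -mulmxBr BK.
  by rewrite -BK mulmxBr uv2 subrr.
exists d', B; split=> //.
- apply/andP; split.
    rewrite lt0n; apply: contra Cf1 => /eqP d0; rewrite -subG1.
    apply/subsetP => c cC; apply/set1gP/(Cffree c (g (x0, 0))) => //.
    have [u gu] : exists u, g u = c (g (x0, 0)) by case: epig => _; exact.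
    rewrite -gu; apply/gB; split.
      rewrite -fgE gu -[RHS](fgE (x0, 0)).
      by symmetry; apply/(Cffib (g (x0,0))); exists c.
    by apply/colP => -[k k_lt]; exfalso; move: k_lt; rewrite d0.
  rewrite ltn_neqAle; have := rank_leq_col B.
  have /eqP rB := freeB; rewrite rB => -> /[!andbT].
  apply: contra Cg1 => /eqP dd; rewrite -subG1; apply/subsetP => c cC.
  have full : row_free B^T by rewrite /row_free mxrank_tr rB dd.
  apply/set1gP/permP => u; rewrite perm1 (CgT c cC) /transl.
  have : (c (x0, 0)).2 \in K by apply/inK; exists c => //; exact: CgT.
  rewrite -BK -(inj_eq trmx_inj) trmx_mul trmx0 mulmx_free_eq0 //.
  by rewrite -(inj_eq trmx_inj) trmxK trmx0 => /eqP->; rewrite add0r -surjective_pairing.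
move=> zeta' def_z.
have ex y : exists u, g u == y by have [_ /(_ y)[u <-]] := epig; exists u.
pose s y := xchoose (ex y); have gs y : g (s y) = y by exact/eqP/(xchooseP (ex y)).
(* The maps [q] and [g] have the same fibres, so [q] composed with a section of [g] identifies [Y]
   with [Cov zeta']. *)
pose q (u : Cov zeta) : Cov zeta' := (u.1, B *m u.2).
have qg u : q (s (g u)) = q u.
  by have /gB[e1 e2] := gs (g u); rewrite /q e1 e2.
have qhom u v : adj u v -> adj (q u) (q v).
  by move=> /andP[uv /eqP E]; apply/andP; rewrite /= uv def_z // E mulmxDr.
have qgE u v : q u = q v -> g u = g v by move=> [E1 E2]; apply/gB.
exists (fun y => q (s y)); last by move=> y; rewrite -[y in LHS]gs /= fgE.
split.
  apply: inj_surj_bij => [y y' /qgE | [x w]]; first by rewrite !gs.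
  by exists (g (x, pinvmx B *m w)); rewrite qg /q /= mulmxA mulmxVp // mul1mx.
move=> y y'; apply/idP/idP => [/andP[/= xx /eqP/= E] | yy].
  rewrite -[y]gs -[y']gs; pose v : Cov zeta := ((s y').1, (s y).2 + zeta (s y).1 (s y').1).
  have <- : g v = g (s y') by apply/gB; rewrite /= E mulmxDr def_z.
  by apply: homg; apply/andP; rewrite /= xx.
have [|v sv gv] := liftg (s y) y'; first by rewrite /= gs.
by rewrite -gv qg; exact: qhom.
Qed.

End PrimeField.

(** * Minimality in terms of matrices *)

Section Minimality.

Variable X : sgraph.

Definition equivalence_invariant (Phi : projection X -> Prop) : Prop :=
  forall P Q, equivalent_projections P Q -> Phi P -> Phi Q.

Lemma equivalent_minimal (Phi : projection X -> Prop) P Q :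
  equivalence_invariant Phi -> equivalent_projections P Q ->
  minimal_for Phi P -> minimal_for Phi Q.
Proof.
move=> inv PQ [PhiP minP]; split; first exact: inv PhiP.
move=> [Y [g [f [ntg ntf Qfg PhiF]]]]; apply: minP.
have [b bI bE] := PQ; exists Y, (g \o b), f; split=> //.
  exact: (nontrivial_covering_comp (P := Projection g)).
by move=> u; rewrite bE Qfg.
Qed.

Lemma elementary_abelian_nontrivial p (P : projection X) :
  elementary_abelian_covering p P -> nontrivial_regular_covering P.
Proof. by move=> [epi [C [cgC C1 _]]]; split=> //; exists C. Qed.

Variables (x0 : X) (p : nat).
Hypothesis pr_p : prime p.

Lemma derived_mx_elementary_abelian d (zeta : voltage X 'cV['F_p]_d) :
  (0 < d)%N -> elementary_abelian_covering p (derived_projection zeta).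
Proof.
case: d zeta => // d zeta _; apply: derived_elementary_abelian => // [|n].
  exists (const_mx 1); apply/eqP => /colP/(_ ord0)/eqP.
  by rewrite !mxE oner_eq0.
by apply/colP => i; rewrite mulmxnE [RHS]mxE -mulr_natr (pcharf0 (pchar_Fp pr_p)) mulr0.
Qed.

Lemma minimal_derived (Phi : projection X -> Prop) d
    (zeta : voltage X 'cV['F_p]_d) :
  equivalence_invariant Phi -> connected_graph (Cov zeta) ->
  minimal_for Phi (derived_projection zeta) <->
  Phi (derived_projection zeta) /\
  forall d' (B : 'M['F_p]_(d', d)) (zeta' : voltage X 'cV['F_p]_d'),
    row_free B -> (0 < d' < d)%N ->
    (forall u v, adj u v -> zeta' u v = B *m zeta u v) ->
    ~ Phi (derived_projection zeta').
Proof.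
move=> inv con; split=> -[PhiZ minZ]; split=> //.
  move=> d' B zeta' freeB /andP[d'0 d'd] def_z PhiZ'; apply: minZ.
  exists (Cov zeta'), (fun u : Cov zeta => (u.1, B *m u.2)), (derived_projection zeta').
  split=> //; last first.
    exact/elementary_abelian_nontrivial/derived_mx_elementary_abelian.
  apply: (derived_quotient x0) => //.
  - by move=> m n; rewrite mulmxDr.
  - by move=> w; exists (pinvmx B *m w); rewrite mulmxA mulmxVp // mul1mx.
  - have : ~~ row_free B^T.
      by rewrite /row_free mxrank_tr (eqP freeB) neq_ltn d'd.
    rewrite -kermx_eq0 => /rowV0Pn[v /sub_kermxP vB v0]; exists v^T.
      by rewrite -(inj_eq trmx_inj) trmxK trmx0.
    by rewrite -[B]trmxK -trmx_mul vB trmx0.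
move=> [Y [g [f [ntg ntf Qfg PhiF]]]].
have [d' [B [freeB d'd eqv]]] := derived_decomposition x0 con ntg ntf Qfg.
have vN u v : adj u v -> B *m zeta v u = - (B *m zeta u v).
  by move=> uv; rewrite (voltN _ uv) mulmxN.
apply: (minZ d' B (Voltage vN)) => //.
by apply: inv PhiF; exact: eqv.
Qed.

End Minimality.

(** * Automorphisms of the Moebius-Kantor graph *)

Section AutomorphismTables.

Local Open Scope nat_scope.

Definition gp_edges : seq (nat * nat) := outer_edges ++ spokes ++ inner_edges.

(* Zero-based labels, as for the ordinals. *)
Definition gp_nbrs : seq (seq nat) :=
  [seq [seq b <- iota 0 16 | ((a.+1, b.+1) \in gp_edges) || ((b.+1, a.+1) \in gp_edges)]
     | a <- iota 0 16].

Definition gp_adj (a b : nat) : bool := b \in nth [::] gp_nbrs a.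

Lemma gp_adjE (u v : GP83) : gp_adj u v = adj u v.
Proof.
rewrite /gp_adj (nth_map 0) ?size_iota ?ltn_ord // nth_iota ?ltn_ord // add0n.
by rewrite mem_filter mem_iota /= ltn_ord andbT.
Qed.

Definition tab (a : 'I_16 -> 'I_16) : seq nat := [seq val (a u) | u <- enum 'I_16].

Lemma size_tab a : size (tab a) = 16.
Proof. by rewrite size_map size_enum_ord. Qed.

Lemma nth_tab a (u : 'I_16) : nth 0 (tab a) u = a u.
Proof. by rewrite (nth_map u) ?size_enum_ord // nth_ord_enum. Qed.

Lemma tab_inj (a b : {perm 'I_16}) : tab a = tab b -> a = b.
Proof.
by move=> ab; apply/permP => u; apply: val_inj; rewrite /= -!nth_tab ab.
Qed.

Definition tab_mul (s t : seq nat) : seq nat := [seq nth 0 t x | x <- s].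

Lemma tab_mulE (a b : {perm 'I_16}) : tab (a * b)%g = tab_mul (tab a) (tab b).
Proof.
by rewrite /tab_mul -map_comp; apply: eq_map => u; rewrite /= permM nth_tab.
Qed.

Lemma tab1 : tab (1%g : {perm 'I_16}) = iota 0 16.
Proof.
by rewrite -val_enum_ord; apply: eq_map => u; rewrite perm1.
Qed.

(* Nested conditionals, as the virtual machine evaluates both sides of a conjunction. *)
Fixpoint lazy_all (T : Type) (q : pred T) (s : seq T) : bool :=
  if s is x :: s' then if q x then lazy_all q s' else false else true.

Lemma lazy_allE (T : Type) (q : pred T) s : lazy_all q s = all q s.
Proof. by elim: s => //= x s ->. Qed.

(** One level of a breadth-first search for automorphisms: [t] lists the images of the vertices
    placed so far, and [c] is a candidate image of the next vertex, whose number is [size t]. *)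
Definition extensions (nb : seq (seq nat)) (t : seq nat) : seq (seq nat) :=
  [seq rcons t c | c <- iota 0 16 & (c \notin t) &&
     lazy_all (fun j => (c \in nth [::] nb (nth 0 t j)) == (size t \in nth [::] nb j))
       (iota 0 (size t))].

Definition all_auts : seq (seq nat) :=
  let nb := gp_nbrs in
  iter 16 (fun l => flatten [seq extensions nb t | t <- l]) [:: [::]].

(** By induction on its length, every prefix of the table of an automorphism survives the search. *)
Lemma tab_all_auts (a : {perm GP83}) : a \in Aut_graph GP83 -> tab a \in all_auts.
Proof.
move=> /in_Aut_graph aA.
have sub n : n <= 16 -> take n (tab a) \in
    iter n (fun l => flatten [seq extensions gp_nbrs t | t <- l]) [:: [::]].
  elim: n => [|n IH] n16; first by rewrite take0 inE.
  apply/flattenP; exists (extensions gp_nbrs (take n (tab a))).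
    by apply: map_f; apply: IH; exact: ltnW.
  have nth_take' j : j < n -> nth 0 (take n (tab a)) j = nth 0 (tab a) j.
    by move=> jn; rewrite nth_take.
  have an : nth 0 (tab a) n = a (Ordinal n16) by rewrite -(nth_tab a (Ordinal n16)).
  rewrite (take_nth 0) ?size_tab //; apply: map_f.
  have szn : size (take n (tab a)) = n by rewrite size_takel // size_tab ltnW.
  have alt : nth 0 (tab a) n < 16 by rewrite an ltn_ord.
  rewrite mem_filter mem_iota leq0n add0n alt !andbT szn; apply/andP; split.
    apply/(nthP 0) => -[j]; rewrite szn => jn; rewrite nth_take' //.
    have j16 := ltn_trans jn n16; rewrite an -[j]/(val (Ordinal j16)) nth_tab.
    by move=> /val_inj/perm_inj[jn']; rewrite jn' ltnn in jn.
  rewrite lazy_allE; apply/allP => j; rewrite mem_iota add0n /= => jn; rewrite nth_take' //.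
  have j16 := ltn_trans jn n16; rewrite an -[j]/(val (Ordinal j16)) nth_tab.
  apply/eqP; apply: etrans (gp_adjE (a (Ordinal j16)) (a (Ordinal n16))) _.
  by rewrite aA; exact/esym/(gp_adjE (Ordinal j16) (Ordinal n16)).
by rewrite -[tab a]take_size size_tab; exact: sub.
Qed.

End AutomorphismTables.

(** The reflection of the outer octagon that exchanges 1 and 2, extended along the spokes. *)
Definition kappa : {perm 'I_16} :=
  (cyc [:: 1; 2] * cyc [:: 3; 8] * cyc [:: 4; 7] * cyc [:: 5; 6]
  * cyc [:: 9; 10] * cyc [:: 11; 16] * cyc [:: 12; 15] * cyc [:: 13; 14])%g.

Lemma tab_cyc (c : seq 'I_16) (Uc : uniq c) :
  tab (cycle_perm Uc) = [seq next (map val c) x | x <- iota 0 16].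
Proof.
rewrite -val_enum_ord -map_comp; apply: eq_map => u.
by rewrite /= permE (next_map val_inj).
Qed.

Lemma tab_rho : tab rho = [:: 1; 2; 3; 4; 5; 6; 7; 0; 9; 10; 11; 12; 13; 14; 15; 8]%N.
Proof. by rewrite !tab_mulE !tab_cyc; vm_compute. Qed.

Lemma tab_omega :
  tab omega = [:: 0; 7; 15; 12; 4; 3; 11; 8; 1; 6; 10; 9; 5; 2; 14; 13]%N.
Proof. by rewrite !tab_mulE !tab_cyc; vm_compute. Qed.

Lemma tab_sigma :
  tab sigma = [:: 13; 10; 15; 12; 9; 14; 11; 8; 5; 2; 7; 4; 1; 6; 3; 0]%N.
Proof. by rewrite !tab_mulE !tab_cyc; vm_compute. Qed.

Lemma tab_kappa :
  tab kappa = [:: 1; 0; 7; 6; 5; 4; 3; 2; 9; 8; 15; 14; 13; 12; 11; 10]%N.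
Proof. by rewrite !tab_mulE !tab_cyc; vm_compute. Qed.

(* Words in rho ^+ 2, omega, kappa and rho, coded by 0, 1, 2 and 3. *)
Definition gen_perm (k : nat) : {perm 'I_16} :=
  nth 1%g [:: (rho ^+ 2)%g; omega; kappa; rho] k.

Definition word_perm (g : nat -> {perm 'I_16}) (w : seq nat) : {perm 'I_16} :=
  foldr (fun k a => g k * a)%g 1%g w.

Definition word_tab (g : nat -> seq nat) (w : seq nat) : seq nat :=
  foldr (fun k t => tab_mul (g k) t) (iota 0 16) w.

Lemma word_tabE (g : nat -> {perm 'I_16}) w :
  tab (word_perm g w) = word_tab (fun k => tab (g k)) w.
Proof. by elim: w => [|k w IH] /=; rewrite ?tab1 // tab_mulE IH. Qed.

Definition gen_tab (k : nat) : seq nat :=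
  nth (iota 0 16)
   [:: [:: 2; 3; 4; 5; 6; 7; 0; 1; 10; 11; 12; 13; 14; 15; 8; 9];
       [:: 0; 7; 15; 12; 4; 3; 11; 8; 1; 6; 10; 9; 5; 2; 14; 13];
       [:: 1; 0; 7; 6; 5; 4; 3; 2; 9; 8; 15; 14; 13; 12; 11; 10];
       [:: 1; 2; 3; 4; 5; 6; 7; 0; 9; 10; 11; 12; 13; 14; 15; 8]]%N k.

Lemma tab_gen k : tab (gen_perm k) = gen_tab k.
Proof.
rewrite /gen_perm /gen_tab.
case: k => [|[|[|[|k]]]] /=; last by rewrite !nth_nil tab1.
- by rewrite expgS expg1 tab_mulE tab_rho.
- exact: tab_omega.
- exact: tab_kappa.
- exact: tab_rho.
Qed.

Lemma tab_word w : tab (word_perm gen_perm w) = word_tab gen_tab w.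
Proof.
rewrite word_tabE; elim: w => //= k w ->; by rewrite tab_gen.
Qed.

(** One word for each of the 24 elements of H. Products of permutations act from left to right, so
    the first letter acts first. *)
Definition H_words : seq (seq nat) :=
  [:: [::]; [:: 0]; [:: 1]; [:: 0; 0]; [:: 0; 1]; [:: 1; 0]; [:: 1; 1];
      [:: 0; 0; 0]; [:: 0; 0; 1]; [:: 0; 1; 0]; [:: 0; 1; 1]; [:: 1; 0; 1];
      [:: 1; 1; 0]; [:: 0; 0; 0; 1]; [:: 0; 0; 1; 0]; [:: 0; 0; 1; 1];
      [:: 0; 1; 0; 1]; [:: 1; 0; 1; 0]; [:: 1; 0; 1; 1]; [:: 1; 1; 0; 1];
      [:: 0; 0; 0; 1; 0]; [:: 0; 0; 1; 0; 1]; [:: 0; 1; 0; 1; 1];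
      [:: 1; 1; 0; 1; 0]]%N.

Definition coset_words : seq (seq nat) := [:: [::]; [:: 2]; [:: 3]; [:: 3; 2]]%N.

Definition aut_word_tabs : seq (seq nat) :=
  [seq word_tab gen_tab (w ++ c) | c <- coset_words, w <- H_words].

(** Comparing the search with the 96 words by computation gives the decomposition of the
    automorphism group into four cosets of H. *)
Lemma all_auts_words : all_auts =i aut_word_tabs.
Proof.
have /andP[/allP h1 /allP h2] : all (mem aut_word_tabs) all_auts && all (mem all_auts) aut_word_tabs.
  by vm_compute.
by move=> t; apply/idP/idP => [/h1 | /h2].
Qed.

Lemma Aut_words (a : {perm GP83}) : a \in Aut_graph GP83 ->
  exists2 c, c \in coset_words & exists2 w, w \in H_words &
    a = word_perm gen_perm (w ++ c).
Proof.
move=> /tab_all_auts aA.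
move: aA; rewrite all_auts_words => /allpairsP[[c w] [/= cC wH tE]].
by exists c => //; exists w => //; apply: tab_inj; rewrite tab_word.
Qed.

Lemma sigma_word : sigma = word_perm gen_perm [:: 0; 1; 0; 1; 1; 3; 2]%N.
Proof. by apply: tab_inj; rewrite tab_word tab_sigma; vm_compute. Qed.

Lemma nth_tab0 (a : {perm 'I_16}) : nth 0%N (tab a) 0 = val (a (vtx 1)).
Proof. exact: nth_tab a (vtx 1). Qed.

Lemma nth_tab1 (a : {perm 'I_16}) : nth 0%N (tab a) 1 = val (a (vtx 2)).
Proof. exact: nth_tab a (vtx 2). Qed.

Lemma aut_word_tabs_mem (a : {perm GP83}) :
  a \in Aut_graph GP83 -> tab a \in aut_word_tabs.
Proof. by move=> /tab_all_auts aA; exact: etrans (esym (all_auts_words (tab a))) aA. Qed.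

Lemma word_perm_group (G : {group {perm GP83}}) (g : nat -> {perm 'I_16}) w :
  (forall k, k \in w -> g k \in G) -> word_perm g w \in G.
Proof.
elim: w => [|k w IH] h /=; first exact: group1.
by rewrite groupM ?h ?mem_head // IH // => l lw; rewrite h // inE lw orbT.
Qed.

(** Tables of the automorphisms that carry the edge {1, 2} to a given edge in either direction; [k]
    and [l] are zero-based. *)
Definition edge_movers (k l : nat) : seq (seq nat) :=
  [seq t <- aut_word_tabs |
    ((nth 0 t 0 == k) && (nth 0 t 1 == l)) || ((nth 0 t 0 == l) && (nth 0 t 1 == k))]%N.

Definition some_word (g : nat -> seq nat) (t : seq nat) (ws : seq (seq nat)) : bool :=
  has (fun w => word_tab g w == t) ws.

Lemma some_word_group (G : {group {perm GP83}}) (g : nat -> {perm 'I_16})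
    (b : {perm 'I_16}) ws :
  (forall k, g k \in G) -> some_word (fun k => tab (g k)) (tab b) ws -> b \in G.
Proof.
move=> gG /hasP[w _ /eqP/esym]; rewrite -word_tabE => /tab_inj->.
by apply: word_perm_group => k _.
Qed.

Definition rho2_words : seq (seq nat) :=
  [:: [:: 2; 0; 2; 0; 2; 2]; [:: 0; 2; 0; 2; 2; 0; 2; 0]; [:: 0; 0; 0; 0; 0; 0];
      [:: 0; 0; 0; 0; 0; 2]; [:: 1; 0; 1; 1; 0; 1; 2; 2]; [:: 0; 0; 2; 0; 2; 0]]%N.

Definition omega_words : seq (seq nat) :=
  [:: [:: 0; 0; 1; 0; 0; 0; 0; 1]; [:: 1; 0; 1; 0; 1; 1]; [:: 1; 0; 1; 1; 1; 2; 0; 2];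
      [:: 1; 0; 2; 1; 2; 0; 0; 0]; [:: 1; 0; 2; 0; 1; 1; 1; 2]; [:: 0; 2; 1; 0; 1]]%N.

(** An edge-transitive group contains some [a], [b], [c] carrying {1, 2} to {8, 1}, {1, 9} and {2,
    3}. Each can be one of four automorphisms, and in every one of the 64 cases some word of either
    list, with letters 0, 1, 2 read as [a], [b], [c], evaluates to [rho ^+ 2], respectively [omega].
    Thus such a group contains H, without enumeration of subgroups. *)
Lemma edge_movers_check :
  all (fun a => all (fun b => all (fun c =>
    let g := nth c [:: a; b] in
    some_word g (gen_tab 0) rho2_words && some_word g (gen_tab 1) omega_words)
    (edge_movers 1 2)) (edge_movers 0 8)) (edge_movers 7 0).
Proof. by vm_compute. Qed.

Lemma edge_transitive_gens (G : {group {perm GP83}}) :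
  G \subset Aut_graph GP83 -> [transitive G, on edges GP83 | ('P^*)%act] ->
  (rho ^+ 2)%g \in G /\ omega \in G.
Proof.
move=> /subsetP GA trG.
have edge k l : adj (vtx k : GP83) (vtx l) -> [set (vtx k : GP83); vtx l] \in edges GP83.
  by move=> kl; apply/imsetP; exists (vtx k, vtx l); rewrite ?inE.
have mover k l : adj (vtx k : GP83) (vtx l) ->
    exists2 a : {perm GP83}, a \in G & tab a \in edge_movers (vtx k) (vtx l).
  move=> kl; have [|a aG] := atransP2 trG (edge 1 2 _)%N (edge _ _ kl); first by vm_compute.
  rewrite /= /setact /= imsetU1 imset_set1 /= !apermE => E.
  exists a => //; rewrite mem_filter aut_word_tabs_mem ?GA // andbT.
  rewrite nth_tab0 nth_tab1.
  have : a (vtx 1) \in [set (vtx k : GP83); vtx l] by rewrite E set21.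
  have : a (vtx 2) \in [set (vtx k : GP83); vtx l] by rewrite E set22.
  have : a (vtx 1) != a (vtx 2) by rewrite (inj_eq perm_inj).
  rewrite !inE => ne /orP[]/eqP e2 /orP[]/eqP e1; rewrite e1 e2 ?eqxx ?orbT //.
    by rewrite e1 e2 eqxx in ne.
  by rewrite e1 e2 eqxx in ne.
have adj81 : adj (vtx 8 : GP83) (vtx 1) by vm_compute.
have [a aG aE] := mover _ _ adj81.
have adj19 : adj (vtx 1 : GP83) (vtx 9) by vm_compute.
have [b bG bE] := mover _ _ adj19.
have adj23 : adj (vtx 2 : GP83) (vtx 3) by vm_compute.
have [c cG cE] := mover _ _ adj23.
pose g := nth c [:: a; b]; have gG k : g k \in G by case: k => [|[|[|k]]].
have gE k : tab (g k) = nth (tab c) [:: tab a; tab b] k by case: k => [|[|[|k]]].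
have /allP/(_ _ aE)/allP/(_ _ bE)/allP/(_ _ cE)/= := edge_movers_check.
rewrite -(tab_gen 0) -(tab_gen 1) => /andP[h0 h1].
have ext t ws : some_word (nth (tab c) [:: tab a; tab b]) t ws =
    some_word (fun k => tab (g k)) t ws.
  by apply: eq_has => w; congr (_ == _); elim: w => //= k w ->; rewrite gE.
by split; [apply: (some_word_group (ws := rho2_words) gG)
          | apply: (some_word_group (ws := omega_words) gG)]; rewrite -ext.
Qed.

(** The cosets of 1 and of [rho * kappa] preserve the two colour classes of the bipartite graph, and
    the adjacent vertices 1 and 2 have different colours; only the cosets of kappa and rho
    remain. *)
Lemma swap_words (a : {perm GP83}) : a \in Aut_graph GP83 -> a (vtx 1) = vtx 2 ->
  exists2 w, w \in H_words &
    a = word_perm gen_perm (w ++ [:: 2%N]) \/ a = word_perm gen_perm (w ++ [:: 3%N]).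
Proof.
move=> /Aut_words[c cC [w wH ->]] av.
have chk : all (fun w => (nth 0 (word_tab gen_tab (w ++ [::])) 0 != 1)
    && (nth 0 (word_tab gen_tab (w ++ [:: 3; 2])) 0 != 1))%N H_words by vm_compute.
have := allP chk _ wH; rewrite -!tab_word.
have nt := nth_tab0 (word_perm gen_perm (w ++ c)); rewrite av /= in nt.
move: cC nt; rewrite !inE => /or4P[]/eqP-> nt; rewrite ?nt //= ?andbF //.
- by exists w => //; left.
- by exists w => //; right.
Qed.

Definition edge_word_check : bool :=
  all (fun u => all (fun v => gp_adj u v ==>
    has (fun w => let t := word_tab gen_tab w in
         ((nth 0 t 0 == u) && (nth 0 t 1 == v)) || ((nth 0 t 0 == v) && (nth 0 t 1 == u)))
      H_words) (iota 0 16)) (iota 0 16)%N.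

Definition vertex_word_check (c : nat) : bool :=
  all (fun v => has (fun w =>
     (nth 0 (word_tab gen_tab w) 0 == v) || (nth 0 (word_tab gen_tab (w ++ [:: c])) 0 == v))
   H_words) (iota 0 16)%N.

Lemma mem_iota16 (u : 'I_16) : val u \in iota 0 16.
Proof. by rewrite mem_iota /= ltn_ord. Qed.

Lemma edge_transitive_intro (G : {group {perm GP83}}) :
  G \subset Aut_graph GP83 -> (rho ^+ 2)%g \in G -> omega \in G ->
  [transitive G, on edges GP83 | ('P^*)%act].
Proof.
move=> /subsetP GA rG oG.
have wG w : w \in H_words -> word_perm gen_perm w \in G.
  move=> wH; apply: word_perm_group => k kw.
  have : all (all (fun k => (k == 0) || (k == 1))%N) H_words by [].
  by move=> /allP/(_ _ wH)/allP/(_ _ kw)/orP[]/eqP->.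
pose e0 := [set (vtx 1 : GP83); vtx 2].
have e0E : e0 \in edges GP83.
  by apply/imsetP; exists (vtx 1, vtx 2); rewrite ?inE //; vm_compute.
apply/imsetP; exists e0 => //; apply/setP => e; apply/idP/orbitP.
  case/imsetP=> -[u v]; rewrite inE /= => uv ->.
  have chk : edge_word_check by vm_compute.
  have := allP (allP chk _ (mem_iota16 u)) _ (mem_iota16 v).
  have uv' : gp_adj (val u) (val v) by rewrite gp_adjE.
  rewrite uv' => /hasP[w wH]; rewrite -tab_word => uvE.
  exists (word_perm gen_perm w); first exact: wG.
  rewrite /= /setact imsetU1 imset_set1 /= !apermE.
  move: uvE; cbv zeta; rewrite nth_tab0 nth_tab1.
  move=> /orP[]/andP[/eqP/val_inj e1 /eqP/val_inj e2]; rewrite e1 e2; first by [].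
  exact: setUC.
move=> [a aG <-]; rewrite /= /setact imsetU1 imset_set1 /= !apermE.
have adj12 : adj (vtx 1 : GP83) (vtx 2) by vm_compute.
apply/imsetP; exists (a (vtx 1), a (vtx 2)); rewrite // inE.
by have aA := elimT (in_Aut_graph a) (GA _ aG); exact: etrans (aA _ _) adj12.
Qed.

Lemma vertex_transitive_intro (G : {group {perm GP83}}) (c : nat) :
  vertex_word_check c ->
  (rho ^+ 2)%g \in G -> omega \in G -> gen_perm c \in G ->
  [transitive G, on [set: GP83] | 'P].
Proof.
move=> chk rG oG cG.
have wG w : w \in H_words -> word_perm gen_perm w \in G.
  move=> wH; apply: word_perm_group => k kw.
  have : all (all (fun k => (k == 0) || (k == 1))%N) H_words by [].
  by move=> /allP/(_ _ wH)/allP/(_ _ kw)/orP[]/eqP->.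
apply/imsetP; exists (vtx 1) => //; apply/setP => v; rewrite inE; symmetry.
have /hasP[w wH] := allP chk _ (mem_iota16 v).
have wcE : word_perm gen_perm (w ++ [:: c]) = (word_perm gen_perm w * gen_perm c)%g.
  by elim: (w) => [|k s IH] /=; rewrite ?mulg1 ?mul1g // IH mulgA.
rewrite -!tab_word !nth_tab0; case/orP=> /eqP/val_inj e; rewrite -e; apply/orbitP.
  by exists (word_perm gen_perm w); rewrite ?wG.
by exists (word_perm gen_perm (w ++ [:: c])); rewrite // wcE groupM ?wG.
Qed.

Lemma vertex_word_check2 : vertex_word_check 2. Proof. by vm_compute. Qed.
Lemma vertex_word_check3 : vertex_word_check 3. Proof. by vm_compute. Qed.

Definition aut_check (t : seq nat) : bool :=
  all (fun a => all (fun b => gp_adj (nth 0 t a) (nth 0 t b) == gp_adj a b)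
    (iota 0 16)) (iota 0 16)%N.

Lemma gen_tab_aut k : aut_check (gen_tab k).
Proof.
case: k => [|[|[|[|k]]]]; try by vm_compute.
have e : gen_tab k.+4 = iota 0 16 by rewrite /gen_tab /= nth_nil.
by rewrite e; vm_compute.
Qed.

Lemma gen_perm_Aut k : gen_perm k \in Aut_graph GP83.
Proof.
apply/in_Aut_graph => u v; rewrite -!gp_adjE.
have := allP (allP (gen_tab_aut k) _ (mem_iota16 u)) _ (mem_iota16 v).
by rewrite -tab_gen !nth_tab => /eqP.
Qed.

Lemma word_perm_Aut w : word_perm gen_perm w \in Aut_graph GP83.
Proof.
elim: w => [|k w IH]; first exact: Aut_graph1.
exact: (@Aut_graphM GP83 _ _ (gen_perm_Aut k) IH).
Qed.

(** * Voltages modulo coboundaries *)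

Lemma vtxK (u : 'I_16) : vtx u.+1 = u.
Proof. by apply: val_inj; rewrite /= modn_small. Qed.

(* The walks in T from the vertex 1, by labels, without their first vertex. *)
Definition tree_walks : seq (seq nat) := 
  [:: [::];
      [:: 9; 12; 15; 10; 2];
      [:: 9; 14; 11; 3];
      [:: 9; 12; 4];
      [:: 9; 12; 15; 10; 13; 5];
      [:: 9; 14; 6];
      [:: 9; 12; 15; 7];
      [:: 9; 12; 15; 10; 13; 16; 8];
      [:: 9];
      [:: 9; 12; 15; 10];
      [:: 9; 14; 11];
      [:: 9; 12];
      [:: 9; 12; 15; 10; 13];
      [:: 9; 14];
      [:: 9; 12; 15];
      [:: 9; 12; 15; 10; 13; 16]]%N.

Definition tree_walk (v : 'I_16) : seq 'I_16 := [seq vtx k | k <- nth [::] tree_walks v].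

(** An arc that does not occur in [cotree_arcs] has index 9, the length of that list; absence in
    both directions means that the edge lies in [T]. *)
Definition tree_step (a b : nat) : bool :=
  [&& gp_adj a b, index (a.+1, b.+1) cotree_arcs == 9%N
    & index (b.+1, a.+1) cotree_arcs == 9%N].

(** Every arc is a tree arc pointing away from the root 1, a tree arc pointing towards it, or a
    cotree arc listed in exactly one direction. These are the three cases of the normal form. *)
Definition arc_check (a b : nat) : bool :=
  let walk := nth [::] tree_walks in
  gp_adj a b ==>
  [|| tree_step a b && (walk b == rcons (walk a) b.+1),
      tree_step a b && (walk a == rcons (walk b) a.+1) |
      ((index (a.+1, b.+1) cotree_arcs < 9) (+) (index (b.+1, a.+1) cotree_arcs < 9))%N].

Lemma arc_checkT : all (fun a => all (arc_check a) (iota 0 16)) (iota 0 16).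
Proof. by vm_compute. Qed.

Definition walk_check (v : nat) : bool :=
  let w := nth [::] tree_walks v in
  path (fun a b => tree_step a.-1 b.-1) 1 w && (last 1%N w == v.+1) && all (fun k => 0 < k <= 16)%N w.

Lemma walk_checkT : all walk_check (iota 0 16).
Proof. by vm_compute. Qed.

Lemma tree_path_vtx (w : seq nat) (m : nat) :
  (0 < m <= 16)%N -> all (fun k => 0 < k <= 16)%N w ->
  path (fun a b => tree_step a.-1 b.-1) m w ->
  path (fun a b : 'I_16 => tree_step a b) (vtx m) [seq vtx k | k <- w].
Proof.
have vE n : (0 < n <= 16)%N -> nat_of_ord (vtx n) = n.-1.
  by case: n => // n; rewrite /= ltnS => ?; rewrite modn_small.
elim: w m => // k w IH m mr /andP[kr wr] /andP[mk pth].
apply/andP; split; last exact: IH.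
by move: mk; rewrite -(vE m mr) -(vE k kr).
Qed.

Lemma tree_walk_path (v : 'I_16) :
  path (fun a b : 'I_16 => tree_step a b) (vtx 1) (tree_walk v) /\ last (vtx 1) (tree_walk v) = v.
Proof.
have /andP[/andP[pth lst] rng] := allP walk_checkT _ (mem_iota16 v).
split; last first.
  by rewrite last_map (eqP lst) vtxK.
by apply: tree_path_vtx pth.
Qed.

Section TreeNormalForm.

Variable N : finZmodType.

Fixpoint walk_sum (z : 'I_16 -> 'I_16 -> N) (u : 'I_16) (s : seq 'I_16) : N :=
  if s is v :: s' then z u v + walk_sum z v s' else 0.

Lemma walk_sum_rcons z u s v :
  walk_sum z u (rcons s v) = walk_sum z u s + z (last u s) v.
Proof. by elim: s u => [|w s IH] u /=; rewrite ?addr0 ?add0r // IH addrA. Qed.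

(** Its coboundary agrees with [z] on [T], so subtracting that coboundary makes [z] trivial on the
    tree. What remains on a cotree arc is the voltage of its fundamental closed walk. *)
Definition potential (z : 'I_16 -> 'I_16 -> N) (v : 'I_16) : N :=
  walk_sum z (vtx 1) (tree_walk v).

Definition normal_values (z : 'I_16 -> 'I_16 -> N) : seq N :=
  [seq z (vtx a.1) (vtx a.2) + potential z (vtx a.1) - potential z (vtx a.2)
     | a <- cotree_arcs].

Lemma size_normal_values z : size (normal_values z) = 9.
Proof. by rewrite size_map. Qed.

Lemma normal_valuesE (zeta : voltage GP83 N) (u v : GP83) : adj u v ->
  zeta u v = tree_volt (normal_values zeta) u v + potential zeta v - potential zeta u.
Proof.
(* Arcs outside the list are read at position 9, beyond the nine values, where the default is 0. *)
move=> uv; have nth9 : (normal_values zeta)`_9 = 0 by rewrite nth_default.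
have idx (a b : 'I_16) : (index (a.+1, b.+1) cotree_arcs <= 9)%N by exact: index_size.
have step (a b : 'I_16) : tree_step a b -> nth [::] tree_walks b = rcons (nth [::] tree_walks a) b.+1 ->
    zeta a b = tree_volt (normal_values zeta) a b + potential zeta b - potential zeta a.
  move=> /and3P[_ /eqP i1 /eqP i2] wb; rewrite /tree_volt i1 i2 nth9 subr0 add0r.
  rewrite {1}/potential /tree_walk wb map_rcons walk_sum_rcons -/(tree_walk a).
  by rewrite (tree_walk_path a).2 vtxK addrAC subrr add0r.
have cot (a b : 'I_16) : (index (a.+1, b.+1) cotree_arcs < 9)%N ->
    (index (b.+1, a.+1) cotree_arcs < 9)%N = false ->
    zeta a b = tree_volt (normal_values zeta) a b + potential zeta b - potential zeta a.
  move=> ia ib; rewrite /tree_volt (_ : index (b.+1, a.+1) _ = 9%N); last first.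
    by apply/eqP; rewrite eqn_leq idx leqNgt ib.
  rewrite nth9 subr0 (nth_map (0, 0)%N) // nth_index -?index_mem //= !vtxK.
  by rewrite subrK addrK.
have flip (a b : GP83) : adj a b ->
    zeta b a = tree_volt (normal_values zeta) b a + potential zeta a - potential zeta b ->
    zeta a b = tree_volt (normal_values zeta) a b + potential zeta b - potential zeta a.
  move=> ab; rewrite (voltN zeta ab) (tree_voltN _ ab) => E.
  by rewrite -[LHS]opprK E !opprD !opprK addrAC.
have := allP (allP arc_checkT _ (mem_iota16 u)) _ (mem_iota16 v).
rewrite /arc_check gp_adjE uv implyTb => /or3P[/andP[st /eqP wE] | /andP[st /eqP wE] |].
- exact: step.
- apply: (flip u v uv); apply: step => //; move: st => /and3P[h1 h2 h3].
  by apply/and3P; split=> //; rewrite gp_adjE adj_sym.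
- case: ltnP => iu; case: ltnP => iv //= _; first by apply: cot => //; rewrite ltnNge iv.
  by apply: (flip u v uv); apply: cot => //; rewrite ltnNge iu.
Qed.

End TreeNormalForm.

Section VoltageMatrices.

Variable p : nat.
Local Notation F := 'F_p.

Definition mx_volt d (Z : 'M[F]_(d, 9)) : voltage GP83 'cV[F]_d :=
  tree_voltage [seq col k Z | k <- enum 'I_9].

Definition covmx d (Z : 'M[F]_(d, 9)) : projection GP83 := derived_projection (mx_volt Z).

(** The universal voltage trivial on [T], with values in the first homology of the graph: a signed
    basis vector on a cotree arc and 0 on the tree. Every [mx_volt Z] is its image under [Z]. *)
Definition arcvec (u v : 'I_16) : 'cV[F]_9 :=
  \col_k ((index (u.+1, v.+1) cotree_arcs == k)%:R
          - (index (v.+1, u.+1) cotree_arcs == k)%:R).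

Lemma nth_cols d (Z : 'M[F]_(d, 9)) (n : nat) :
  [seq col k Z | k <- enum 'I_9]`_n = Z *m \col_k (n == k)%:R.
Proof.
have [n9 | n9] := ltnP n 9.
  rewrite (nth_map (Ordinal n9)) ?size_enum_ord //.
  have -> : nth (Ordinal n9) (enum 'I_9) n = Ordinal n9 := nth_ord_enum _ (Ordinal n9).
  apply/colP => i; rewrite [LHS]mxE [RHS]mxE (bigD1 (Ordinal n9)) //= big1 => [|k].
    by rewrite mxE eqxx mulr1 addr0.
  by rewrite -val_eqE /= mxE eq_sym => /negPf->; rewrite mulr0.
rewrite nth_default; last by rewrite size_map size_enum_ord.
apply/colP => i; rewrite !mxE big1 // => k _; rewrite mxE gtn_eqF ?mulr0 //.
exact: leq_trans (ltn_ord k) n9.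
Qed.

Lemma mx_voltE d (Z : 'M[F]_(d, 9)) u v : mx_volt Z u v = Z *m arcvec u v.
Proof.
rewrite /= /tree_volt !nth_cols -mulmxBr; congr (_ *m _).
by apply/colP => k; rewrite !mxE.
Qed.

Lemma arcvecN (u v : GP83) : adj u v -> arcvec v u = - arcvec u v.
Proof. by move=> _; apply/colP => k; rewrite !mxE opprB. Qed.

Lemma cols_mx d (l : seq 'cV[F]_d) : size l = 9 ->
  [seq col k (\matrix_(i, k) l`_k i 0) | k <- enum 'I_9] = l.
Proof.
move=> sl; apply: (@eq_from_nth _ 0) => [|n]; rewrite size_map size_enum_ord // => n9.
rewrite (nth_map (Ordinal n9)) ?size_enum_ord //.
have -> : nth (Ordinal n9) (enum 'I_9) n = Ordinal n9 := nth_ord_enum _ (Ordinal n9).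
by apply/colP => i; rewrite !mxE.
Qed.

Lemma cotree_check : all (fun n => let a := nth (0, 0)%N cotree_arcs n in
    [&& gp_adj a.1.-1 a.2.-1, (val (vtx a.1) == a.1.-1) && (val (vtx a.2) == a.2.-1),
        index ((vtx a.1).+1, (vtx a.2).+1) cotree_arcs == n &
        index ((vtx a.2).+1, (vtx a.1).+1) cotree_arcs == 9])%N (iota 0 9).
Proof. by vm_compute. Qed.

(** Both voltages vanish on [T], so [f] is constant along the spanning tree and its coboundary is
    zero. Evaluating on the cotree arcs compares the columns. This rigidity makes the matrix of a
    voltage class unique. *)
Lemma tree_cohomologous d (Z Z' : 'M[F]_(d, 9)) (f : GP83 -> 'cV[F]_d) :
  (forall u v : GP83, adj u v -> Z *m arcvec u v = Z' *m arcvec u v + f v - f u) ->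
  Z = Z'.
Proof.
move=> coh.
have step (u v : 'I_16) : tree_step u v -> f v = f u.
  move=> /and3P[uv /eqP i1 /eqP i2]; have := coh u v.
  rewrite -gp_adjE => /(_ uv); have -> : arcvec u v = 0.
    apply/colP => k; rewrite !mxE i1 i2 subrr.
    by [].
  by rewrite !mulmx0 add0r => /esym/eqP; rewrite subr_eq0 => /eqP.
have fc v : f v = f (vtx 1).
  have [] := tree_walk_path v; move: (vtx 1) (tree_walk v) => u s.
  elim: s u => [|w s IH] u /= => [_ <- // | /andP[uw pth] lst].
  by rewrite (IH w pth lst) (step u w uw).
apply/matrixP => i k; have k9 := ltn_ord k.
pose a := nth (0, 0)%N cotree_arcs k.
have kI : val k \in iota 0 9 by rewrite mem_iota.
have /and4P[ha /andP[/eqP h1 /eqP h2] /eqP i1 /eqP i2] := allP cotree_check _ kI.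
have := coh (vtx a.1) (vtx a.2); rewrite -gp_adjE h1 h2 => /(_ ha).
rewrite !fc addrK; have -> : arcvec (vtx a.1) (vtx a.2) = delta_mx k 0.
  apply/colP => l; rewrite !mxE i1 i2 andbT [val k == _]eq_sym val_eqE.
  by rewrite [9%N == _]gtn_eqF ?subr0.
by rewrite -!colE => /colP/(_ i); rewrite !mxE.
Qed.

End VoltageMatrices.

Definition act_volt (p : nat) (a : {perm GP83}) (u v : 'I_16) : 'cV['F_p]_9 :=
  arcvec p (a u) (a v).

(* Pulling a voltage with matrix Z back along a and normalising it on T
   multiplies Z by act_mx a; locked to keep unification from computing it. *)
HB.lock Definition act_mx (p : nat) (a : {perm GP83}) : 'M['F_p]_9 :=
  \matrix_(i, k) (normal_values (act_volt p a))`_k i 0.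

HB.lock Definition act_pot (p : nat) (a : {perm GP83}) (u : GP83) : 'cV['F_p]_9 :=
  potential (act_volt p a) u.

Section ActionMatrix.

Variable p : nat.
Local Notation F := 'F_p.
Local Notation act_mx := (act_mx p).
Local Notation act_pot := (act_pot p).
Local Notation act_volt := (act_volt p).
Local Notation arcvec := (arcvec p).

Lemma act_mxE (a : {perm GP83}) (u v : GP83) : a \in Aut_graph GP83 -> adj u v ->
  arcvec (a u) (a v) = act_mx a *m arcvec u v + act_pot a v - act_pot a u.
Proof.
move=> /in_Aut_graph aA uv.
have aN (x y : GP83) : adj x y -> act_volt a y x = - act_volt a x y.
  by move=> xy; apply: arcvecN; rewrite aA.
have E := normal_valuesE (Voltage aN) uv.
rewrite -[LHS]/(act_volt a u v) [LHS]E /=; rewrite act_pot.unlock act_mx.unlock; congr (_ + _ - _).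
rewrite -mx_voltE /= /tree_volt.
by rewrite cols_mx ?size_normal_values.
Qed.

(** Two normalised matrices of the same pulled-back voltage are cohomologous, hence equal; products
    are computed this way without unfolding [act_mx]. *)
Lemma act_mx_unique (a : {perm GP83}) (A : 'M[F]_9) (f : GP83 -> 'cV[F]_9) :
  a \in Aut_graph GP83 ->
  (forall u v : GP83, adj u v -> arcvec (a u) (a v) = A *m arcvec u v + f v - f u) ->
  act_mx a = A.
Proof.
move=> aA AE; apply: (tree_cohomologous (f := fun u => f u - act_pot a u)) => u v uv.
have := act_mxE aA uv; rewrite AE // => E.
apply: (addIr (act_pot a v - act_pot a u)); rewrite addrA -E -!addrA.
congr (_ + _); apply/matrixP => i j; rewrite !mxE.
move: (f _ _ _) (f _ _ _) (act_pot _ _ _ _) (act_pot _ _ _ _) => x y z t; ring.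
Qed.

End ActionMatrix.

(** * Lifting and isomorphism as conditions on row spaces *)

Section LiftingCriterion.

Variable p : nat.
Local Notation F := 'F_p.
Local Notation R a := (act_mx p a).
Local Notation arcvec := (arcvec p).

Lemma act_mx1 : R 1%g = 1%:M.
Proof.
apply: (act_mx_unique (f := fun=> 0)) => [|u v uv]; first exact: Aut_graph1.
by rewrite !perm1 mul1mx addrK.
Qed.

(** The order is reversed because [(a * b) u] is [b (a u)]: the factor of [b] is split off first, on
    the left. *)
Lemma act_mxM (a b : {perm GP83}) : a \in Aut_graph GP83 -> b \in Aut_graph GP83 ->
  R (a * b)%g = R b *m R a.
Proof.
move=> aA bA; apply: (act_mx_unique
  (f := fun u => R b *m act_pot p a u + act_pot p b (a u))) => [|u v uv].
  exact: Aut_graphM.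
rewrite !permM (act_mxE p bA) ?(elimT (in_Aut_graph a) aA) // (act_mxE p aA uv).
rewrite mulmxBr mulmxDr mulmxA; apply/matrixP => i j; rewrite !mxE; ring.
Qed.

Lemma act_mx_unit (a : {perm GP83}) : a \in Aut_graph GP83 -> R a \in unitmx.
Proof.
move=> aA; have a'A : (a^-1)%g \in Aut_graph GP83.
  apply/in_Aut_graph => u v; rewrite -[in RHS](permKV a u) -[in RHS](permKV a v).
  by rewrite (elimT (in_Aut_graph a) aA).
have : R a *m R (a^-1)%g = 1%:M by rewrite -act_mxM // mulVg act_mx1.
by case/mulmx1_unit=> unitA _.
Qed.

Lemma covmx_connected d (Z : 'M[F]_(d, 9)) :
  connected_graph (cover_graph (covmx Z)) <-> row_free Z.
Proof.
split=> [con | freeZ].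
  rewrite -kermx_eq0; apply/negPn/negP => /rowV0Pn[w /sub_kermxP wZ].
  apply/negP; rewrite negbK; apply/eqP/trmx_inj; rewrite trmx0.
  (* If [w] annihilates all voltages, the product of [w] with the fibre coordinate does not change
     along edges; connectedness then makes it 0 everywhere, so [w = 0]. *)
  have inv (u : cover_graph (covmx Z)) : w *m u.2 = 0.
    refine (@connected_ind (Cov (mx_volt Z)) (fun u => w *m u.2 = 0) (vtx 1, 0) con _ _ u).
      by rewrite mulmx0.
    move=> x y /andP[_ /eqP-> xw].
    by rewrite mulmxDr xw mx_voltE mulmxA wZ mul0mx addr0.
  apply/colP => i; have := inv (vtx 1, delta_mx i 0); rewrite /= -colE.
  by move=> /colP/(_ 0); rewrite !mxE.
pose e := @adj (cover_graph (covmx Z)).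
have csym : connect_sym e by apply: sym_connect_sym; exact: adj_sym.
have step (u v : 'I_16) a : gp_adj u v -> connect e (u, a) (v, a + Z *m arcvec u v).
  move=> uv; apply: connect1; apply/andP; rewrite /= -mx_voltE eqxx; split=> //.
  by rewrite -[GP_adj _ _]gp_adjE.
have tree v a : connect e (vtx 1, a) (v, a).
  have [] := tree_walk_path v; move: (vtx 1) (tree_walk v) => u s.
  elim: s u => [|w s IH] u /= => [_ -> // | /andP[uw pth] lst].
  apply: connect_trans (IH w pth lst); case/and3P: uw => uw /eqP i1 /eqP i2.
  have := step u w a uw; have -> : arcvec u w = 0.
    by apply/colP => k; rewrite !mxE i1 i2 subrr.
  by rewrite mulmx0 addr0.
(* The closed walk through the cotree arc [k] and otherwise inside [T] translates the fibre over the
   vertex 1 by column [k]; when the rows are independent, these columns span. *)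
have loop k a : connect e (vtx 1, a) (vtx 1, a + col k Z).
  have kI : val k \in iota 0 9 by rewrite mem_iota ltn_ord.
  have := allP cotree_check _ kI; set b := nth _ _ _ => /and4P[ha /andP[/eqP h1 /eqP h2] /eqP i1 /eqP i2].
  have st : gp_adj (vtx b.1) (vtx b.2) by rewrite h1 h2.
  have := step _ _ a st; have -> : arcvec (vtx b.1) (vtx b.2) = delta_mx k 0.
    apply/colP => l; rewrite !mxE i1 i2 andbT [val k == _]eq_sym val_eqE.
    by rewrite [9%N == _]gtn_eqF ?subr0.
  rewrite -colE => c1; apply: connect_trans (tree (vtx b.1) a) _.
  by apply: connect_trans c1 _; rewrite csym.
have loops k (c : F) a : connect e (vtx 1, a) (vtx 1, a + c *: col k Z).
  rewrite -[c]natr_Zp scaler_nat; elim: (val c) => [|n IH]; first by rewrite mulr0n addr0.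
  by apply: connect_trans IH _; rewrite mulrSr addrA; exact: loop.
have all0 a : connect e (vtx 1, 0) (vtx 1, a).
  have -> : a = \sum_k (pinvmx Z *m a) k 0 *: col k Z.
    rewrite -[LHS]mul1mx -(mulmxVp freeZ) -mulmxA; apply/colP => i.
    by rewrite mxE summxE; apply: eq_bigr => k _; rewrite !mxE mulrC.
  set c := pinvmx Z *m a.
  have h (s : seq 'I_9) b : connect e (vtx 1, b) (vtx 1, b + \sum_(k <- s) c k 0 *: col k Z).
    elim: s b => [|k s IH] b; first by rewrite big_nil addr0.
    by rewrite big_cons addrA; apply: connect_trans (loops k _ b) (IH _).
  by have := h (index_enum 'I_9) 0; rewrite add0r.
move=> [u a] [v b]; apply: (@connect_trans _ e (vtx 1, 0)).
  by rewrite [connect _ _ _]csym; apply: connect_trans (all0 a) (tree u a).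
exact: connect_trans (all0 b) (tree v b).
Qed.

(** The isomorphism makes [Z' *m R a] and some [A *m Z] cohomologous, and matrices of tree-normal
    voltages are then equal. *)
Lemma covmx_iso_sub d d' (Z : 'M[F]_(d, 9)) (Z' : 'M[F]_(d', 9)) (a : {perm GP83})
    (b : cover_graph (covmx Z) -> cover_graph (covmx Z')) :
  a \in Aut_graph GP83 -> row_free Z -> graph_iso b ->
  (forall u, a (covmx Z u) = covmx Z' (b u)) -> (Z' *m R a <= Z)%MS.
Proof.
move=> aA freeZ bI ab; have con := (covmx_connected Z).2 freeZ.
have [g [f [gD _ eqz]]] := derived_iso_cocycle (vtx 1 : GP83) con bI ab.
have [A gA] := additive_mulmx gD.
suff -> : Z' *m R a = A *m Z by exact: submxMl.
apply: (@tree_cohomologous _ _ _ _ (fun u => f u - Z' *m act_pot p a u)) => u v uv.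
have := eqz u v uv; rewrite !mx_voltE gA (act_mxE p aA uv) !mulmxBr mulmxDr !mulmxA.
move=> /(congr1 (fun x => x - Z' *m act_pot p a v + Z' *m act_pot p a u)).
set x := Z' *m R a *m _; set y := A *m Z *m _.
move: (Z' *m act_pot p a v) (Z' *m act_pot p a u) (f v) (f u) => z t fv fu.
move=> E; transitivity (x + z - t - z + t).
  by apply/matrixP => i j; rewrite !mxE; ring.
by rewrite E; apply/matrixP => i j; rewrite !mxE; ring.
Qed.

(** The inclusion gives [Z' *m R a = A *m Z]; the left side has rank [d], so the square matrix [A]
    is invertible and supplies the map on fibres. *)
Lemma covmx_iso_intro d (Z Z' : 'M[F]_(d, 9)) (a : {perm GP83}) :
  a \in Aut_graph GP83 -> row_free Z' -> (Z' *m R a <= Z)%MS ->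
  exists2 b : cover_graph (covmx Z) -> cover_graph (covmx Z'), graph_iso b &
    forall u, a (covmx Z u) = covmx Z' (b u).
Proof.
move=> aA freeZ' /submxP[A AE].
have unitA : A \in unitmx.
  rewrite -row_full_unit -col_leq_rank.
  apply: leq_trans (mxrankM_maxl A Z); rewrite -AE mxrankMfree; last first.
    by rewrite row_free_unit act_mx_unit.
  by rewrite (eqP freeZ').
have [|||b bI bE] := @cocycle_derived_iso GP83 _ _ (mx_volt Z) (mx_volt Z') a (mulmx A)
  (fun u => Z' *m act_pot p a u) aA.
- by move=> m n; rewrite mulmxDr.
- by exists (mulmx (invmx A)) => x; rewrite mulmxA ?mulVmx ?mulmxV // mul1mx.
- move=> u v uv; rewrite !mx_voltE (act_mxE p aA uv) !mulmxBr mulmxDr.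
  by rewrite mulmxA AE -mulmxA.
by exists b.
Qed.

Lemma graph_iso_dim d d' (Z : 'M[F]_(d, 9)) (Z' : 'M[F]_(d', 9))
    (b : cover_graph (covmx Z) -> cover_graph (covmx Z')) :
  graph_iso b -> d = d'.
Proof.
move=> [/bij_eq_card + _]; rewrite !card_prod !card_mx !muln1 => /eqP.
by rewrite !card_ord eqn_pmul2l // => /eqP/expnI; apply.
Qed.

Lemma covmx_liftsP d (Z : 'M[F]_(d, 9)) (a : {perm GP83}) :
  row_free Z -> a \in Aut_graph GP83 -> lifts (covmx Z) a = (Z *m R a <= Z)%MS.
Proof.
move=> freeZ aA; apply/idP/idP => [/existsP[b /andP[/in_Aut_graph bA /forallP ab]] | sub].
  apply: (@covmx_iso_sub _ _ Z Z a (fun u => b u)) => // [|u]; last exact/eqP/ab.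
  by split; [exact: (Bijective (permK b) (permKV b)) | exact: bA].
have [b [bb badj] ab] := covmx_iso_intro aA freeZ sub.
apply/existsP; exists (perm (bij_inj bb)); apply/andP; split.
  by apply/in_Aut_graph => u v; rewrite !permE badj.
by apply/forallP => u; rewrite permE ab.
Qed.

Lemma covmx_isoP d d' (Z : 'M[F]_(d, 9)) (Z' : 'M[F]_(d', 9)) :
  row_free Z -> isomorphic_projections (covmx Z) (covmx Z') ->
  d = d' /\ exists2 a, a \in Aut_graph GP83 & (Z' *m R a <= Z)%MS.
Proof.
move=> freeZ [a aA [b bI ab]]; split; first exact: graph_iso_dim bI.
by exists a => //; exact: covmx_iso_sub bI ab.
Qed.

Lemma covmx_isoI d (Z Z' : 'M[F]_(d, 9)) (a : {perm GP83}) :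
  a \in Aut_graph GP83 -> row_free Z' -> (Z' *m R a <= Z)%MS ->
  isomorphic_projections (covmx Z) (covmx Z').
Proof.
move=> aA freeZ' /(covmx_iso_intro aA freeZ')[b bI ab].
by exists a => //; exists b.
Qed.

End LiftingCriterion.

(** * Transitivity and the largest lifting group *)

Section Symmetry.

Variable p : nat.
Local Notation F := 'F_p.

Definition stab d (Z : 'M[F]_(d, 9)) (A : 'M[F]_9) : bool := (Z *m A <= Z)%MS.

Definition mxI : 'M[F]_9 := act_mx p (rho ^+ 2)%g.
Definition mxO : 'M[F]_9 := act_mx p omega.
Definition mxK : 'M[F]_9 := act_mx p kappa.
Definition mxR : 'M[F]_9 := act_mx p rho.

Lemma stabM d (Z : 'M[F]_(d, 9)) A B : stab Z A -> stab Z B -> stab Z (A *m B).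
Proof.
by rewrite /stab mulmxA => sA sB; apply: submx_trans sB; exact: submxMr.
Qed.

Lemma Aut_rho2 : (rho ^+ 2)%g \in Aut_graph GP83. Proof. exact: gen_perm_Aut 0. Qed.
Lemma Aut_omega : omega \in Aut_graph GP83. Proof. exact: gen_perm_Aut 1. Qed.
Lemma Aut_kappa : kappa \in Aut_graph GP83. Proof. exact: gen_perm_Aut 2. Qed.
Lemma Aut_rho : rho \in Aut_graph GP83. Proof. exact: gen_perm_Aut 3. Qed.

Lemma stab_inv d (Z : 'M[F]_(d, 9)) A : A \in unitmx -> stab Z A -> stab Z (invmx A).
Proof.
move=> uA sA; have /eqmxP e : (Z *m A == Z)%MS.
  by rewrite -(geq_leqif (mxrank_leqif_eq sA)) mxrankMfree // row_free_unit.
by rewrite /stab -(eqmxMr (invmx A) e) mulmxK.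
Qed.

Definition Hstab d (Z : 'M[F]_(d, 9)) : bool := stab Z mxI && stab Z mxO.

Definition semisym_mx d (Z : 'M[F]_(d, 9)) : bool :=
  [&& Hstab Z, ~~ stab Z mxK & ~~ stab Z mxR].

Section FreeMatrix.

Variables (d : nat) (Z : 'M[F]_(d, 9)).
Hypothesis freeZ : row_free Z.
Let L := Group (lifts_group_set (covmx Z)).

Lemma in_lifting_group a : a \in Aut_graph GP83 -> (a \in L) = stab Z (act_mx p a).
Proof.
move=> aA; rewrite /stab -(covmx_liftsP freeZ aA).
by apply/setIdP/idP => [[] | la].
Qed.

Lemma lifting_group_sub : L \subset Aut_graph GP83.
Proof. by apply/subsetP => a /setIdP[]. Qed.

Lemma covmx_edge_transitive : edge_transitive (covmx Z) <-> Hstab Z.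
Proof.
split=> [[G [GA Gt Gl]] | /andP[sI sO]].
  have [rG oG] := edge_transitive_gens GA Gt.
  by apply/andP; rewrite /stab -!covmx_liftsP ?Gl ?Aut_rho2 ?Aut_omega.
exists L; split; last by move=> a /setIdP[].
  exact: lifting_group_sub.
by apply: edge_transitive_intro; rewrite ?lifting_group_sub ?in_lifting_group ?Aut_rho2 ?Aut_omega.
Qed.

Lemma word_perm_cat w c :
  word_perm gen_perm (w ++ c) = (word_perm gen_perm w * word_perm gen_perm c)%g.
Proof. by elim: w => [|k w IH] /=; rewrite ?mul1g // IH mulgA. Qed.

Lemma H_words_lift w : Hstab Z -> w \in H_words -> word_perm gen_perm w \in L.
Proof.
move=> /andP[sI sO] wH; apply: word_perm_group => k kw.
have : all (all (fun k => (k == 0) || (k == 1))%N) H_words by [].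
by move=> /allP/(_ _ wH)/allP/(_ _ kw)/orP[]/eqP->; rewrite in_lifting_group ?Aut_rho2 ?Aut_omega.
Qed.

(** A vertex-transitive lifting group has an element sending 1 to 2, which by [swap_words] lies in
    the coset of kappa or of rho. As H lifts, the coset representative lifts as well. *)
Lemma covmx_vertex_transitive : Hstab Z ->
  vertex_transitive (covmx Z) <-> stab Z mxK || stab Z mxR.
Proof.
move=> HZ; have [/andP[sI sO]] := (HZ, HZ).1; split=> [[G [GA Gt Gl]] | sKR].
  have [a aG] := atransP2 Gt (in_setT (vtx 1 : GP83)) (in_setT (vtx 2)).
  rewrite /= apermE => av; have aA : a \in Aut_graph GP83 by exact: (subsetP GA).
  have aL : a \in L by apply/setIdP; split=> //; exact: Gl.
  have gen_lift w k : w \in H_words -> word_perm gen_perm (w ++ [:: k]) \in L ->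
      stab Z (act_mx p (gen_perm k)).
    move=> wH; rewrite word_perm_cat (groupMl _ (H_words_lift HZ wH)) -in_lifting_group.
      by rewrite /word_perm /= mulg1.
    exact: gen_perm_Aut.
  by have [w wH [] aE] := swap_words aA (esym av);
    rewrite aE in aL; have /= := gen_lift _ _ wH aL; rewrite /mxK /mxR => ->; rewrite ?orbT.
exists L; split; last by move=> a /setIdP[].
  exact: lifting_group_sub.
case/orP: sKR => s.
  apply: (vertex_transitive_intro vertex_word_check2);
    by rewrite in_lifting_group ?Aut_rho2 ?Aut_omega ?Aut_kappa.
apply: (vertex_transitive_intro vertex_word_check3);
  by rewrite in_lifting_group ?Aut_rho2 ?Aut_omega ?Aut_rho.
Qed.

Lemma covmx_semisymmetric : semisymmetric (covmx Z) <-> semisym_mx Z.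
Proof.
rewrite /semisym_mx -negb_or; split=> [[/covmx_edge_transitive HZ nv] | /andP[HZ nKR]].
  by rewrite HZ; apply/negP => /(covmx_vertex_transitive HZ).
split; first exact/covmx_edge_transitive.
by move=> /(covmx_vertex_transitive HZ); exact/negP.
Qed.

Lemma lifting_group_cosets a : Hstab Z -> a \in L ->
  exists2 c, c \in coset_words & exists2 w, w \in H_words &
    a = word_perm gen_perm (w ++ c) /\ word_perm gen_perm c \in L.
Proof.
move=> HZ aL; have [c cC [w wH aE]] := Aut_words (subsetP lifting_group_sub _ aL).
exists c => //; exists w => //; split=> //.
by move: aL; rewrite aE word_perm_cat (groupMl _ (H_words_lift HZ wH)).
Qed.

Lemma H_words_grpH w : w \in H_words -> word_perm gen_perm w \in <<[set (rho ^+ 2)%g; omega]>>%g.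
Proof.
move=> wH; apply: word_perm_group => k kw.
have : all (all (fun k => (k == 0) || (k == 1))%N) H_words by [].
by move=> /allP/(_ _ wH)/allP/(_ _ kw)/orP[]/eqP->; apply: mem_gen; rewrite !inE eqxx ?orbT.
Qed.

Lemma act_mx_rho_kappa : act_mx p (rho * kappa)%g = mxK *m mxR.
Proof. exact: act_mxM Aut_rho Aut_kappa. Qed.

Lemma largest_group_H : semisym_mx Z -> ~~ stab Z (mxK *m mxR) ->
  largest_lifting_group (covmx Z) = grpH.
Proof.
case/and3P=> HZ nK nR nKR; apply/eqP; rewrite eqEsubset; apply/andP; split.
  apply/subsetP => a /(lifting_group_cosets HZ)[c cC [w wH [-> cL]]].
  move: cC; rewrite !inE => /or4P[]/eqP cE; rewrite cE /= ?mulg1 in cL *.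
  - by rewrite cats0; exact: H_words_grpH.
  - by rewrite in_lifting_group ?Aut_kappa // (negPf nK) in cL.
  - by rewrite in_lifting_group ?Aut_rho // (negPf nR) in cL.
  - rewrite in_lifting_group ?act_mx_rho_kappa ?(negPf nKR) // in cL.
    exact: Aut_graphM Aut_rho Aut_kappa.
have /andP[sI sO] := HZ.
rewrite (gen_subG _ L); apply/subsetP => a /set2P[]->.
  by rewrite in_lifting_group ?Aut_rho2.
by rewrite in_lifting_group ?Aut_omega.
Qed.

Lemma sigma_coset : exists2 h, h \in grpH & sigma = (h * (rho * kappa))%g.
Proof.
exists (word_perm gen_perm [:: 0; 1; 0; 1; 1]%N); first exact: H_words_grpH.
by rewrite sigma_word -[[:: 0; 1; 0; 1; 1; 3; 2]%N]/([:: 0; 1; 0; 1; 1] ++ [:: 3; 2])%N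
  word_perm_cat; congr (_ * _)%g; rewrite /word_perm /= mulg1.
Qed.

Lemma largest_group_M : semisym_mx Z -> stab Z (mxK *m mxR) ->
  largest_lifting_group (covmx Z) = grpM.
Proof.
case/and3P=> HZ nK nR sKR; have [h hH sE] := sigma_coset.
have HL : grpH \subset L.
  have /andP[sI sO] := HZ.
  rewrite (gen_subG _ L); apply/subsetP => a /set2P[]->.
    by rewrite in_lifting_group ?Aut_rho2.
  by rewrite in_lifting_group ?Aut_omega.
have rkA : (rho * kappa)%g \in Aut_graph GP83 by exact: Aut_graphM Aut_rho Aut_kappa.
have HM : {subset grpH <= grpM}.
  by move=> x xH; apply: mem_gen; rewrite !inE xH orbT.
have rkM : (rho * kappa)%g \in grpM.
  have -> : (rho * kappa)%g = (h^-1 * sigma)%g by rewrite sE mulKg.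
  have sM : sigma \in grpM by apply: mem_gen; exact: setU11.
  by apply: groupM; [rewrite groupV; exact: HM | exact: sM].
apply/eqP; rewrite eqEsubset; apply/andP; split.
  apply/subsetP => a /(lifting_group_cosets HZ)[c cC [w wH [-> cL]]].
  have wM : word_perm gen_perm w \in grpM by apply: HM; exact: H_words_grpH.
  move: cC; rewrite !inE => /or4P[]/eqP cE; rewrite cE ?word_perm_cat /= ?mulg1 in cL *.
  - exact: wM.
  - by rewrite in_lifting_group ?Aut_kappa // (negPf nK) in cL.
  - by rewrite in_lifting_group ?Aut_rho // (negPf nR) in cL.
  - exact: groupM wM rkM.
rewrite (gen_subG _ L) subUset HL andbT sub1set sE.
apply: (groupM (G := L)); first exact: (subsetP HL).
by rewrite in_lifting_group // act_mx_rho_kappa.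
Qed.

End FreeMatrix.

Lemma semisym_invariant : equivalence_invariant (@semisymmetric GP83).
Proof. exact: equivalent_semisymmetric. Qed.

Lemma edge_transitive_invariant : equivalence_invariant (@edge_transitive GP83).
Proof. exact: equivalent_edge_transitive. Qed.

Hypothesis pr_p : prime p.

Lemma voltage_eq_equivalent d (zeta zeta' : voltage GP83 'cV[F]_d) :
  (forall u v, adj u v -> zeta u v = zeta' u v) ->
  equivalent_projections (derived_projection zeta) (derived_projection zeta').
Proof.
move=> E; have [|||b bI bE] := @cocycle_derived_iso GP83 _ _ zeta zeta' 1%g id (fun=> 0)
    (Aut_graph1 _).
- by [].
- by exists id.
- by move=> u v uv; rewrite !perm1 subr0 addr0 E.
by exists b => // u; rewrite /= -bE perm1.
Qed.

Lemma minimal_covmx (Phi : projection GP83 -> Prop) d (Z : 'M[F]_(d, 9)) :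
  equivalence_invariant Phi -> row_free Z ->
  minimal_for Phi (covmx Z) <->
  Phi (covmx Z) /\ forall d' (B : 'M[F]_(d', d)), row_free B -> (0 < d' < d)%N ->
    ~ Phi (covmx (B *m Z)).
Proof.
move=> inv freeZ; have con := (covmx_connected Z).2 freeZ.
have minE := minimal_derived (vtx 1 : GP83) pr_p inv con.
split=> [/minE[PhiZ minZ] | [PhiZ minZ]].
  split=> // d' B freeB d'd; apply: minZ freeB d'd _ => u v uv.
  by rewrite !mx_voltE mulmxA.
apply/minE; split=> // d' B zeta' freeB d'd def_z PhiZ'.
apply: (minZ d' B freeB d'd); apply: inv PhiZ'.
by apply: voltage_eq_equivalent => u v uv; rewrite def_z // !mx_voltE mulmxA.
Qed.

Lemma covmx_elementary_abelian d (Z : 'M[F]_(d, 9)) :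
  (0 < d)%N -> elementary_abelian_covering p (covmx Z).
Proof. exact: derived_mx_elementary_abelian (vtx 1 : GP83) _ pr_p _ _. Qed.

Lemma elementary_abelian_covmx (P : projection GP83) :
  elementary_abelian_covering p P -> connected_graph (cover_graph P) ->
  exists d (Z : 'M[F]_(d, 9)), row_free Z /\ equivalent_projections P (covmx Z).
Proof.
move=> elP conP; have [d [zeta [b bI bE]]] := elementary_abelian_derived pr_p elP.
pose Z : 'M[F]_(d, 9) := \matrix_(i, k) (normal_values zeta)`_k i 0.
have ZE u v : mx_volt Z u v = tree_volt (normal_values zeta) u v.
  by rewrite /= cols_mx ?size_normal_values.
have [|||c cI cE] := @cocycle_derived_iso GP83 _ _ zeta (mx_volt Z) 1%g id
    (fun u => - potential zeta u) (Aut_graph1 _).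
- by [].
- by exists id.
- by move=> u v uv; rewrite !perm1 ZE (normal_valuesE zeta uv) opprK addrAC subrK addrK.
have PQ : equivalent_projections P (covmx Z).
  exists (c \o b); first exact: graph_iso_comp.
  by move=> u; rewrite bE /= -cE perm1.
exists d, Z; split=> //; apply/covmx_connected.
by case: PQ => e eI _; exact: graph_iso_connected eI conP.
Qed.

End Symmetry.

(** * Stable subspaces *)

(** Integer counterpart of [arcvec] on zero-based vertex numbers. The entries of the action matrices
    come from integers independent of [p], so they are computed once for all primes. *)
Definition arc_coef (x y i : nat) : int :=
  (index (x.+1, y.+1) cotree_arcs == i)%:R - (index (y.+1, x.+1) cotree_arcs == i)%:R.

Fixpoint walk_coef (t : seq nat) (x : nat) (s : seq nat) (i : nat) : int :=
  if s is k :: s' then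
    let y := (k.-1 %% 16)%N in
    arc_coef (nth 0%N t x) (nth 0%N t y) i + walk_coef t y s' i
  else 0.

Definition act_coef (t : seq nat) (k i : nat) : int :=
  let x := ((nth (0, 0) cotree_arcs k).1.-1 %% 16)%N in
  let y := ((nth (0, 0) cotree_arcs k).2.-1 %% 16)%N in
  arc_coef (nth 0%N t x) (nth 0%N t y) i + walk_coef t 0%N (nth [::] tree_walks x) i
  - walk_coef t 0%N (nth [::] tree_walks y) i.

Section ExplicitAction.

Variable p : nat.
Local Notation F := 'F_p.

Lemma arc_coefE (u v : 'I_16) (i : 'I_9) : arcvec p u v i 0 = (arc_coef u v i)%:~R.
Proof. by rewrite mxE /arc_coef rmorphB /= !rmorph_nat. Qed.

Lemma walk_coefE (a : {perm GP83}) (u : 'I_16) (s : seq nat) (i : 'I_9) :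
  walk_sum (act_volt p a) u [seq vtx k | k <- s] i 0 = (walk_coef (tab a) u s i)%:~R.
Proof.
elim: s u => [|k s IH] u; first by rewrite mxE.
have -> : walk_coef (tab a) u (k :: s) i = arc_coef (nth 0%N (tab a) u)
    (nth 0%N (tab a) (vtx k)) i + walk_coef (tab a) (vtx k) s i by [].
rewrite [map _ _]/= [walk_sum _ _ _]/(_ + _) mxE IH rmorphD; congr (_ + _).
by rewrite /act_volt arc_coefE -!nth_tab.
Qed.

Lemma act_coefE (a : {perm GP83}) (i k : 'I_9) :
  act_mx p a i k = (act_coef (tab a) k i)%:~R.
Proof.
rewrite act_mx.unlock mxE /normal_values (nth_map (0, 0)%N) ?ltn_ord //.
have DB (x y z : 'cV[F]_9) : (x + y - z) i 0 = x i 0 + y i 0 - z i 0 by rewrite !mxE.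
rewrite DB /potential /tree_walk !walk_coefE {1}/act_volt arc_coefE -!nth_tab.
have IB (x y z : int) : (x + y - z)%:~R = x%:~R + y%:~R - z%:~R :> F.
  by rewrite rmorphB rmorphD.
exact/esym/IB.
Qed.

Definition rowl (s : seq F) : 'rV[F]_9 := \row_k s`_k.

(** The coefficients 0, 1 and -1 get their own cases so that evaluation leaves short linear forms,
    without products by constants. *)
Fixpoint lincomb (c : seq int) (s : seq F) : F :=
  match c, s with
  | Posz 0 :: c', _ :: s' => lincomb c' s'
  | Posz 1 :: c', x :: s' => x + lincomb c' s'
  | Negz 0 :: c', x :: s' => - x + lincomb c' s'
  | z :: c', x :: s' => x * z%:~R + lincomb c' s'
  | _, _ => 0
  end.

Lemma lincombE (c : seq int) (s : seq F) n : size c = n -> size s = n ->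
  lincomb c s = \sum_(i < n) s`_i * (c`_i)%:~R.
Proof.
elim: n c s => [|n IH] [|z c] [|x s] //=; first by rewrite big_ord0.
move=> [sc] [ss]; rewrite big_ord_recl /= -IH //.
by case: z => [[|[|z]]|[|z]] /=; rewrite ?mulr0 ?mulr1 ?add0r ?mulrN1.
Qed.

Definition act_cols (t : seq nat) : seq (seq int) :=
  [seq [seq act_coef t k i | i <- iota 0 9] | k <- iota 0 9].

Lemma nth_act_cols t (k : 'I_9) :
  nth [::] (act_cols t) k = [seq act_coef t k i | i <- iota 0 9].
Proof.
rewrite /act_cols (nth_map 0%N); last by rewrite size_iota ltn_ord.
by rewrite nth_iota; last exact: ltn_ord.
Qed.

Lemma rowl_act (a : {perm GP83}) (T : seq (seq int)) (s : seq F) :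
  act_cols (tab a) = T -> size s = 9%N ->
  rowl s *m act_mx p a = rowl [seq lincomb c s | c <- T].
Proof.
move=> <- ss; apply/rowP => k; rewrite [LHS]mxE [RHS]mxE.
rewrite (nth_map [::]); last by rewrite size_map size_iota ltn_ord.
rewrite nth_act_cols (@lincombE _ _ 9 _ ss); last by rewrite size_map size_iota.
apply: eq_bigr => i _; rewrite mxE act_coefE (nth_map 0%N); last by rewrite size_iota ltn_ord.
by rewrite nth_iota; last exact: ltn_ord.
Qed.

Definition rI (s : seq F) : seq F :=
  if s is [:: w0; w1; w2; w3; w4; w5; w6; w7; w8]
  then [:: w0; w3; w0 + w4; w5 - w0; w6; w0 + w7; w8 - w0; w1; w2] else s.

Definition rO (s : seq F) : seq F :=
  if s is [:: w0; w1; w2; w3; w4; w5; w6; w7; w8]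
  then [:: - w2 - w6; - w1 - w7 - w8; w0 - w2 + w7; w2 - w0; w5 + w6;
           - w2 - w3 - w4 - w5 - w6; w2 + w3; w6; w1 - w6] else s.

Definition rK (s : seq F) : seq F :=
  if s is [:: w0; w1; w2; w3; w4; w5; w6; w7; w8]
  then [:: - w0; - w1; - w8; - w7; - w6; - w5; - w4; - w3; - w2] else s.

Definition rR (s : seq F) : seq F :=
  if s is [:: w0; w1; w2; w3; w4; w5; w6; w7; w8]
  then [:: w0; w2 - w0; w0 + w3; w4; w5 - w0; w0 + w6; w7; w8 - w0; w0 + w1] else s.

Lemma rowl_explicit (a : {perm GP83}) (T : seq (seq int)) (r : seq F -> seq F) :
  act_cols (tab a) = T ->
  (forall w0 w1 w2 w3 w4 w5 w6 w7 w8, let s := [:: w0; w1; w2; w3; w4; w5; w6; w7; w8] in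
    [seq lincomb c s | c <- T] = r s) ->
  forall s, size s = 9%N -> rowl s *m act_mx p a = rowl (r s).
Proof.
move=> aT Tr s ss; rewrite (rowl_act aT ss).
by do 9?[case: s ss => // ? s ss]; case: s ss => // _; rewrite Tr.
Qed.

Ltac explicit_action k :=
  let T := eval vm_compute in (act_cols (gen_tab k)) in
  refine (@rowl_explicit (gen_perm k) T _ _ _);
  [ rewrite tab_gen; vm_compute; reflexivity
  | intros; cbn [map lincomb]; do 9?[congr (_ :: _); first by ring]; by [] ].

Lemma rowl_I s : size s = 9%N -> rowl s *m mxI p = rowl (rI s).
Proof. move: s; explicit_action 0%N. Qed.

Lemma rowl_O s : size s = 9%N -> rowl s *m mxO p = rowl (rO s).
Proof. move: s; explicit_action 1%N. Qed.

Lemma rowl_K s : size s = 9%N -> rowl s *m mxK p = rowl (rK s).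
Proof. move: s; explicit_action 2%N. Qed.

Lemma rowl_R s : size s = 9%N -> rowl s *m mxR p = rowl (rR s).
Proof. move: s; explicit_action 3%N. Qed.

End ExplicitAction.

Ltac row_ring := apply/rowP; let k := fresh in let h := fresh in
  case=> k h; rewrite !mxE /=; revert h;
  do 9! [case: k => [|k] /=; [move=> _; ring |]]; by [].

(** * The parts on which rho ^+ 4 acts as 1 and as -1 *)

Section InvariantSubspaces.

Variable p : nat.
Hypotheses (pr_p : prime p) (odd_p : odd p).
Local Notation F := 'F_p.
Local Notation rowl := (@rowl p).
Local Notation mxI := (mxI p).
Local Notation mxO := (mxO p).
Local Notation mxK := (mxK p).
Local Notation mxR := (mxR p).

Lemma Fp_natr_eq0 n : ((n%:R : F) == 0) = (p %| n)%N.
Proof. by rewrite (dvdn_pcharf (pchar_Fp pr_p)). Qed.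

Lemma two_neq0 : (2%:R : F) != 0.
Proof.
rewrite Fp_natr_eq0 dvdn_prime2 //; apply: contraL odd_p => /eqP->.
by [].
Qed.

Lemma four_neq0 : (4%:R : F) != 0.
Proof. by rewrite (natrM _ 2 2) mulf_neq0 ?two_neq0. Qed.

Lemma row9P (v : 'rV[F]_9) :
  exists w0 w1 w2 w3 w4 w5 w6 w7 w8, v = rowl [:: w0; w1; w2; w3; w4; w5; w6; w7; w8].
Proof.
exists (v 0 (inord 0)), (v 0 (inord 1)), (v 0 (inord 2)), (v 0 (inord 3)), (v 0 (inord 4)).
exists (v 0 (inord 5)), (v 0 (inord 6)), (v 0 (inord 7)), (v 0 (inord 8)).
apply/rowP => k; rewrite mxE -[k in LHS]inord_val; case: k => k /= h.
by do 9?[case: k h => [|k] h //].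
Qed.

Lemma stab_row d (W : 'M[F]_(d, 9)) (A : 'M[F]_9) (v : 'rV[F]_9) :
  stab W A -> (v <= W)%MS -> (v *m A <= W)%MS.
Proof. by move=> sA vW; apply: submx_trans sA; exact: submxMr. Qed.

Lemma subZ_inv d (W : 'M[F]_(d, 9)) (c : F) (v : 'rV[F]_9) :
  c != 0 -> (c *: v <= W)%MS -> (v <= W)%MS.
Proof. by move=> c0 /(scalemx_sub c^-1); rewrite scalerA mulVf // scale1r. Qed.

Lemma stabPn d (W : 'M[F]_(d, 9)) (A : 'M[F]_9) :
  ~~ stab W A -> exists2 v : 'rV[F]_9, (v <= W)%MS & ~~ (v *m A <= W)%MS.
Proof.
case/row_subPn=> k nk; exists (row k W); first exact: row_sub.
by rewrite -row_mul.
Qed.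

(* The rows of the eigenspace of rho ^+ 4 for the eigenvalue -1. *)
Definition v4 (a b c d : F) : 'rV[F]_9 := rowl [:: 0; a; b; c; d; - a; - b; - c; - d].

Lemma v4_I a b c d : v4 a b c d *m mxI = v4 c d (- a) (- b).
Proof. by rewrite /v4 rowl_I //; row_ring. Qed.
Lemma v4_O a b c d : v4 a b c d *m mxO = v4 (- a + c + d) (- b - c) b (- a - b).
Proof. by rewrite /v4 rowl_O //; row_ring. Qed.
Lemma v4_K a b c d : v4 a b c d *m mxK = v4 (- a) d c b.
Proof. by rewrite /v4 rowl_K //; row_ring. Qed.
Lemma v4_R a b c d : v4 a b c d *m mxR = v4 b c d (- a).
Proof. by rewrite /v4 rowl_R //; row_ring. Qed.
Lemma v4D a b c d a' b' c' d' :
  v4 a b c d + v4 a' b' c' d' = v4 (a + a') (b + b') (c + c') (d + d').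
Proof. by rewrite /v4; row_ring. Qed.
Lemma v4Z x a b c d : x *: v4 a b c d = v4 (x * a) (x * b) (x * c) (x * d).
Proof. by rewrite /v4; row_ring. Qed.

Lemma v4_inj a b c d a' b' c' d' : v4 a b c d = v4 a' b' c' d' ->
  [/\ a = a', b = b', c = c' & d = d'].
Proof.
move=> /rowP E; have e k := E (inord k); split.
- by have := e 1%N; rewrite !mxE inordK.
- by have := e 2%N; rewrite !mxE inordK.
- by have := e 3%N; rewrite !mxE inordK.
- by have := e 4%N; rewrite !mxE inordK.
Qed.

Lemma v4_0 : v4 0 0 0 0 = 0.
Proof. by rewrite /v4; row_ring. Qed.

Definition chi (theta : F) : 'rV[F]_9 :=
  rowl [:: - 4%:R; 1 + theta; - 3%:R - theta; 1 + theta; 1 - theta; - 3%:R + theta;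
           1 - theta; 1 + theta; - 3%:R - theta].

Section Closed.

Variables (d : nat) (W : 'M[F]_(d, 9)).
Hypothesis HW : Hstab W.

Lemma HI (v : 'rV[F]_9) : (v <= W)%MS -> (v *m mxI <= W)%MS.
Proof. by case/andP: HW => h _; exact: stab_row. Qed.
Lemma HO (v : 'rV[F]_9) : (v <= W)%MS -> (v *m mxO <= W)%MS.
Proof. by case/andP: HW => _ h; exact: stab_row. Qed.

Lemma oppmx_sub (v : 'rV[F]_9) : (v <= W)%MS -> ((- v)%R <= W)%MS.
Proof. by rewrite eqmx_opp. Qed.

Ltac span_tac := repeat match goal with
  | H : is_true (submx ?v W) |- is_true (submx ?v W) => exact H
  | |- is_true (submx (_ + _)%R W) => apply: addmx_sub
  | |- is_true (submx (- _)%R W) => apply: oppmx_sub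
  | |- is_true (submx (_ *: _)%R W) => apply: scalemx_sub
  | |- is_true (submx (_ *m mxI) W) => apply: HI
  | |- is_true (submx (_ *m mxO) W) => apply: HO
  end.

(** [mxI *m mxI] is the action of [rho ^+ 4], so [y] is twice the projection of [w] to its fixed
    space. There the right side, an element of the group algebra of H, acts as twice kappa. *)
Lemma plus_kappa_identity (w : 'rV[F]_9) :
  let y := w + w *m mxI *m mxI in
  2%:R *: (y *m mxK) = - y - y *m mxI + y *m mxO *m mxI *m mxO *m mxO
     - y *m mxO *m mxO *m mxI *m mxO.
Proof.
have [w0 [w1 [w2 [w3 [w4 [w5 [w6 [w7 [w8 ->]]]]]]]]] := row9P w.
rewrite /= !rowl_I //= !mulmxDl !(rowl_I, rowl_O, rowl_K) //=.
row_ring.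
Qed.

Lemma plus_kappa (v : 'rV[F]_9) :
  (v <= W)%MS -> ((v + v *m mxI *m mxI)%R *m mxK <= W)%MS.
Proof.
move=> vW; have yW : ((v + v *m mxI *m mxI)%R <= W)%MS by span_tac.
apply: (subZ_inv two_neq0); rewrite plus_kappa_identity.
by move: yW; set y := v + _ => yW; span_tac.
Qed.

Lemma minus_v4 (w : 'rV[F]_9) : exists a b c e, w - w *m mxI *m mxI = v4 a b c e.
Proof.
have [w0 [w1 [w2 [w3 [w4 [w5 [w6 [w7 [w8 ->]]]]]]]]] := row9P w.
exists (w0 + w1 - w5), (w2 - w6 - w0), (w3 - w7), (w0 + w4 - w8).
by rewrite !rowl_I //= /v4; row_ring.
Qed.

(* The fixed space of the quaternion subgroup, spanned by chi theta and chi (- theta). *)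
Definition v2 (a b : F) : 'rV[F]_9 :=
  rowl [:: - (4%:R * a); a + b; - (3%:R * a) - b; a + b; a - b; - (3%:R * a) + b;
           a - b; a + b; - (3%:R * a) - b].

Lemma v2_I a b : v2 a b *m mxI = v2 a b.
Proof. by rewrite /v2 rowl_I //; row_ring. Qed.
Lemma v2_O a b : 2%:R *: (v2 a b *m mxO) = v2 (- a - b) (3%:R * a - b).
Proof. by rewrite /v2 rowl_O //; row_ring. Qed.
Lemma v2_R a b : v2 a b *m mxR = v2 a (- b).
Proof. by rewrite /v2 rowl_R //; row_ring. Qed.
Lemma v2_K a b : v2 a b *m mxK = v2 (- a) (- b).
Proof. by rewrite /v2 rowl_K //; row_ring. Qed.
Lemma v2D a b a' b' : v2 a b + v2 a' b' = v2 (a + a') (b + b').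
Proof. by rewrite /v2; row_ring. Qed.
Lemma v2Z x a b : x *: v2 a b = v2 (x * a) (x * b).
Proof. by rewrite /v2; row_ring. Qed.
Lemma chiE theta : chi theta = v2 1 theta.
Proof. by rewrite /v2 /chi; row_ring. Qed.

(** The sum of the images of [y] under [rho ^+ 2] and its two conjugates by omega, as [omega] has
    order 3. On vectors fixed by [rho ^+ 4] these and 1 run through the quaternion group modulo its
    centre, so [y + quaternion_sum y] is 4 times the projection to its fixed space. *)
Definition quaternion_sum (y : 'rV[F]_9) : 'rV[F]_9 :=
  y *m mxI + y *m mxO *m mxI *m mxO *m mxO + y *m mxO *m mxO *m mxI *m mxO.

Lemma quaternion_sum_v2 (w : 'rV[F]_9) :
  let y := w + w *m mxI *m mxI in exists a b, y + quaternion_sum y = v2 a b.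
Proof.
have [w0 [w1 [w2 [w3 [w4 [w5 [w6 [w7 [w8 ->]]]]]]]]] := row9P w.
exists (- (w0 + w1 + w2 + w3 + w4 + w5 + w6 + w7 + w8)).
exists (w0 + w1 - w2 + w3 - w4 + w5 - w6 + w7 - w8).
rewrite /quaternion_sum !rowl_I //= !mulmxDl !(rowl_I, rowl_O) //= /v2.
row_ring.
Qed.

(** The complement of the [v2] rows in the fixed space of [rho ^+ 4], that is, the image of the
    complementary projection [3 y - quaternion_sum y]. *)
Definition v3 (t u v : F) : 'rV[F]_9 :=
  rowl [:: - u - v; u + v - t; - u; t; u; - t; v; t; - v].

Lemma v3_I t u v : v3 t u v *m mxI = v3 (u + v - t) v u.
Proof. by rewrite /v3 rowl_I //; row_ring. Qed.
Lemma v3_O t u v : v3 t u v *m mxO = v3 v (v - t) (t - u).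
Proof. by rewrite /v3 rowl_O //; row_ring. Qed.
Lemma v3_R t u v : v3 t u v *m mxR = v3 u (u + v - t) t.
Proof. by rewrite /v3 rowl_R //; row_ring. Qed.

Lemma v3_rho t u v : let e := v3 t u v in
  2%:R *: (e *m mxR) = e + e *m mxI + e *m mxO - e *m mxO *m mxO
     + e *m mxI *m mxO *m mxI - e *m mxO *m mxI *m mxO.
Proof. by rewrite /= !(v3_I, v3_O, v3_R) /v3; row_ring. Qed.

Lemma quaternion_v3 (w : 'rV[F]_9) :
  let y := w + w *m mxI *m mxI in exists t u v, 3%:R *: y - quaternion_sum y = v3 t u v.
Proof.
have [w0 [w1 [w2 [w3 [w4 [w5 [w6 [w7 [w8 ->]]]]]]]]] := row9P w.
exists (2%:R * (w2 + w4 + w6 + w8) + 4%:R * (w3 + w7)).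
exists (2%:R * (w1 + w3 + w5 + w7 - w0) + 4%:R * (w4 + w8)).
exists (2%:R * (w1 + w3 + w5 + w7 - w0) + 4%:R * (w2 + w6)).
rewrite /quaternion_sum !rowl_I //= !mulmxDl !(rowl_I, rowl_O) //= /v3.
row_ring.
Qed.

(* The part of the row space on which rho ^+ 4 is trivial splits, up to the factor
   4, into a vector of v2 and one of v3; on the latter rho acts as an element of the
   group algebra of H. *)
Lemma plus_rho (w : 'rV[F]_9) : (w <= W)%MS ->
  exists a b, (v2 a b <= W)%MS /\
    ((v2 a b *m mxR <= W)%MS -> ((w + w *m mxI *m mxI)%R *m mxR <= W)%MS).
Proof.
move=> wW; have [a [b vE]] := quaternion_sum_v2 w; exists a, b.
have [t [u [v eE]]] := quaternion_v3 w.
have yW : ((w + w *m mxI *m mxI)%R <= W)%MS by span_tac.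
set y := (w + _)%R in vE eE yW *.
have qW : (quaternion_sum y <= W)%MS by rewrite /quaternion_sum; span_tac.
rewrite -vE; split; first by span_tac.
move=> vR; apply: (subZ_inv four_neq0).
have eW : (v3 t u v <= W)%MS by rewrite -eE; span_tac.
have -> : 4%:R *: (y *m mxR) = (y + quaternion_sum y) *m mxR + v3 t u v *m mxR.
  rewrite -eE -mulmxDl scalemxAl; congr (_ *m _).
  by move: (quaternion_sum y) (y) => q z; apply/matrixP => i j; rewrite !mxE; ring.
apply: addmx_sub => //; apply: (subZ_inv two_neq0); rewrite v3_rho.
by move: (v3 t u v) eW => e eW; span_tac.
Qed.

End Closed.
End InvariantSubspaces.

Arguments v4 {p} (a b c d)%_R.
Arguments v2 {p} (a b)%_R.
Arguments chi {p} theta%_R.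

(** * Structure of semisymmetric row spaces *)

Section SplitFamily.

Variable p : nat.
Hypotheses (pr_p : prime p) (odd_p : odd p).
Local Notation F := 'F_p.
Local Notation mxI := (mxI p).
Local Notation mxO := (mxO p).
Local Notation mxK := (mxK p).
Local Notation mxR := (mxR p).

(** The condition [theta != 0] is recorded separately: for [p = 3] the value 0 also satisfies
    [theta ^+ 2 = - 3], but then the line of [chi theta] is stable under rho. *)
Lemma v2_chi d (W : 'M[F]_(d, 9)) (a b : F) :
  Hstab W -> (v2 a b <= W)%MS -> ~~ (v2 a b *m mxR <= W)%MS ->
  exists theta : F, [/\ theta ^+ 2 = - 3%:R, theta != 0 & (chi theta <= W)%MS].
Proof.
move=> HW vW nR.
have v'W : (v2 (- a - b) (3%:R * a - b) <= W)%MS.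
  by rewrite -v2_O; apply: scalemx_sub; apply: HO.
(* This is the determinant of the coordinates of [v2 a b] and of twice its omega-image. If it were
   nonzero, [W] would contain all [v2] rows, among them the image under rho. *)
have /eqP D0 : 3%:R * a ^+ 2 + b ^+ 2 == 0.
  apply: contraR nR => D0; rewrite v2_R.
  have h1 : (v2 1 0 <= W)%MS.
    apply: (subZ_inv D0); have -> : (3%:R * a ^+ 2 + b ^+ 2) *: v2 1 0 =
        (3%:R * a - b) *: v2 a b + (- b) *: v2 (- a - b) (3%:R * a - b).
      by rewrite !v2Z v2D; congr v2; ring.
    by rewrite addmx_sub // scalemx_sub.
  have h2 : (v2 0 1 <= W)%MS.
    apply: (subZ_inv D0); have -> : (3%:R * a ^+ 2 + b ^+ 2) *: v2 0 1 =
        (a + b) *: v2 a b + a *: v2 (- a - b) (3%:R * a - b).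
      by rewrite !v2Z v2D; congr v2; ring.
    by rewrite addmx_sub // scalemx_sub.
  have -> : v2 a (- b) = a *: v2 1 0 + (- b) *: v2 0 1.
    by rewrite !v2Z v2D; congr v2; ring.
  by rewrite addmx_sub // scalemx_sub.
have a0 : a != 0.
  apply: contraNneq nR => a0; move: D0; rewrite a0 expr0n mulr0 add0r => /eqP.
  rewrite expf_eq0 /= => /eqP b0; rewrite b0 v2_R oppr0.
  by move: vW; rewrite a0 b0.
exists (b / a); split.
- apply: (mulIf (expf_neq0 2 a0)); rewrite -exprMn divfK //.
  by apply: (addrI (3%:R * a ^+ 2)); rewrite D0; ring.
- rewrite mulf_neq0 ?invr_eq0 //; apply: contraNneq nR => b0.
  by rewrite v2_R b0 oppr0 -b0.
- have -> : chi (b / a) = a^-1 *: v2 a b by rewrite chiE v2Z mulVf // mulrC.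
  exact: scalemx_sub.
Qed.

(** The common interface of the projective line and of the conic: an H-stable space that meets the
    4-dimensional part properly and nontrivially meets it in exactly one plane of the family. The
    classification below is carried out once from this property. *)
Definition split_family (fam : 'M[F]_(2, 9) -> Prop) : Prop :=
  [/\ forall U, fam U -> row_free U /\ Hstab U,
      forall U (v : 'rV_9), fam U -> (v <= U)%MS -> exists a b c e, v = v4 a b c e &
      forall d (W : 'M[F]_(d, 9)) a b c e, Hstab W ->
        (v4 a b c e <= W)%MS -> v4 a b c e != 0 ->
        ~ (forall a b c e, (v4 a b c e <= W)%MS) ->
        exists U, [/\ fam U, (U <= W)%MS &
                    forall a b c e, (v4 a b c e <= W)%MS -> (v4 a b c e <= U)%MS]].

Definition chi_mx (theta : F) (U : 'M[F]_(2, 9)) : 'M[F]_(1 + 2, 9) := col_mx (chi theta) U.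

Lemma four_neq0' : (4%:R : F) != 0. Proof. exact: four_neq0. Qed.

Lemma chi_v4 theta (x : F) a b c e a' b' c' e' :
  x *: chi theta + v4 a b c e = v4 a' b' c' e' -> x = 0.
Proof.
move=> /rowP/(_ ord0); rewrite !mxE /= addr0 mulrN => /eqP.
by rewrite oppr_eq0 mulf_eq0 (negPf four_neq0') orbF => /eqP.
Qed.

Lemma chi_I (theta : F) : chi theta *m mxI = chi theta.
Proof. by rewrite chiE v2_I. Qed.

(** The eigenvalue [(- 1 - theta) / 2] is a cube root of unity; this is where the square root of -3
    comes from. *)
Lemma chi_O (theta : F) : theta ^+ 2 = - 3%:R ->
  2%:R *: (chi theta *m mxO) = (- 1 - theta) *: chi theta.
Proof.
by move=> th; rewrite chiE v2_O v2Z; congr v2; [ring | ring: th].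
Qed.

Lemma chi_R (theta : F) : chi theta *m mxR = chi (- theta).
Proof. by rewrite !chiE v2_R. Qed.

Lemma chi_K (theta : F) : chi theta *m mxK = - chi theta.
Proof. by rewrite chiE v2_K -[RHS]scaleN1r v2Z !mulN1r. Qed.

Lemma chi_Hstab (theta : F) : theta ^+ 2 = - 3%:R -> Hstab (chi theta).
Proof.
move=> th; rewrite /Hstab /stab chi_I submx_refl.
by apply: (subZ_inv (two_neq0 pr_p odd_p)); rewrite chi_O // scalemx_sub.
Qed.

Lemma Hstab_col (d1 d2 : nat) (Z1 : 'M[F]_(d1, 9)) (Z2 : 'M[F]_(d2, 9)) :
  Hstab Z1 -> Hstab Z2 -> Hstab (col_mx Z1 Z2).
Proof.
rewrite /Hstab /stab => /andP[i1 o1] /andP[i2 o2].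
rewrite !mul_col_mx -!addsmxE !addsmx_sub.
by rewrite !(submx_trans i1, submx_trans o1, submx_trans i2, submx_trans o2) ?addsmxSl ?addsmxSr.
Qed.

Variable fam : 'M[F]_(2, 9) -> Prop.
Hypothesis sf : split_family fam.

Lemma fam_free U : fam U -> row_free U. Proof. by case: sf => h _ _ /h[]. Qed.
Lemma fam_Hstab U : fam U -> Hstab U. Proof. by case: sf => h _ _ /h[]. Qed.
Lemma fam_v4 U (v : 'rV_9) : fam U -> (v <= U)%MS -> exists a b c e, v = v4 a b c e.
Proof. by case: sf => _ h _; exact: h. Qed.

Lemma chi_mx_free theta U : fam U -> row_free (chi_mx theta U).
Proof.
move=> fU; rewrite -kermx_eq0; apply/rowV0P => w /sub_kermxP.
rewrite -[w]hsubmxK mul_row_col => E.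
have [a [b [c [e v4E]]]] := fam_v4 fU (submxMl (rsubmx w) U).
have l0 : lsubmx w = 0.
  apply/rowP => k; rewrite (ord1 k) [RHS]mxE.
  move: E; rewrite v4E {1}[lsubmx w]mx11_scalar mul_scalar_mx -v4_0.
  exact: chi_v4.
by move: E; rewrite l0 mul0mx add0r => /eqP; rewrite mulmx_free_eq0 ?fam_free // => /eqP->; rewrite row_mx0.
Qed.

Lemma chi_mx_v4 theta U a b c e : fam U ->
  (v4 a b c e <= chi_mx theta U)%MS -> (v4 a b c e <= U)%MS.
Proof.
move=> fU /submxP[D]; rewrite -[D]hsubmxK mul_row_col => E.
have [a' [b' [c' [e' v4E]]]] := fam_v4 fU (submxMl (rsubmx D) U).
move: E; rewrite v4E [lsubmx D]mx11_scalar mul_scalar_mx => E.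
by rewrite E (chi_v4 (esym E)) scale0r add0r -v4E submxMl.
Qed.

Lemma chi_sub_chi_mx theta U : (chi theta <= chi_mx theta U)%MS.
Proof. by rewrite -addsmxE addsmxSl. Qed.

Lemma fam_sub_chi_mx theta U : (U <= chi_mx theta U)%MS.
Proof. by rewrite -addsmxE addsmxSr. Qed.

Lemma sub_chi_mx d (W : 'M[F]_(d, 9)) theta U :
  (chi theta <= W)%MS -> (U <= W)%MS -> (chi_mx theta U <= W)%MS.
Proof. by move=> cW UW; rewrite -addsmxE addsmx_sub cW. Qed.

Lemma chi_opp_sub theta U : theta != 0 -> fam U -> ~~ (chi (- theta) <= chi_mx theta U)%MS.
Proof.
move=> th0 fU; apply/negP.
case/submxP=> D; rewrite -[D]hsubmxK mul_row_col => E.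
have [a [b [c [e v4E]]]] := fam_v4 fU (submxMl (rsubmx D) U).
move: E; rewrite v4E [lsubmx D]mx11_scalar mul_scalar_mx; set x := _ 0 0 => E.
have x1 : x = 1.
  have := congr1 (fun v : 'rV[F]_9 => v 0 ord0) E; rewrite !mxE /= addr0.
  move=> h; have : (1 - x) * 4%:R = 0.
    have -> : (1 - x) * 4%:R = - (- 4%:R - x * - 4%:R) by ring.
    by rewrite -h subrr oppr0.
  by move/eqP; rewrite mulf_eq0 (negPf four_neq0') orbF subr_eq0 => /eqP.
(* Entries 1 and 5 of a [v4] row are opposite, so adding them removes the plane and leaves an
   equation in [theta] alone. *)
have e1 := congr1 (fun v : 'rV[F]_9 => v 0 (inord 1)) E.
have e5 := congr1 (fun v : 'rV[F]_9 => v 0 (inord 5)) E.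
move: e1 e5; rewrite !mxE !inordK //= x1 !mul1r => e1 e5.
have : 4%:R * theta = 0.
  have -> : 4%:R * theta = (1 + theta + a + (- 3%:R + theta - a)) - (1 - theta + (- 3%:R - theta)) by ring.
  by rewrite -e1 -e5; ring.
by move/eqP; rewrite mulf_eq0 (negPf four_neq0') (negPf th0).
Qed.

Lemma chi_mx_semisym theta U : theta ^+ 2 = - 3%:R -> theta != 0 -> fam U ->
  ~~ stab U mxK -> semisym_mx (chi_mx theta U).
Proof.
move=> th th0 fU nK; apply/and3P; split.
- by apply: Hstab_col; [exact: chi_Hstab | exact: fam_Hstab].
- apply: contra nK => sK; apply/row_subP => k; rewrite row_mul.
  have [a [b [c [e rE]]]] := fam_v4 fU (row_sub k U).
  rewrite rE v4_K; apply: (chi_mx_v4 (theta := theta)) => //.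
  rewrite -v4_K -rE; apply: stab_row => //.
  exact: submx_trans (row_sub k U) (fam_sub_chi_mx _ _).
- apply: contra (chi_opp_sub th0 fU) => sR.
  by rewrite -chi_R; apply: stab_row => //; exact: chi_sub_chi_mx.
Qed.

Theorem semisym_structure d (W : 'M[F]_(d, 9)) : semisym_mx W ->
  exists U, [/\ fam U, (U <= W)%MS,
    forall a b c e, (v4 a b c e <= W)%MS -> (v4 a b c e <= U)%MS,
    ~~ stab U mxK &
    ~~ stab U mxR \/
      stab U mxR /\ exists theta : F, [/\ theta ^+ 2 = - 3%:R, theta != 0 & (chi theta <= W)%MS]].
Proof.
case/and3P=> HW nK nR.
have two0 := two_neq0 pr_p odd_p.
have split2 (w : 'rV[F]_9) (A : 'M[F]_9) : 2%:R *: (w *m A) =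
    (w + w *m mxI *m mxI) *m A + (w - w *m mxI *m mxI) *m A.
  by rewrite -mulmxDl addrACA addrC addrN add0r -mulr2n -scaler_nat scalemxAl.
have minusW (w : 'rV[F]_9) : (w <= W)%MS -> ((w - w *m mxI *m mxI)%R <= W)%MS.
  by move=> wW; rewrite addmx_sub ?eqmx_opp ?HI.
(* By [plus_kappa] the component fixed by [rho ^+ 4] stays in [W] under kappa, so the failure comes
   from the other component. It gives a nonzero [v4] row whose kappa-image is outside [W]. *)
have [w wW nwK] := stabPn nK; have [a [b [c [e mE]]]] := minus_v4 w.
have vW : (v4 a b c e <= W)%MS by rewrite -mE minusW.
have nvK : ~~ (v4 a b c e *m mxK <= W)%MS.
  apply: contra nwK => vK; apply: (subZ_inv two0).
  by rewrite split2 addmx_sub ?plus_kappa // mE.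
have v0 : v4 a b c e != 0 by apply: contraNneq nvK => ->; rewrite mul0mx sub0mx.
have nall : ~ (forall a b c e, (v4 a b c e <= W)%MS).
  by move=> all; move: nvK; rewrite v4_K all.
have [_ _ /(_ _ _ _ _ _ _ HW vW v0 nall)[U [fU UW v4U]]] := sf.
have nUK : ~~ stab U mxK.
  apply: contra nvK => sK; apply: submx_trans UW.
  by apply: stab_row => //; exact: v4U.
exists U; split=> //; case: (boolP (stab U mxR)) => sR; [right; split=> // | by left].
(* With [U] stable under rho, the failure of rho lies in the fixed part of [rho ^+ 4]; [plus_rho]
   reduces it to a [v2] row, from which [v2_chi] extracts the eigenvector. *)
have [x xW nxR] := stabPn nR; have [a' [b' [c' [e' m'E]]]] := minus_v4 x.
have [a2 [b2 [yW yR]]] := plus_rho pr_p odd_p HW xW.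
apply: (v2_chi HW yW); apply: contra nxR => /yR pR; apply: (subZ_inv two0).
rewrite split2 addmx_sub // m'E; apply: submx_trans UW; apply: stab_row => //.
by apply: v4U; rewrite -m'E minusW.
Qed.

Definition minimal_semisym d (Z : 'M[F]_(d, 9)) : Prop :=
  semisym_mx Z /\ forall d' (B : 'M[F]_(d', d)), row_free B -> (0 < d' < d)%N ->
    ~~ semisym_mx (B *m Z).

Definition minimal_Hstab d (Z : 'M[F]_(d, 9)) : Prop :=
  Hstab Z /\ forall d' (B : 'M[F]_(d', d)), row_free B -> (0 < d' < d)%N ->
    ~~ Hstab (B *m Z).

Lemma minimal_semisym_sub d d' (Z : 'M[F]_(d, 9)) (Z' : 'M[F]_(d', 9)) :
  row_free Z -> minimal_semisym Z -> row_free Z' -> (0 < d')%N ->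
  semisym_mx Z' -> (Z' <= Z)%MS -> d' = d /\ (Z <= Z')%MS.
Proof.
move=> freeZ [_ minZ] freeZ' d'0 sZ' sub; have /submxP[B BE] := sub.
have freeB : row_free B.
  apply/eqP/anti_leq; rewrite rank_leq_row -{1}(eqP freeZ') BE; exact: mxrankM_maxl.
have d'd : (d' <= d)%N by have := mxrankS sub; rewrite (eqP freeZ) (eqP freeZ').
have dd : d' = d.
  apply/eqP; rewrite eqn_leq d'd leqNgt; apply/negP => lt.
  by have := minZ d' B freeB; rewrite d'0 lt -BE sZ' => /(_ isT).
split=> //; rewrite -(geq_leqif (mxrank_leqif_sup sub)).
by rewrite (eqP freeZ) (eqP freeZ') dd.
Qed.

Theorem minimal_semisym_classification d (Z : 'M[F]_(d, 9)) :
  row_free Z -> minimal_semisym Z ->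
  exists U, [/\ fam U, ~~ stab U mxK &
    (d = 2%N /\ ~~ stab U mxR /\ (U <= Z)%MS) \/
    (d = 3%N /\ stab U mxR /\ exists theta : F,
       [/\ theta ^+ 2 = - 3%:R, theta != 0 & (chi_mx theta U <= Z)%MS])].
Proof.
move=> freeZ minZ; have [sZ _] := minZ.
have [U [fU UZ v4U nK [nR | [sR [th [th2 th0 chiZ]]]]]] := semisym_structure sZ;
  exists U; split=> //; [left | right].
  have sU : semisym_mx U by rewrite /semisym_mx fam_Hstab // nK.
  by have [e _] := minimal_semisym_sub freeZ minZ (fam_free fU) isT sU UZ.
have sub := sub_chi_mx chiZ UZ.
have [e _] := minimal_semisym_sub freeZ minZ (chi_mx_free th fU) isT
  (chi_mx_semisym th2 th0 fU nK) sub.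
by split=> //; split=> //; exists th.
Qed.

Lemma v4_all_rank d (W : 'M[F]_(d, 9)) :
  (forall a b c e, (v4 a b c e <= W)%MS) -> (2 < \rank W)%N.
Proof.
move=> all; pose M : 'M[F]_(3, 9) := \matrix_(k < 3, l < 9)
  v4 (k == 0 :> nat)%:R (k == 1 :> nat)%:R (k == 2 :> nat)%:R 0 0 l.
have freeM : row_free M.
  apply/row_freeP; exists (\matrix_(l < 9, k < 3) (l == k.+1 :> nat)%:R).
  apply/matrixP => i j; rewrite !mxE !big_ord_recl big_ord0 !mxE.
  case: i => [[|[|[|i]]] hi] //; case: j => [[|[|[|j]]] hj] //=;
    rewrite ?(mulr0, mulr1, addr0, add0r) //.
have MW : (M <= W)%MS.
  apply/row_subP => k; have -> : row k M = v4 (k == 0 :> nat)%:R (k == 1 :> nat)%:R (k == 2 :> nat)%:R 0.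
    by apply/rowP => l; rewrite !mxE.
  exact: all.
by have := mxrankS MW; rewrite (eqP freeM).
Qed.

(** A nonzero H-stable space inside [U] would contain a whole plane of the family or all [v4] rows,
    and its rank is below 2. *)
Lemma fam_minimal U : fam U -> minimal_Hstab U.
Proof.
move=> fU; split=> [|d' B freeB /andP[d'0 d'2]]; first exact: fam_Hstab.
apply/negP => HB; have rkB : \rank (B *m U) = d'.
  by rewrite mxrankMfree ?fam_free // (eqP freeB).
have /rowV0Pn[v vB v0] : B *m U != 0 by rewrite -mxrank_eq0 rkB -lt0n.
have [a [b [c [e vE]]]] := fam_v4 fU (submx_trans vB (submxMl B U)).
have [_ _ /(_ _ (B *m U) a b c e HB)] := sf; rewrite -vE => /(_ vB v0)[].
  by move=> /v4_all_rank; rewrite rkB => h; have := leq_trans h (ltnW d'2).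
move=> U' [fU' /mxrankS]; rewrite rkB (eqP (fam_free fU')) => h.
by have := leq_ltn_trans h d'2.
Qed.

Lemma Hstab_minimal_semisym d (Z : 'M[F]_(d, 9)) :
  minimal_Hstab Z -> semisym_mx Z -> minimal_semisym Z.
Proof.
move=> [_ minZ] sZ; split=> // d' B freeB d'd.
by rewrite /semisym_mx negb_and minZ.
Qed.

(** The plane found in a smaller semisymmetric space must be [U] itself. As it is stable under rho,
    the structure theorem also yields some [chi theta'], and the rank is already 3. *)
Lemma chi_mx_minimal theta U : theta ^+ 2 = - 3%:R -> theta != 0 -> fam U ->
  ~~ stab U mxK -> stab U mxR -> minimal_semisym (chi_mx theta U).
Proof.
move=> th th0 fU nK sR; split=> [|d' B freeB /andP[d'0 d'3]].
  exact: chi_mx_semisym.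
apply/negP => sB.
have [U' [fU' U'B _ nK' alt]] := semisym_structure sB.
have U'Z : (U' <= chi_mx theta U)%MS := submx_trans U'B (submxMl _ _).
have U'U : (U' <= U)%MS.
  apply/row_subP => k; have [a [b [c [e rE]]]] := fam_v4 fU' (row_sub k U').
  rewrite rE; apply: (chi_mx_v4 (theta := theta)) => //.
  by rewrite -rE; exact: submx_trans (row_sub k U') U'Z.
have /eqmxP eqU : (U' == U)%MS.
  by rewrite -(geq_leqif (mxrank_leqif_eq U'U)) (eqP (fam_free fU)) (eqP (fam_free fU')).
have sR' : stab U' mxR.
  rewrite /stab eqU; apply: submx_trans (submxMr _ _) sR; by rewrite eqU.
case: alt => [|[_ [th' [_ _ chiB]]]]; first by rewrite sR'.
have := mxrankS (sub_chi_mx chiB U'B).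
rewrite (eqP (chi_mx_free th' fU')) => h.
have := leq_trans h (leq_trans (mxrankM_maxl _ _) (rank_leq_row _)).
by rewrite leqNgt d'3.
Qed.

(** The line of [chi theta] is itself H-stable; the matrix [row_mx 1 0] selects it. *)
Lemma chi_mx_not_minimal_Hstab theta U : theta ^+ 2 = - 3%:R ->
  ~ minimal_Hstab (chi_mx theta U).
Proof.
move=> th [_ minZ]; have := minZ 1%N (row_mx 1%:M 0).
rewrite mul_row_col mul0mx addr0 mul1mx chi_Hstab // => h.
suff : ~~ true by []; apply: h => //.
by rewrite -kermx_eq0; apply/rowV0P => w /sub_kermxP; rewrite mul_mx_row mulmx1 -row_mx0 => /eq_row_mx[].
Qed.

End SplitFamily.

Section Linking.

Variable p : nat.
Hypotheses (pr_p : prime p) (odd_p : odd p).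
Local Notation F := 'F_p.
Local Notation mxI := (mxI p).
Local Notation mxO := (mxO p).
Local Notation mxK := (mxK p).
Local Notation mxR := (mxR p).

Lemma row_freeM d d' (B : 'M[F]_(d', d)) (Z : 'M[F]_(d, 9)) :
  row_free B -> row_free Z -> row_free (B *m Z).
Proof. by move=> fB fZ; rewrite /row_free mxrankMfree. Qed.

Lemma minimal_semisymmetric_covmx d (Z : 'M[F]_(d, 9)) : row_free Z ->
  minimal_semisymmetric (covmx Z) <-> minimal_semisym Z.
Proof.
move=> fZ; have E := minimal_covmx pr_p semisym_invariant fZ.
split=> [/E[/(covmx_semisymmetric fZ) sZ h] | [sZ h]].
  split=> // d' B fB d'd; apply/negP => s; apply: (h d' B fB d'd).
  by apply/covmx_semisymmetric; first exact: row_freeM.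
apply/E; split=> [|d' B fB d'd]; first exact/covmx_semisymmetric.
by move=> /(covmx_semisymmetric (row_freeM fB fZ)); exact/negP/h.
Qed.

Lemma minimal_edge_transitive_covmx d (Z : 'M[F]_(d, 9)) : row_free Z ->
  minimal_edge_transitive (covmx Z) <-> minimal_Hstab Z.
Proof.
move=> fZ; have E := minimal_covmx pr_p edge_transitive_invariant fZ.
split=> [/E[/(covmx_edge_transitive fZ) sZ h] | [sZ h]].
  split=> // d' B fB d'd; apply/negP => s; apply: (h d' B fB d'd).
  by apply/covmx_edge_transitive; first exact: row_freeM.
apply/E; split=> [|d' B fB d'd]; first exact/covmx_edge_transitive.
by move=> /(covmx_edge_transitive (row_freeM fB fZ)); exact/negP/h.
Qed.

Lemma act_mx_word_inv d (Z : 'M[F]_(d, 9)) w : Hstab Z -> w \in H_words ->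
  stab Z (invmx (act_mx p (word_perm gen_perm w))).
Proof.
move=> /andP[sI sO] wH; apply: stab_inv; first exact/act_mx_unit/word_perm_Aut.
have : all (fun k => (k == 0) || (k == 1))%N w.
  have : all (all (fun k => (k == 0) || (k == 1))%N) H_words by [].
  by move=> /allP/(_ _ wH).
elim: w {wH} => [|k w IH] /= => [_ | /andP[k01 wH]].
  by rewrite act_mx1 /stab mulmx1.
rewrite act_mxM; [|exact: gen_perm_Aut|exact: word_perm_Aut].
by apply: stabM; [exact: IH | case/orP: k01 => /eqP->].
Qed.

Definition coset_mx : seq 'M[F]_9 := [:: 1%:M; mxK; mxR; mxK *m mxR].

(** Since the row space of [Z] is H-stable, the H-part of the automorphism can be cancelled, leaving
    only a coset representative. *)
Lemma iso_coset d d' (Z : 'M[F]_(d, 9)) (Z' : 'M[F]_(d', 9)) :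
  row_free Z -> Hstab Z -> isomorphic_projections (covmx Z) (covmx Z') ->
  d = d' /\ exists2 C, C \in coset_mx & (Z' *m C <= Z)%MS.
Proof.
move=> fZ HZ /(covmx_isoP fZ)[dd [a aA sub]]; split=> //.
have [c cC [w wH aE]] := Aut_words aA.
have wA := word_perm_Aut w; have cA := word_perm_Aut c.
exists (act_mx p (word_perm gen_perm c)).
  move: cC; rewrite !inE => /or4P[]/eqP->; rewrite /word_perm /= ?mulg1.
  - by rewrite act_mx1 eqxx.
  - by rewrite eqxx ?orbT.
  - by rewrite eqxx ?orbT.
  - by rewrite act_mx_rho_kappa eqxx ?orbT.
move: sub; rewrite aE word_perm_cat act_mxM // mulmxA.
move=> /(submxMr (invmx (act_mx p (word_perm gen_perm w)))).
rewrite mulmxK ?act_mx_unit // => /submx_trans; apply.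
exact: act_mx_word_inv.
Qed.

Lemma coset_iso d (Z Z' : 'M[F]_(d, 9)) C :
  C \in coset_mx -> row_free Z' -> (Z' *m C <= Z)%MS ->
  isomorphic_projections (covmx Z) (covmx Z').
Proof.
move=> + fZ'; rewrite !inE => /or4P[]/eqP->.
- by rewrite -act_mx1; apply: covmx_isoI => //; exact: Aut_graph1.
- by apply: covmx_isoI => //; exact: Aut_kappa.
- by apply: covmx_isoI => //; exact: Aut_rho.
- by rewrite -act_mx_rho_kappa; apply: covmx_isoI => //; exact: Aut_graphM Aut_rho Aut_kappa.
Qed.

Lemma mx2_rows (U : 'M[F]_(2, 9)) (v w : 'rV[F]_9) : row ord0 U = v -> row (inord 1) U = w ->
  forall d (W : 'M[F]_(d, 9)), (U <= W)%MS = (v <= W)%MS && (w <= W)%MS.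
Proof.
move=> <- <- d W; apply/idP/andP => [h | [h0 h1]].
  by split; apply: submx_trans h; exact: row_sub.
apply/row_subP => k; have [->|->] // : k = ord0 \/ k = inord 1.
case: k => [[|[|k]]] h //; [left | right]; apply: val_inj => //=.
by rewrite inordK.
Qed.

Lemma mx2_comb (U : 'M[F]_(2, 9)) (v w x : 'rV[F]_9) : row ord0 U = v -> row (inord 1) U = w ->
  (x <= U)%MS <-> exists a b, x = a *: v + b *: w.
Proof.
move=> vE wE; split=> [/submxP[D ->] | [a [b ->]]].
  exists (D 0 ord0), (D 0 (inord 1)); rewrite -vE -wE; apply/rowP => k.
  rewrite !mxE !big_ord_recl big_ord0 addr0; congr (_ + D 0 _ * U _ _);
    by apply: val_inj; rewrite /= inordK.
by rewrite -vE -wE addmx_sub // scalemx_sub // row_sub.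
Qed.

Lemma mx2_free (U : 'M[F]_(2, 9)) (v w : 'rV[F]_9) : row ord0 U = v -> row (inord 1) U = w ->
  (forall a b, a *: v + b *: w = 0 -> a = 0 /\ b = 0) -> row_free U.
Proof.
move=> vE wE h; rewrite -kermx_eq0; apply/rowV0P => D /sub_kermxP E.
have := h (D 0 ord0) (D 0 (inord 1)); rewrite -vE -wE => -[|a0 b0].
  rewrite -E; apply/rowP => k.
  rewrite !mxE !big_ord_recl big_ord0 addr0; congr (_ + D 0 _ * U _ _);
    by apply: val_inj; rewrite /= inordK.
apply/rowP => k; rewrite mxE; have [->|->] // : k = ord0 \/ k = inord 1.
case: k => [[|[|k]]] hk //; [left | right]; apply: val_inj => //=.
by rewrite inordK.
Qed.

End Linking.

(** * The stable planes *)

Section RowPairs.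

Variable p : nat.
Local Notation F := 'F_p.

Definition rows2 (v w : 'rV[F]_9) : 'M[F]_(2, 9) :=
  \matrix_(r < 2) (if r == ord0 then v else w).

Lemma rows2_0 v w : row ord0 (rows2 v w) = v. Proof. by rewrite rowK. Qed.
Lemma rows2_1 v w : row (inord 1) (rows2 v w) = w.
Proof. by rewrite rowK -val_eqE /= inordK. Qed.

Lemma rows2_mul v w (C : 'M[F]_9) : rows2 v w *m C = rows2 (v *m C) (w *m C).
Proof. by apply/row_matrixP => k; rewrite row_mul !rowK; case: ifP. Qed.

Lemma rows2_sub v w d (W : 'M[F]_(d, 9)) :
  (rows2 v w <= W)%MS = (v <= W)%MS && (w <= W)%MS.
Proof. exact: mx2_rows (rows2_0 v w) (rows2_1 v w) _ _. Qed.

Lemma rows2_comb v w (x : 'rV[F]_9) :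
  (x <= rows2 v w)%MS <-> exists a b, x = a *: v + b *: w.
Proof. exact: mx2_comb (rows2_0 v w) (rows2_1 v w). Qed.

Lemma sub_rows2_0 v w : (v <= rows2 v w)%MS.
Proof. by rewrite -{1}(rows2_0 v w) row_sub. Qed.

Lemma sub_rows2_1 v w : (w <= rows2 v w)%MS.
Proof. by rewrite -{1}(rows2_1 v w) row_sub. Qed.

End RowPairs.

(** * Stable planes when -1 is a square *)

Section FamilyA.

Variable p : nat.
Hypotheses (pr_p : prime p) (odd_p : odd p).
Local Notation F := 'F_p.
Local Notation mxI := (mxI p).
Local Notation mxO := (mxO p).
Local Notation mxK := (mxK p).
Local Notation mxR := (mxR p).
Variable i : F.
Hypothesis i2 : i ^+ 2 = -1.

Let two0 := two_neq0 pr_p odd_p.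

Definition ev (x y : F) : 'rV[F]_9 := v4 x y (x * i) (y * i).
(** The [ev] rows are the eigenvectors of [rho ^+ 2] for [i]. The row [fv x y] is, up to a scalar,
    the component for [- i] of the omega-image of [ev x y], as [ev_O] shows; so the two span an
    H-stable plane. *)
Definition fv (x y : F) : 'rV[F]_9 :=
  v4 (x * i + y * (1 + i)) (- (1 + i) * x - y) (x + y * (1 - i)) (x * (i - 1) + y * i).

Definition UA (x y : F) : 'M[F]_(2, 9) := rows2 (ev x y) (fv x y).

Arguments ev (x y)%_R.
Arguments fv (x y)%_R.
Arguments UA (x y)%_R.

Ltac v4ring := congr v4; (ring || ring: i2).

Lemma evZ c x y : c *: ev x y = ev (c * x) (c * y).
Proof. by rewrite v4Z; v4ring. Qed.
Lemma fvZ c x y : c *: fv x y = fv (c * x) (c * y).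
Proof. by rewrite v4Z; v4ring. Qed.
Lemma evD x y x' y' : ev x y + ev x' y' = ev (x + x') (y + y').
Proof. by rewrite v4D; v4ring. Qed.
Lemma ev_I x y : ev x y *m mxI = i *: ev x y.
Proof. by rewrite v4_I v4Z; v4ring. Qed.
Lemma fv_I x y : fv x y *m mxI = (- i) *: fv x y.
Proof. by rewrite v4_I v4Z; v4ring. Qed.
Lemma ev_O x y : 2%:R *: (ev x y *m mxO) = (i - 1) *: ev x y + (1 + i) *: fv x y.
Proof. by rewrite v4_O !v4Z v4D; v4ring. Qed.
Lemma fv_O x y : 2%:R *: (fv x y *m mxO) = (i - 1) *: ev x y - (1 + i) *: fv x y.
Proof. by rewrite v4_O -scaleNr !v4Z v4D; v4ring. Qed.
Lemma ev_K x y : ev x y *m mxK = fv (- i * x - (1 + i) * y) ((i - 1) * x + i * y).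
Proof. by rewrite v4_K; v4ring. Qed.
Lemma fv_K x y : fv x y *m mxK = ev (- i * x - (1 + i) * y) ((i - 1) * x + i * y).
Proof. by rewrite v4_K; v4ring. Qed.
Lemma ev_R x y : ev x y *m mxR = ev y (i * x).
Proof. by rewrite v4_R; v4ring. Qed.
Lemma fv_R x y : fv x y *m mxR = i *: fv y (i * x).
Proof. by rewrite v4_R v4Z; v4ring. Qed.

Lemma v4_ev_fv a b c e :
  2%:R *: v4 a b c e = ev (a - i * c) (b - i * e)
    + fv (i * (a + i * c) + (i - 1) * (b + i * e)) ((1 - i) * (a + i * c) + (b + i * e)).
Proof. by rewrite v4Z v4D; v4ring. Qed.

Lemma v4_ev a b c e :
  v4 a b c e - i *: (v4 a b c e *m mxI) = ev (a - i * c) (b - i * e).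
Proof. by rewrite v4_I -scaleNr v4Z v4D; v4ring. Qed.

Lemma i_neq0 : i != 0.
Proof. by apply: contraNneq (oner_neq0 F) => i0; rewrite -oppr_eq0 -i2 i0 expr0n. Qed.

Lemma one_i_neq0 : 1 + i != 0.
Proof.
apply: contraNneq two0 => h; have -> : 2%:R = (1 + i) * (1 - i) by ring: i2.
by rewrite h mul0r.
Qed.

Lemma i_one_neq0 : i - 1 != 0.
Proof.
apply: contraNneq two0 => h; have -> : 2%:R = (i - 1) * (- 1 - i) by ring: i2.
by rewrite h mul0r.
Qed.

Lemma UA_Hstab x y : Hstab (UA x y).
Proof.
rewrite /Hstab /stab !rows2_mul !rows2_sub ev_I fv_I.
rewrite !scalemx_sub ?sub_rows2_0 ?sub_rows2_1 //=; apply/andP; split; apply: (subZ_inv two0).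
  by rewrite ev_O addmx_sub // scalemx_sub ?sub_rows2_0 ?sub_rows2_1.
by rewrite fv_O addmx_sub ?eqmx_opp // scalemx_sub ?sub_rows2_0 ?sub_rows2_1.
Qed.

Lemma ev_eq0 x y : ev x y = 0 -> x = 0 /\ y = 0.
Proof. by rewrite -v4_0 => /v4_inj[]. Qed.

Lemma fv_eq0 x y : fv x y = 0 -> x = 0 /\ y = 0.
Proof.
move=> E; have := fv_O x y; rewrite E mul0mx !scaler0 subr0 evZ => /esym/ev_eq0[/eqP + /eqP].
by rewrite !mulf_eq0 (negPf i_one_neq0) => /eqP-> /eqP->.
Qed.

Lemma ev_fv_comb a b x y x' y' : ev x y = a *: ev x' y' + b *: fv x' y' ->
  x = a * x' /\ y = a * y'.
Proof.
rewrite !v4Z v4D => /v4_inj[e1 e2 e3 e4].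
(* The first and third entries of an [ev] row are [z] and [z * i], while those of an [fv] row
   satisfy [i * u + v = 0]. Comparing both entries eliminates [b]; entries two and four behave
   alike. *)
have key (z c u v : F) : z = c + b * u -> z * i = c * i + b * v -> i * u + v = 0 -> z = c.
  move=> h1 h2 h3; apply/eqP; rewrite -subr_eq0 -(mulIr_eq0 _ (mulIf i_neq0)).
  have : (z - c) * i * 2%:R = b * (i * u + v).
    have -> : (z - c) * i * 2%:R = i * (z - c) + (z * i - c * i) by ring.
    by rewrite {1}h1 h2; ring.
  by rewrite h3 mulr0 => /eqP h; rewrite mulf_eq0 (negPf two0) orbF in h.
split.
  by apply: (key x _ _ (x' + y' * (1 - i)) e1); [rewrite e3; ring | ring: i2].
by apply: (key y _ _ (x' * (i - 1) + y' * i) e2); [rewrite e4; ring | ring: i2].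
Qed.

Lemma UA_free x y : (x != 0) || (y != 0) -> row_free (UA x y).
Proof.
move=> xy; apply: mx2_free (rows2_0 _ _) (rows2_1 _ _) _ => a b E.
have a0 : a = 0.
  have : ev 0 0 = a *: ev x y + b *: fv x y.
    by rewrite E -v4_0; v4ring.
  move=> /ev_fv_comb[/esym/eqP h /esym/eqP h']; move: h h'; rewrite !mulf_eq0.
  by case/orP: xy => /negPf->; rewrite ?orbF => /eqP h /eqP h'; rewrite ?h ?h'.
split=> //; move: E; rewrite a0 scale0r add0r => E.
move: E; rewrite fvZ => /fv_eq0[/eqP + /eqP]; rewrite !mulf_eq0.
by case/orP: xy => /negPf->; rewrite ?orbF => /eqP h /eqP h'; rewrite ?h ?h'.
Qed.

Definition famA (U : 'M[F]_(2, 9)) : Prop :=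
  exists x y, ((x != 0) || (y != 0)) /\ U = UA x y.

Definition same_ratio (u v : F * F) : bool := u.1 * v.2 == v.1 * u.2.

Lemma same_ratioP (x y x' y' : F) : (x != 0) || (y != 0) ->
  reflect (exists c, x' = c * x /\ y' = c * y) (same_ratio (x, y) (x', y')).
Proof.
move=> xy; apply: (iffP eqP) => /= [E | [c [-> ->]]]; last by ring.
have [x0 | x0] := eqVneq x 0; last first.
  exists (x' / x); rewrite divfK //; split=> //.
  by apply: (mulfI x0); rewrite E; field.
rewrite x0 eqxx /= in xy; exists (y' / y); rewrite divfK // x0 mulr0; split=> //.
by apply/eqP; move/eqP: E; rewrite x0 mul0r eq_sym mulf_eq0 (negPf xy) orbF.
Qed.

Lemma UA_subP x y x' y' : (x != 0) || (y != 0) -> (x' != 0) || (y' != 0) ->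
  (UA x y <= UA x' y')%MS = same_ratio (x, y) (x', y').
Proof.
move=> xy xy'; rewrite rows2_sub; apply/andP/idP => [[/rows2_comb[a [b E]] _] | h].
  by have [-> ->] := ev_fv_comb E; apply/eqP => /=; ring.
have /(same_ratioP _ _ xy')[c [-> ->]] : same_ratio (x', y') (x, y).
  by rewrite /same_ratio eq_sym.
by rewrite -evZ -fvZ !scalemx_sub ?sub_rows2_0 ?sub_rows2_1.
Qed.

Lemma UA_K x y : UA x y *m mxK =
  rows2 (fv (- i * x - (1 + i) * y) ((i - 1) * x + i * y))
        (ev (- i * x - (1 + i) * y) ((i - 1) * x + i * y)).
Proof. by rewrite rows2_mul ev_K fv_K. Qed.

Lemma UA_K_sub x y d (W : 'M[F]_(d, 9)) : (UA x y *m mxK <= W)%MS =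
  (UA (- i * x - (1 + i) * y) ((i - 1) * x + i * y) <= W)%MS.
Proof. by rewrite UA_K !rows2_sub andbC. Qed.

Lemma UA_R_sub x y d (W : 'M[F]_(d, 9)) : (UA x y *m mxR <= W)%MS = (UA y (i * x) <= W)%MS.
Proof.
rewrite rows2_mul ev_R fv_R !rows2_sub; congr (_ && _).
by apply/idP/idP => [/(subZ_inv i_neq0) // | h]; exact: scalemx_sub.
Qed.

(** The eigenprojections of [rho ^+ 2] split every [v4] row of [W], and omega links the two
    eigenspaces. Hence the intersection is governed by the pairs [(x, y)] with [ev x y] in [W],
    which form a line in the plane of all pairs. *)
Lemma split_family_A : split_family famA.
Proof.
split=> [U [x [y [xy ->]]] | U v [x [y [xy ->]]] | d W a b c e HW vW v0 nall].
- by split; [exact: UA_free | exact: UA_Hstab].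
- case/rows2_comb=> a [b ->]; rewrite !v4Z v4D.
  by do 4!eexists.
have evW x y : (fv x y <= W)%MS -> (ev x y <= W)%MS.
  move=> fW; apply: (subZ_inv i_one_neq0).
  have -> : (i - 1) *: ev x y = 2%:R *: (fv x y *m mxO) + (1 + i) *: fv x y.
    by rewrite fv_O subrK.
  by rewrite addmx_sub // scalemx_sub // HO.
have fvW x y : (ev x y <= W)%MS -> (fv x y <= W)%MS.
  move=> eW; apply: (subZ_inv one_i_neq0).
  have -> : (1 + i) *: fv x y = 2%:R *: (ev x y *m mxO) - (i - 1) *: ev x y.
    by rewrite ev_O addrAC subrr add0r.
  by rewrite addmx_sub ?eqmx_opp // scalemx_sub // HO.
have comps a' b' c' e' : (v4 a' b' c' e' <= W)%MS -> exists x1 y1 x2 y2,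
    [/\ 2%:R *: v4 a' b' c' e' = ev x1 y1 + fv x2 y2, (ev x1 y1 <= W)%MS & (ev x2 y2 <= W)%MS].
  move=> v'W; have E := v4_ev_fv a' b' c' e'.
  have e1W : (ev (a' - i * c') (b' - i * e') <= W)%MS.
    by rewrite -v4_ev addmx_sub ?eqmx_opp // scalemx_sub // HI.
  do 4!eexists; split; [exact: E | exact: e1W |].
  apply: evW; have -> : fv (i * (a' + i * c') + (i - 1) * (b' + i * e'))
      ((1 - i) * (a' + i * c') + (b' + i * e')) = 2%:R *: v4 a' b' c' e' - ev (a' - i * c') (b' - i * e').
    by rewrite E addrAC subrr add0r.
  by rewrite addmx_sub ?eqmx_opp // scalemx_sub.
have [x [y [xy eW]]] : exists x y, ((x != 0) || (y != 0)) /\ (ev x y <= W)%MS.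
  have [x1 [y1 [x2 [y2 [E e1 e2]]]]] := comps _ _ _ _ vW.
  case: (boolP ((x1 != 0) || (y1 != 0))) => h1; first by exists x1, y1.
  case: (boolP ((x2 != 0) || (y2 != 0))) => h2; first by exists x2, y2.
  move: h1 h2 E; rewrite !negb_or !negbK => /andP[/eqP-> /eqP->] /andP[/eqP-> /eqP->].
  have -> : ev 0 0 + fv 0 0 = 0 by rewrite v4D -v4_0; v4ring.
  by move/eqP; rewrite scaler_eq0 (negPf two0) (negPf v0).
(* Two nonproportional [ev] rows would give all [ev] rows, then all [fv] rows through omega, and so
   the whole 4-dimensional part. *)
have ratio x' y' : (ev x' y' <= W)%MS -> exists c', x' = c' * x /\ y' = c' * y.
  move=> e'W; apply/(same_ratioP _ _ xy); apply/negPn/negP => D0; apply: nall => a' b' c' e'.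
  have {}D0 : x * y' - x' * y != 0 by rewrite subr_eq0.
  have ev10 : (ev 1 0 <= W)%MS.
    apply: (subZ_inv D0).
    have -> : (x * y' - x' * y) *: ev 1 0 = y' *: ev x y + (- y) *: ev x' y'.
      by rewrite !evZ evD; congr ev; ring.
    by rewrite addmx_sub // scalemx_sub.
  have ev01 : (ev 0 1 <= W)%MS.
    apply: (subZ_inv D0).
    have -> : (x * y' - x' * y) *: ev 0 1 = (- x') *: ev x y + x *: ev x' y'.
      by rewrite !evZ evD; congr ev; ring.
    by rewrite addmx_sub // scalemx_sub.
  have evall u v : (ev u v <= W)%MS.
    have -> : ev u v = u *: ev 1 0 + v *: ev 0 1 by rewrite !evZ evD; congr ev; ring.
    by rewrite addmx_sub // scalemx_sub.
  by apply: (subZ_inv two0); rewrite v4_ev_fv addmx_sub // fvW.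
exists (UA x y); split; first by exists x, y.
  by rewrite rows2_sub eW fvW.
move=> a' b' c' e' /comps[x1 [y1 [x2 [y2 [E /ratio[c1 [e1 e2]] /ratio[c2 [e3 e4]]]]]]].
apply: (subZ_inv two0); rewrite E e1 e2 e3 e4 -evZ -fvZ.
by rewrite addmx_sub // scalemx_sub ?sub_rows2_0 ?sub_rows2_1.
Qed.

End FamilyA.

Arguments ev {p} i (x y)%_R.
Arguments fv {p} i (x y)%_R.
Arguments UA {p} i (x y)%_R.

Section ProjectiveLine.

Variable p : nat.
Local Notation F := 'F_p.

Definition pt (z : option F) : F * F := if z is Some s then (s, 1) else (1, 0).

Lemma pt_neq0 z : ((pt z).1 != 0) || ((pt z).2 != 0).
Proof. by apply/orP; case: z => [s|]; [right | left]; exact: oner_neq0. Qed.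

Lemma pt_ratio z z' : same_ratio (pt z) (pt z') = (z == z').
Proof.
have n1 : (1 == 0 :> F) = false by apply: negPf; exact: oner_neq0.
case: z z' => [s|] [t|]; rewrite /same_ratio /pt [_.1]/= [_.2]/= [X in X == _]/= [X in _ == X]/=.
- by rewrite !mulr1.
- by rewrite mulr0 mulr1 eq_sym n1.
- by rewrite mulr1 mulr0 n1.
- by rewrite mulr0 !eqxx.
Qed.

(** In homogeneous coordinates a Möbius map is linear up to a nonzero factor [k]. Composition and
    fixed points are derived from this without treating infinity separately. *)
Lemma mobius_pt (a b c d : F) z : a * d - b * c != 0 ->
  exists2 k, k != 0 & a * (pt z).1 + b * (pt z).2 = k * (pt (mobius a b c d z)).1 /\
                      c * (pt z).1 + d * (pt z).2 = k * (pt (mobius a b c d z)).2.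
Proof.
move=> D0; case: z => [s|] /=; rewrite ?mulr1 ?mulr0 ?addr0; case: eqP => [E | /eqP E] /=.
- exists (a * s + b); last by rewrite mulr1 mulr0.
  apply: contraNneq D0 => h; have -> : a * d - b * c = a * (c * s + d) - c * (a * s + b) by ring.
  by rewrite E h !mulr0 subrr.
- by exists (c * s + d); rewrite // [X in _ = X /\ _]mulrC divfK // mulr1.
- exists a; last by rewrite mulr1 mulr0.
  by apply: contraNneq D0 => h; rewrite h E mul0r mulr0 subrr.
- by exists c; rewrite // [X in _ = X /\ _]mulrC divfK // mulr1.
Qed.

Lemma mobius_comp (a b c d a' b' c' d' : F) z :
  a * d - b * c != 0 -> a' * d' - b' * c' != 0 ->
  mobius a b c d (mobius a' b' c' d' z) =
  mobius (a * a' + b * c') (a * b' + b * d') (c * a' + d * c') (c * b' + d * d') z.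
Proof.
move=> D0 D0'; set M := RHS.
have D0'' : (a * a' + b * c') * (c * b' + d * d') - (a * b' + b * d') * (c * a' + d * c') != 0.
  rewrite (_ : _ - _ = (a * d - b * c) * (a' * d' - b' * c')); first exact: mulf_neq0.
  by ring.
have [k1 k10 [e1 e2]] := mobius_pt z D0'.
have [k2 k20 [e3 e4]] := mobius_pt (mobius a' b' c' d' z) D0.
have [k3 k30 [e5 e6]] := mobius_pt z D0''.
apply/eqP; rewrite -pt_ratio /same_ratio; apply/eqP.
move: e1 e2 e3 e4 e5 e6; rewrite -/M.
move: (pt z) (pt (mobius a' _ _ _ z)) (pt (mobius a _ _ _ _)) (pt M) => [x y] [x1 y1] [x2 y2] [x3 y3] /=.
move=> e1 e2 e3 e4 e5 e6.
have k0 : k1 * k2 * k3 != 0 by rewrite !mulf_neq0.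
apply: (mulfI k0).
have -> : k1 * k2 * k3 * (x2 * y3) = k1 * (k2 * x2) * (k3 * y3) by ring.
have -> : k1 * k2 * k3 * (x3 * y2) = k1 * (k2 * y2) * (k3 * x3) by ring.
rewrite -e3 -e4 -e5 -e6.
have -> : k1 * (a * x1 + b * y1) = a * (k1 * x1) + b * (k1 * y1) by ring.
have -> : k1 * (c * x1 + d * y1) = c * (k1 * x1) + d * (k1 * y1) by ring.
by rewrite -e1 -e2; ring.
Qed.

Lemma mobius_scalar (l : F) z : l != 0 -> mobius l 0 0 l z = z.
Proof.
move=> l0; case: z => [s|]; rewrite /mobius; last by rewrite eqxx.
by rewrite mul0r add0r (negPf l0) addr0 mulrAC divff // mul1r.
Qed.

Lemma mobius_scale (l a b c d : F) z : l != 0 -> a * d - b * c != 0 ->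
  mobius (l * a) (l * b) (l * c) (l * d) z = mobius a b c d z.
Proof.
move=> l0 D0; rewrite -[RHS](mobius_scalar _ l0) mobius_comp //.
  by congr (mobius _ _ _ _ _); ring.
by rewrite mul0r subr0 mulf_neq0.
Qed.

End ProjectiveLine.

Section OrbitsA.

Variable p : nat.
Hypotheses (pr_p : prime p) (odd_p : odd p).
Local Notation F := 'F_p.
Local Notation mxK := (mxK p).
Local Notation mxR := (mxR p).
Variable i : F.
Hypothesis i2 : i ^+ 2 = -1.

Let two0 := two_neq0 pr_p odd_p.
Let i0 := i_neq0 i2.
Let i10 := i_one_neq0 pr_p odd_p i2.

Definition mobR (z : option F) := mobius 0 (- i) 1 0 z.
Definition mobK (z : option F) := mobius ((i - 1) / 2%:R) i 1 (- ((i - 1) / 2%:R)) z.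
Definition mobKR (z : option F) := mobius (i - 1) i 1 (- (i - 1)) z.

Let h : F := (i - 1) / 2%:R.

Lemma half_neq0 : h != 0. Proof. by rewrite mulf_neq0 ?invr_neq0. Qed.
Lemma half2 : 2%:R * h = i - 1. Proof. by rewrite mulrC divfK. Qed.
Lemma half_sqr : 2%:R * h ^+ 2 = - i.
Proof.
apply: (mulfI two0); have -> : 2%:R * (2%:R * h ^+ 2) = (2%:R * h) ^+ 2 by ring.
by rewrite half2; ring: i2.
Qed.

Lemma half_i : h * i = h - i.
Proof.
apply: (addrI (- h)); have -> : - h + (h - i) = 2%:R * h ^+ 2 by rewrite half_sqr; ring.
have -> : - h + h * i = h * (i - 1) by ring.
by rewrite -half2; ring.
Qed.

Lemma detR : 0 * 0 - (- i) * 1 != 0. Proof. by rewrite mul0r sub0r mulr1 opprK. Qed.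
Lemma detK : h * (- h) - i * 1 != 0.
Proof.
rewrite -(mulrI_eq0 _ (mulfI two0)).
have -> : 2%:R * (h * (- h) - i * 1) = - (2%:R * h ^+ 2) - 2%:R * i by ring.
by rewrite half_sqr (_ : - - i - 2%:R * i = - i); [rewrite oppr_eq0 | ring].
Qed.
Lemma detKR : (i - 1) * (- (i - 1)) - i * 1 != 0.
Proof. by have -> : (i - 1) * (- (i - 1)) - i * 1 = i by ring: i2. Qed.

Lemma mobRR z : mobR (mobR z) = z.
Proof.
rewrite /mobR mobius_comp ?detR // -[RHS](mobius_scalar z (l := - i)) ?oppr_eq0 //.
by congr (mobius _ _ _ _ _); ring.
Qed.

Lemma mobKK z : mobK (mobK z) = z.
Proof.
rewrite /mobK mobius_comp ?detK //.
have l0 : h * h + i != 0.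
  by apply: contraNneq detK => E; rewrite mulrN -opprD mulr1 E oppr0.
by rewrite -[RHS](mobius_scalar z l0); congr (mobius _ _ _ _ _); rewrite /h; ring.
Qed.

Lemma mobR_K z : mobR (mobK z) = mobKR z.
Proof.
rewrite /mobR /mobK mobius_comp ?detK ?detR // -[RHS](mobius_scale _ half_neq0 detKR).
by have e := half_i; rewrite -/h; congr (mobius _ _ _ _ _); ring: e.
Qed.

Lemma mobK_R z : mobK (mobR z) = mobKR z.
Proof.
have nh : - h != 0 by rewrite oppr_eq0 half_neq0.
rewrite /mobR /mobK mobius_comp ?detK ?detR // -[RHS](mobius_scale _ nh detKR).
by have e := half_i; rewrite -/h; congr (mobius _ _ _ _ _); ring: e.
Qed.

Lemma orbitAE z : orbitA i z = [set z; mobR z; mobK z; mobKR z].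
Proof. by []. Qed.

Definition UAo (z : option F) : 'M[F]_(2, 9) := UA i (pt z).1 (pt z).2.

Lemma UA_scale_sub c x y d (W : 'M[F]_(d, 9)) : c != 0 ->
  (UA i (c * x) (c * y) <= W)%MS = (UA i x y <= W)%MS.
Proof.
move=> c0; rewrite !rows2_sub -evZ -fvZ; congr (_ && _); apply/idP/idP;
  by [exact: scalemx_sub | exact: subZ_inv].
Qed.

Lemma UAo_sub z z' : (UAo z <= UAo z')%MS = (z == z').
Proof. by rewrite UA_subP ?pt_neq0 // -pt_ratio; case: (pt z) (pt z') => ? ? []. Qed.

Lemma UAo_K z d (W : 'M[F]_(d, 9)) : (UAo z *m mxK <= W)%MS = (UAo (mobK z) <= W)%MS.
Proof.
rewrite UA_K_sub //; have [k k0 [e1 e2]] := mobius_pt z detK.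
(* The linear action of kappa on [(x, y)] is [i - 1] times the matrix of [mobK]; the factor drops
   out in the plane. *)
have k'0 : (i - 1) * k != 0 by rewrite mulf_neq0.
rewrite /UAo /mobK -/h -[RHS](UA_scale_sub _ _ _ k'0) -!mulrA -e1 -e2; congr (UA _ _ _ <= _)%MS.
  have -> : (i - 1) * (h * (pt z).1 + i * (pt z).2) =
     2%:R * h ^+ 2 * (pt z).1 + (i - 1) * i * (pt z).2 by rewrite -half2; ring.
  by rewrite half_sqr; ring: i2.
have -> : (i - 1) * (1 * (pt z).1 + - h * (pt z).2) =
   (i - 1) * (pt z).1 - 2%:R * h ^+ 2 * (pt z).2 by rewrite -half2; ring.
by rewrite half_sqr; ring.
Qed.

Lemma UAo_R z d (W : 'M[F]_(d, 9)) : (UAo z *m mxR <= W)%MS = (UAo (mobR z) <= W)%MS.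
Proof.
rewrite UA_R_sub //; have [k k0 [e1 e2]] := mobius_pt z detR.
have k'0 : i * k != 0 by rewrite mulf_neq0.
by rewrite /UAo /mobR -[RHS](UA_scale_sub _ _ _ k'0) -!mulrA -e1 -e2; congr (UA _ _ _ <= _)%MS; ring: i2.
Qed.

Lemma mobius_fixed (a b c d s : F) : a * d - b * c != 0 ->
  (mobius a b c d (Some s) == Some s) = (a * s + b == s * (c * s + d)).
Proof.
move=> D0; have [k k0 [e1 e2]] := mobius_pt (Some s) D0.
rewrite -pt_ratio /same_ratio -(inj_eq (mulfI k0)) mulrA -e1 mulrCA -e2 /= !mulr1.
by [].
Qed.

Lemma mobK_fixed s : (mobK (Some s) == Some s) = (s == -1) || (s == i).
Proof.
rewrite mobius_fixed ?detK // -/h -subr_eq0.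
have -> : h * s + i - s * (1 * s + - h) = - ((s - -1) * (s - i)) + (2%:R * h - (i - 1)) * s by ring.
by rewrite half2 subrr mul0r addr0 oppr_eq0 mulf_eq0 !subr_eq0.
Qed.

Lemma mobR_fixed s : (mobR (Some s) == Some s) = (s ^+ 2 == - i).
Proof.
rewrite mobius_fixed ?detR // mul0r add0r mul1r addr0 eq_sym; congr (_ == _).
Qed.

Lemma mobKR_fixed s : (mobKR (Some s) == Some s) = ((s - (i - 1)) ^+ 2 == - i).
Proof.
rewrite mobius_fixed ?detKR // eq_sym -subr_eq0 -[RHS]subr_eq0; congr (_ == _).
by ring: i2.
Qed.

Lemma mob_None : [/\ mobK None = Some h, mobR None = Some 0 & mobKR None = Some (i - 1)].
Proof. by rewrite /mobK /mobR /mobKR /mobius oner_eq0 !divr1. Qed.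

End OrbitsA.

(** * Stable planes when -1 is not a square *)

Section FamilyB.

Variable p : nat.
Hypotheses (pr_p : prime p) (odd_p : odd p).
Local Notation F := 'F_p.
Local Notation mxI := (mxI p).
Local Notation mxO := (mxO p).
Local Notation mxK := (mxK p).
Local Notation mxR := (mxR p).
Hypothesis aniso : forall x y : F, x ^+ 2 + y ^+ 2 = 0 -> x = 0 /\ y = 0.

Let two0 := two_neq0 pr_p odd_p.

(** Here [rho ^+ 2] has no eigenvector in the 4-dimensional part, so a stable plane is spanned by a
    vector and its image. The vector is normalised to have second and fourth entries -1 and 1;
    stability under omega then becomes the equation of the conic. *)
Definition wv (a b : F) : 'rV[F]_9 := v4 (a + 1) (- 1) b 1.
Definition wi (a b : F) : 'rV[F]_9 := v4 b 1 (- (a + 1)) 1.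
Definition UB (a b : F) : 'M[F]_(2, 9) := rows2 (wv a b) (wi a b).

Arguments wv (a b)%_R.
Arguments wi (a b)%_R.
Arguments UB (a b)%_R.

Lemma wv_I a b : wv a b *m mxI = wi a b.
Proof. by rewrite v4_I; congr v4; ring. Qed.
Lemma wi_I a b : wi a b *m mxI = - wv a b.
Proof. by rewrite v4_I -scaleN1r v4Z; congr v4; ring. Qed.

Lemma sol_sqr (a b : F) : solutionB (a, b) -> b ^+ 2 = - 1 - a ^+ 2.
Proof. by rewrite /solutionB /= => /eqP <-; ring. Qed.

Lemma wv_O (a b : F) : solutionB (a, b) ->
  2%:R *: (wv a b *m mxO) = (b - a - 1) *: wv a b + (1 - b - a) *: wi a b.
Proof. by move=> /sol_sqr e; rewrite v4_O !v4Z v4D; congr v4; ring: e. Qed.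

Lemma wi_O (a b : F) : solutionB (a, b) ->
  2%:R *: (wi a b *m mxO) = (- a - b - 1) *: wv a b + (a - b - 1) *: wi a b.
Proof. by move=> /sol_sqr e; rewrite v4_O !v4Z v4D; congr v4; ring: e. Qed.

Lemma wv_K a b : wv a b *m mxK = - wv a (- b).
Proof. by rewrite v4_K -scaleN1r v4Z; congr v4; ring. Qed.
Lemma wi_K a b : wi a b *m mxK = wi a (- b).
Proof. by rewrite v4_K; congr v4; ring. Qed.

Lemma wv_R (a b a' : F) : solutionB (a, b) -> a * a' = 1 ->
  2%:R *: (wv a b *m mxR) =
  (- a - 1 - b) *: wv a' (- (b * a')) + (b - a - 1) *: wi a' (- (b * a')).
Proof. by move=> /sol_sqr e e'; rewrite v4_R !v4Z v4D; congr v4; ring: e e'. Qed.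

Lemma wi_R (a b a' : F) : solutionB (a, b) -> a * a' = 1 ->
  2%:R *: (wi a b *m mxR) =
  (a + 1 - b) *: wv a' (- (b * a')) + (- a - 1 - b) *: wi a' (- (b * a')).
Proof. by move=> /sol_sqr e e'; rewrite v4_R !v4Z v4D; congr v4; ring: e e'. Qed.

Lemma UB_Hstab (a b : F) : solutionB (a, b) -> Hstab (UB a b).
Proof.
move=> sol; rewrite /Hstab /stab !rows2_mul !rows2_sub wv_I wi_I eqmx_opp.
rewrite sub_rows2_0 sub_rows2_1 /=; apply/andP; split; apply: (subZ_inv two0).
  by rewrite wv_O // addmx_sub // scalemx_sub ?sub_rows2_0 ?sub_rows2_1.
by rewrite wi_O // addmx_sub // scalemx_sub ?sub_rows2_0 ?sub_rows2_1.
Qed.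

Lemma two_eq0 (x : F) : x + x = 0 -> x = 0.
Proof.
by move=> h; apply: (mulfI two0); rewrite mulr0 mulr_natl mulr2n.
Qed.

Lemma UB_free a b : row_free (UB a b).
Proof.
apply: mx2_free (rows2_0 _ _) (rows2_1 _ _) _ => s t; rewrite !v4Z v4D -v4_0.
move=> /v4_inj[_ e2 _ e4]; rewrite !mulr1 in e2 e4.
have t0 : t = 0.
  by apply: two_eq0; rewrite -[RHS](addr0 0) -{1}e2 -e4; ring.
by split=> //; move: e4; rewrite t0 addr0.
Qed.

Lemma UB_sub a b c d : (UB a b <= UB c d)%MS = ((a, b) == (c, d)).
Proof.
apply/idP/eqP => [|[-> ->]]; last exact: submx_refl.
rewrite rows2_sub => /andP[/rows2_comb[s [t]]]; rewrite !v4Z v4D.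
move=> /v4_inj[e1 e2 e3 e4] _.
have t0 : t = 0.
  apply: two_eq0; have -> : t + t = (s * -1 + t * 1) + (s * 1 + t * 1) by ring.
  by rewrite -e2 -e4 addNr.
have s1 : s = 1 by rewrite e4 t0 mul0r addr0 mulr1.
by move: e1 e3; rewrite t0 s1 !mul0r !addr0 !mul1r => /addIr-> ->.
Qed.

Definition famB (U : 'M[F]_(2, 9)) : Prop := exists a b, solutionB (a, b) /\ U = UB a b.

Lemma split_family_B : split_family famB.
Proof.
split=> [U [a [b [sol ->]]] | U v [a [b [sol ->]]] | d W a0 b0 c0 e0 HW v0W v0n nall].
- by split; [exact: UB_free | exact: UB_Hstab].
- case/rows2_comb=> s [t ->]; rewrite !v4Z v4D.
  by do 4!eexists.
have norm_neq0 (x y : F) : (x != 0) || (y != 0) -> x ^+ 2 + y ^+ 2 != 0.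
  by move=> xy; apply: contraTneq xy => /aniso[-> ->]; rewrite eqxx.
(* A nonzero vector (x, 0, y, 0) generates the whole 4-dimensional space. *)
have none x y : (v4 x 0 y 0 <= W)%MS -> x = 0 /\ y = 0.
  move=> vW; apply: aniso; apply/eqP/negPn/negP => N0; apply: nall.
  have v'W : (v4 y 0 (- x) 0 <= W)%MS.
    have -> : v4 y 0 (- x) 0 = v4 x 0 y 0 *m mxI by rewrite v4_I; congr v4; ring.
    exact: HI.
  have e1 : (v4 1 0 0 0 <= W)%MS.
    apply: (subZ_inv N0); have -> : (x ^+ 2 + y ^+ 2) *: v4 1 0 0 0 =
        x *: v4 x 0 y 0 + y *: v4 y 0 (- x) 0 by rewrite !v4Z v4D; congr v4; ring.
    by rewrite addmx_sub // scalemx_sub.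
  have e3 : (v4 0 0 1 0 <= W)%MS.
    apply: (subZ_inv N0); have -> : (x ^+ 2 + y ^+ 2) *: v4 0 0 1 0 =
        y *: v4 x 0 y 0 + (- x) *: v4 y 0 (- x) 0 by rewrite !v4Z v4D; congr v4; ring.
    by rewrite addmx_sub // scalemx_sub.
  have e4 : (v4 0 0 0 1 <= W)%MS.
    have -> : v4 0 0 0 1 = (- 1) *: (v4 1 0 0 0 *m mxO) + (- 1) *: v4 1 0 0 0.
      by rewrite v4_O !v4Z v4D; congr v4; ring.
    by rewrite addmx_sub // scalemx_sub // HO.
  have e2 : (v4 0 1 0 0 <= W)%MS.
    have -> : v4 0 1 0 0 = v4 0 0 0 1 *m mxI by rewrite v4_I; congr v4; ring.
    exact: HI.
  move=> a b c e; have -> : v4 a b c e = a *: v4 1 0 0 0 + b *: v4 0 1 0 0 +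
      (c *: v4 0 0 1 0 + e *: v4 0 0 0 1).
    by rewrite !v4Z !v4D; congr v4; ring.
  by rewrite !addmx_sub // scalemx_sub.
have [a [b [c [e [vW be0]]]]] : exists a b c e,
    (v4 a b c e <= W)%MS /\ ((b != 0) || (e != 0)).
  case: (boolP ((b0 != 0) || (e0 != 0))) => h; first by exists a0, b0, c0, e0.
  move: h v0W v0n; rewrite negb_or !negbK => /andP[/eqP-> /eqP->] v0W.
  have [-> ->] := none _ _ v0W; by rewrite v4_0 eqxx.
have N0 := norm_neq0 _ _ be0; set N := b ^+ 2 + e ^+ 2 in N0.
have [al [bt wW]] : exists al bt, (wv al bt <= W)%MS.
  (* Multiplying [v4 a b c e] by [e - b] and subtracting [b + e] times its image under [rho ^+ 2]
     gives second and fourth entries [- N] and [N]; dividing by [N] reaches the normal form of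
     [wv]. *)
  exists (((e - b) * a - (b + e) * c) / N - 1), (((e - b) * c + (b + e) * a) / N).
  apply: (subZ_inv N0).
  have -> : N *: wv (((e - b) * a - (b + e) * c) / N - 1) (((e - b) * c + (b + e) * a) / N) =
      (e - b) *: v4 a b c e + (- (b + e)) *: (v4 a b c e *m mxI).
    rewrite v4_I !v4Z v4D subrK ![N * (_ / N)]mulrC !divfK // /N; congr v4; ring.
  by rewrite addmx_sub // scalemx_sub // HI.
have wiW : (wi al bt <= W)%MS by rewrite -wv_I HI.
(* Twice the omega-image of [wv], minus the combination it equals on the conic, has zero second and
   fourth entries; [none] forces the remaining entry to vanish. *)
have sol : solutionB (al, bt).
  have : (v4 (al ^+ 2 + bt ^+ 2 + 1) 0 (- (al ^+ 2 + bt ^+ 2 + 1)) 0 <= W)%MS.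
    have -> : v4 (al ^+ 2 + bt ^+ 2 + 1) 0 (- (al ^+ 2 + bt ^+ 2 + 1)) 0 =
        2%:R *: (wv al bt *m mxO) + (- (bt - al - 1)) *: wv al bt + (- (1 - bt - al)) *: wi al bt.
      by rewrite v4_O !v4Z !v4D; congr v4; ring.
    by rewrite !addmx_sub // scalemx_sub // HO.
  by case/none=> h _; rewrite /solutionB /= -subr_eq0 opprK h.
exists (UB al bt); split; first by exists al, bt.
  by rewrite rows2_sub wW.
move=> x y z t v'W.
(* Multiples of [wv] and [wi] clear the second and fourth entries of twice the given row, so [none]
   applies once more. *)
have : (v4 (2%:R * x + (y - t) * (al + 1) - (y + t) * bt) 0
           (2%:R * z + (y - t) * bt + (y + t) * (al + 1)) 0 <= W)%MS.
  have -> : v4 (2%:R * x + (y - t) * (al + 1) - (y + t) * bt) 0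
      (2%:R * z + (y - t) * bt + (y + t) * (al + 1)) 0 =
      2%:R *: v4 x y z t + (y - t) *: wv al bt + (- (y + t)) *: wi al bt.
    by rewrite !v4Z !v4D; congr v4; ring.
  by rewrite !addmx_sub // scalemx_sub.
case/none=> h1 h2; apply: (subZ_inv two0).
have -> : 2%:R *: v4 x y z t = (t - y) *: wv al bt + (y + t) *: wi al bt.
  rewrite !v4Z !v4D; congr v4; [| by ring | | by ring].
    by rewrite -[LHS]subr0 -h1; ring.
  by rewrite -[LHS]subr0 -h2; ring.
by rewrite addmx_sub // scalemx_sub ?sub_rows2_0 ?sub_rows2_1.
Qed.

Lemma sol_neq0 (a b : F) : solutionB (a, b) -> a != 0.
Proof.
move=> /eqP /= sol; apply: contraTneq (oner_neq0 F) => a0; rewrite negbK.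
have [_ -> //] : b = 0 /\ 1 = 0 :> F.
by apply: aniso; move: sol; rewrite a0 expr0n add0r expr1n => ->; rewrite addNr.
Qed.

Lemma sol_neq0r (a b : F) : solutionB (a, b) -> b != 0.
Proof.
move=> /eqP /= sol; apply: contraTneq (oner_neq0 F) => b0; rewrite negbK.
have [_ -> //] : a = 0 /\ 1 = 0 :> F.
by apply: aniso; move: sol; rewrite b0 expr0n addr0 expr1n => ->; rewrite addNr.
Qed.

Definition solK (u : F * F) : F * F := (u.1, - u.2).
Definition solR (u : F * F) : F * F := (1 / u.1, - (u.2 / u.1)).
Definition solKR (u : F * F) : F * F := (1 / u.1, u.2 / u.1).

Lemma solK_sol (u : F * F) : solutionB u -> solutionB (solK u).
Proof. by rewrite /solutionB /= sqrrN. Qed.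

Lemma solR_sol (u : F * F) : solutionB u -> solutionB (solR u).
Proof.
case: u => a b sol; have a0 := sol_neq0 sol; have e := sol_sqr sol.
rewrite /solutionB /= sqrrN !exprMn exprVn -mulrDl expr1n e.
rewrite (_ : 1 + (- 1 - a ^+ 2) = - a ^+ 2); last by ring.
by rewrite mulNr divff // expf_neq0.
Qed.

Lemma solKK u : solK (solK u) = u. Proof. by case: u => a b; rewrite /solK /= opprK. Qed.
Lemma solRR (u : F * F) : solutionB u -> solR (solR u) = u.
Proof.
case: u => a b /sol_neq0 a0; rewrite /solR /=.
by congr (_, _); field; rewrite a0 ?oner_neq0.
Qed.
Lemma solR_K u : solR (solK u) = solKR u.
Proof. by rewrite /solR /solKR /= mulNr opprK. Qed.
Lemma solK_R u : solK (solR u) = solKR u.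
Proof. by rewrite /solK /solKR /= opprK. Qed.
Lemma orbitBE u : orbitB u = [set u; solR u; solK u; solKR u].
Proof. by case: u. Qed.

Definition UBo (u : F * F) : 'M[F]_(2, 9) := UB u.1 u.2.

Lemma UBo_sub u u' : (UBo u <= UBo u')%MS = (u == u').
Proof. by case: u u' => a b [c d]; rewrite UB_sub. Qed.

Lemma UBo_K u d (W : 'M[F]_(d, 9)) : (UBo u *m mxK <= W)%MS = (UBo (solK u) <= W)%MS.
Proof. by rewrite rows2_mul wv_K wi_K !rows2_sub eqmx_opp. Qed.

(** The formulas for [wv] and [wi] give one inclusion of planes; equality follows since rho acts
    invertibly. *)
Lemma UBo_R u d (W : 'M[F]_(d, 9)) : solutionB u ->
  (UBo u *m mxR <= W)%MS = (UBo (solR u) <= W)%MS.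
Proof.
case: u => a b sol; have a0 := sol_neq0 sol.
have aa : a * (1 / a) = 1 by rewrite mul1r divff.
have sub : (UBo (a, b) *m mxR <= UBo (solR (a, b)))%MS.
  rewrite rows2_mul rows2_sub; apply/andP; split; apply: (subZ_inv two0).
    rewrite (wv_R sol aa) addmx_sub // scalemx_sub // /UBo /solR /= div1r.
      exact: sub_rows2_0.
    exact: sub_rows2_1.
  rewrite (wi_R sol aa) addmx_sub // scalemx_sub // /UBo /solR /= div1r.
    exact: sub_rows2_0.
  exact: sub_rows2_1.
have /eqmxP e : (UBo (a, b) *m mxR == UBo (solR (a, b)))%MS.
  rewrite -(geq_leqif (mxrank_leqif_eq sub)) mxrankMfree; last first.
    by rewrite row_free_unit; exact/act_mx_unit/Aut_rho.
  by rewrite (eqP (UB_free _ _)) (eqP (UB_free _ _)).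
by rewrite e.
Qed.

Lemma solK_fixed (u : F * F) : solutionB u -> solK u != u.
Proof.
case: u => a b sol; apply: contraNneq (sol_neq0r sol) => -[h].
by apply/eqP/two_eq0; rewrite -{1}h; exact: addNr.
Qed.

Lemma solR_fixed (u : F * F) : solutionB u -> (solR u == u) = (u.1 == -1).
Proof.
case: u => a b sol; have a0 := sol_neq0 sol; have b0 := sol_neq0r sol.
rewrite /solR /=; apply/eqP/eqP => [[_ h] | ->].
  apply: (mulfI b0); have := congr1 (fun x => x * a) h.
  by rewrite mulNr divfK // => <-; rewrite mulrN1.
by rewrite div1r invrN1 mulrN1 opprK.
Qed.

Lemma solKR_fixed (u : F * F) : solutionB u -> (solKR u == u) = (u.1 == 1).
Proof.
case: u => a b sol; have a0 := sol_neq0 sol; have b0 := sol_neq0r sol.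
rewrite /solKR /=; apply/eqP/eqP => [[_ h] | ->].
  by apply: (mulfI b0); rewrite -{1}h divfK // mulr1.
by rewrite !divr1.
Qed.

End FamilyB.

(** * Klein four-groups and congruences *)

Section KleinAction.

Variables (T : finType) (f g : T -> T).
Hypotheses (ffK : involutive f) (ggK : involutive g) (fgC : forall z, f (g z) = g (f z)).

Definition klein_act (z : T) (a : 'Z_2 * 'Z_2) : T :=
  (if a.1 == 0 then id else f) ((if a.2 == 0 then id else g) z).

Lemma klein_act1 z : klein_act z 1%g = z.
Proof. by []. Qed.

Lemma Z2_cases (x : 'Z_2) : x = 0 \/ x = 1.
Proof. by case: x => [[|[|x]]] h //; [left | right]; apply: val_inj. Qed.

Lemma klein_actM z : act_morph klein_act z.
Proof.
move=> [a b] [c d]; rewrite /klein_act /=.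
by case: (Z2_cases a) => ->; case: (Z2_cases b) => ->; case: (Z2_cases c) => ->;
  case: (Z2_cases d) => -> /=; rewrite ?ffK ?ggK ?fgC ?ffK ?ggK.
Qed.

Definition klein_action := TotalAction klein_act1 klein_actM.

Lemma klein_orbitE z : orbit klein_action setT z = [set z; f z; g z; f (g z)].
Proof.
apply/setP => w; rewrite !inE; apply/orbitP/idP => [[[a b] _ <-] | ].
  rewrite /= /klein_act /=.
  by case: (Z2_cases a) => ->; case: (Z2_cases b) => -> /=; rewrite eqxx ?orbT.
rewrite -!orbA => /or4P[]/eqP->.
- by exists (0, 0).
- by exists (1, 0).
- by exists (0, 1).
- by exists (1, 1).
Qed.

Lemma klein_orbit_card z : f z != z -> g z != z -> f (g z) != z ->
  #|[set z; f z; g z; f (g z)]| = 4.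
Proof.
move=> fz gz fgz; have uniq4 : uniq [:: z; f z; g z; f (g z)].
  rewrite /= !inE !negb_or ![z == _]eq_sym fz gz fgz /= andbT.
  rewrite (inj_eq (inv_inj ffK)) [z == _]eq_sym gz andbT; apply/andP; split.
    by rewrite -(inj_eq (inv_inj ffK)) ffK eq_sym.
  by rewrite fgC -(inj_eq (inv_inj ggK)) !ggK eq_sym.
rewrite -[RHS]/(size [:: z; f z; g z; f (g z)]) -(card_uniqP uniq4).
by apply: eq_card => w; rewrite !inE -!orbA.
Qed.

Lemma klein_count (S : {set T}) :
  (forall z, z \in S -> f z \in S /\ g z \in S) ->
  (forall z, z \in S -> [/\ f z != z, g z != z & f (g z) != z]) ->
  #|S| = (#|[set orbit klein_action setT z | z in S]| * 4)%N.
Proof.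
move=> inS freeS; apply: card_uniform_partition => [O /imsetP[z zS ->] | ].
  by have [h1 h2 h3] := freeS z zS; rewrite klein_orbitE klein_orbit_card.
apply: orbit_partition; apply/actsP => a _ z; rewrite /= /klein_act.
have fS w : (f w \in S) = (w \in S).
  by apply/idP/idP => [/inS[] | /inS[]//]; rewrite ffK.
have gS w : (g w \in S) = (w \in S).
  by apply/idP/idP => [/inS[_] | /inS[]//]; rewrite ggK.
by case: ifP => _; case: ifP => _; rewrite /= ?fS ?gS.
Qed.

End KleinAction.

(** * Congruences forced by square roots *)

Section NumberTheory.

Variable p : nat.
Hypotheses (pr_p : prime p) (odd_p : odd p).
Local Notation F := 'F_p.

Let two0 := two_neq0 pr_p odd_p.

Lemma Fermat (x : F) : x != 0 -> x ^+ p.-1 = 1.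
Proof.
move=> x0; apply: (mulfI x0); rewrite mulr1 -exprS prednK ?prime_gt0 //.
by rewrite -{2}(expf_card x) card_Fp.
Qed.

Lemma one_neq_opp1 : (1 == -1 :> F) = false.
Proof.
apply/negP => /eqP h; move: two0; rewrite -[2%:R]/(1 + 1) {1}h addNr eqxx //.
Qed.

Lemma mod4_cases : p = 1 %[mod 4] \/ p = 3 %[mod 4].
Proof. by move: odd_p; lia. Qed.

(** If [p = 3] modulo 4, then [(p - 1) / 2] is odd, and raising [x ^+ 2 = -1] to this power
    contradicts Fermat. The lemma on fourth powers is the same argument modulo 8. *)
Lemma sqr_opp1_mod4 (x : F) : x ^+ 2 = -1 -> p = 1 %[mod 4].
Proof.
move=> x2; case: mod4_cases => // p3; have := one_neq_opp1.
have x0 : x != 0.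
  by apply: contra_eq_neq x2 => ->; rewrite expr0n eq_sym oppr_eq0 oner_neq0.
rewrite -{1}(Fermat x0) (_ : p.-1 = (2 * (p %/ 4).*2.+1)%N); last by lia.
by rewrite exprM x2 exprS -mul2n exprM sqrrN !expr1n mulr1 eqxx.
Qed.

Lemma aniso_mod4 : p = 3 %[mod 4] -> forall x y : F, x ^+ 2 + y ^+ 2 = 0 -> x = 0 /\ y = 0.
Proof.
move=> p3 x y xy; have [y0 | y0] := eqVneq y 0.
  by move: xy; rewrite y0 expr0n addr0 => /eqP; rewrite expf_eq0 => /eqP.
have := @sqr_opp1_mod4 (x / y); rewrite p3 => h; exfalso.
suff : 3 = 1 %[mod 4] by [].
apply: h; rewrite expr_div_n; apply: (mulIf (expf_neq0 2 y0)).
by rewrite divfK ?expf_neq0 // mulN1r; apply/eqP; rewrite -addr_eq0 xy.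
Qed.

Lemma pow4_opp1_mod8 (x : F) : x ^+ 4 = -1 -> p = 1 %[mod 8].
Proof.
move=> x4; have p1 : p = 1 %[mod 4].
  by apply: (@sqr_opp1_mod4 (x ^+ 2)); rewrite -exprM.
have [// | p5] : p = 1 %[mod 8] \/ p = 5 %[mod 8] by move: p1; lia.
have := one_neq_opp1.
have x0 : x != 0.
  by apply: contra_eq_neq x4 => ->; rewrite expr0n eq_sym oppr_eq0 oner_neq0.
rewrite -{1}(Fermat x0) (_ : p.-1 = (4 * (p %/ 8).*2.+1)%N); last by lia.
by rewrite exprM x4 exprS -mul2n exprM sqrrN !expr1n mulr1 eqxx.
Qed.

(** The element [l = (t - 1) / 2] satisfies [l ^+ 2 + l + 1 = 0], so its cube is 1. If [p = 2]
    modulo 3, Fermat gives [l = 1] and hence [3 = 0], which [t != 0] excludes. *)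
Lemma sqr_opp3_mod3 (t : F) : t ^+ 2 = - 3%:R -> t != 0 -> p = 1 %[mod 3].
Proof.
move=> t2 t0; pose l : F := (t - 1) / 2%:R.
have tE : t = 2%:R * l + 1 by rewrite mulrC divfK // subrK.
have l2 : l ^+ 2 + l + 1 = 0.
  apply: (mulfI (four_neq0 pr_p odd_p)).
  have -> : 4%:R * (l ^+ 2 + l + 1) = (2%:R * l + 1) ^+ 2 + 3%:R by ring.
  by rewrite -tE t2 addNr mulr0.
have l3 : l ^+ 3 = 1.
  have -> : l ^+ 3 = (l - 1) * (l ^+ 2 + l + 1) + 1 by ring.
  by rewrite l2 mulr0 add0r.
have three0 : (3%:R : F) != 0.
  by apply: contraNneq t0 => h; have := expf_eq0 t 2; rewrite t2 h oppr0 eqxx /= => /esym.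
have p3 : p <> 3%N by move=> e; move: three0; rewrite Fp_natr_eq0 // e.
have l0 : l != 0.
  by apply: contra_eq_neq l3 => ->; rewrite expr0n eq_sym oner_neq0.
have nd : ~~ (3 %| p)%N.
  by rewrite (dvdn_prime2 (isT : prime 3) pr_p); apply/eqP => e; apply: p3.
have [// | p2] : p = 1 %[mod 3] \/ p = 2 %[mod 3] by move: nd; lia.
have := Fermat l0; rewrite (_ : p.-1 = (3 * (p %/ 3) + 1)%N); last by lia.
rewrite exprD exprM l3 expr1n mul1r expr1 => l1.
by move: l2; rewrite l1 expr1n => h; case/negP: three0; apply/eqP; rewrite -h; ring.
Qed.

(** Suppose [p = 7] modulo 8 and write [p + 1 = 8 m]. The matrix [J] replaces the missing square
    root of -1. Frobenius gives [(1 + J) ^+ p = 1 - J], so [(1 + J) ^+ (8 m) = 2], while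
    [(1 + J) ^+ 8 = 16]; thus [16 ^+ m = 2]. But [x ^+ 8 = 16] and [x ^+ (8 m) = x ^+ 2 = - 2], a
    contradiction. *)
Lemma sqr_opp2_mod8 (x : F) : p = 3 %[mod 4] -> x ^+ 2 = - 2%:R -> p = 3 %[mod 8].
Proof.
move=> p3 x2; have [// | p7] : p = 3 %[mod 8] \/ p = 7 %[mod 8] by move: p3; lia.
pose J : 'M[F]_2 := \matrix_(i, j) (if (i == 0) && (j == 1) then 1 else
                                    if (i == 1) && (j == 0) then -1 else 0).
have J2 : J ^+ 2 = - 1.
  apply/matrixP => i j; rewrite expr2 -mulmxE !mxE !big_ord_recl big_ord0 !mxE /=.
  by case: i => [[|[|i]]] hi //; case: j => [[|[|j]]] hj //=;
    rewrite ?(mulr0, mul0r, mulr1, mul1r, addr0, add0r, mulN1r, oppr0, mulr1n, mulr0n).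
have J4 : J ^+ 4 = 1 by rewrite (exprM J 2 2) J2 sqrrN expr1n.
have chM : p \in [pchar 'M[F]_2].
  by rewrite pchar_lalg; exact: pchar_Fp.
have Jp : J ^+ p = - J.
  have -> : J ^+ p = J ^+ (4 * (p %/ 4) + 3)%N by congr (_ ^+ _); move: p3; lia.
  by rewrite exprD exprM J4 expr1n mul1r exprSr J2 mulN1r.
have frob : (1 + J) ^+ p = 1 - J.
  have := pFrobenius_autD_comm chM (commr1 J : GRing.comm J 1).
  by rewrite !pFrobenius_autE expr1n Jp => h; rewrite addrC h addrC.
have e1 : (1 + J) ^+ p.+1 = 2%:R.
  by rewrite exprSr frob mulrDr mulr1 mulrBl mul1r -expr2 J2 opprK addrA subrK.
have sq : (1 + J) ^+ 2 = 2%:R * J.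
  by rewrite expr2 mulrDr mulr1 mulrDl mul1r -expr2 J2 [J - 1]addrC addrACA subrr add0r mulr_natl mulr2n.
have e2 : (1 + J) ^+ 8 = 16%:R.
  rewrite (exprM _ 2 4) sq exprMn_comm ?J4 ?mulr1; last exact: commr_sym (commr_nat _ _).
  by rewrite -natrX.
set m := (p.+1 %/ 8)%N; have pm : p.+1 = (8 * m)%N by rewrite /m; lia.
have /(congr1 (fun M : 'M[F]_2 => M 0 0)) : (16 ^ m)%:R = 2%:R :> 'M[F]_2.
  by rewrite natrX -e2 -exprM -pm e1.
rewrite !mulmxnE !mxE eqxx /= => e.
have x0 : x != 0.
  by apply: contraNneq two0 => h; rewrite -oppr_eq0 -x2 h expr0n.
have e' : (16 ^ m)%:R = - 2%:R :> F.
  have x8 : x ^+ 8 = 16%:R by rewrite (exprM x 2 4) x2 exprNn -signr_odd mul1r -natrX.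
  rewrite natrX -x8 -exprM -pm (_ : p.+1 = p.-1 + 2)%N; last by move: (prime_gt0 pr_p); lia.
  by rewrite exprD Fermat // mul1r.
have := four_neq0 pr_p odd_p; have -> : 4%:R = 2%:R - - 2%:R :> F by ring.
by rewrite -[X in X - _]e -e' subrr eqxx.
Qed.

End NumberTheory.

(** * Counting the points of the conic *)

Section SolutionCount.

Variable p : nat.
Hypotheses (pr_p : prime p) (odd_p : odd p) (p3 : p = 3 %[mod 4]).
Local Notation F := 'F_p.

Let aniso := aniso_mod4 pr_p odd_p p3.

(** The witness is [u] to the power [(p + 1) / 4], whose square is [u] times the sign
    [u ^+ ((p - 1) / 2)]. *)
Lemma sqr_or_opp (u : F) : exists b : F, (b ^+ 2 == u) || (b ^+ 2 == - u).
Proof.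
have [->|u0] := eqVneq u 0; first by exists 0; rewrite expr0n eqxx.
exists (u ^+ (p %/ 4).+1).
have e : (u ^+ (p %/ 2)) ^+ 2 = 1.
  by rewrite -exprM -(Fermat pr_p u0); congr (_ ^+ _); move: p3; lia.
have -> : (u ^+ (p %/ 4).+1) ^+ 2 = u * u ^+ (p %/ 2).
  by rewrite -exprM -exprS; congr (_ ^+ _); move: p3; lia.
by have /orP[/eqP->|/eqP->] : (u ^+ (p %/ 2) == 1) || (u ^+ (p %/ 2) == -1);
  rewrite ?mulr1 ?mulrN1 ?eqxx ?orbT // -sqrf_eq1 e.
Qed.

(** If the conic had no point, the successor of a square would be a square, since otherwise its
    opposite is one. All residues would then be squares, among them [p - 1 = -1]. *)
Lemma solutionB_exists : exists u : F * F, solutionB u.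
Proof.
have [/existsP // | no] := boolP [exists u : F * F, solutionB u].
suff sq n : exists b : F, b ^+ 2 = n%:R.
  have [b b2] := sq p.-1; suff : p = 1 %[mod 4] by rewrite p3.
  apply: (@sqr_opp1_mod4 p pr_p odd_p b); apply/eqP; rewrite -addr_eq0 b2.
  by rewrite -(natrD _ p.-1 1) addn1 prednK ?prime_gt0 // Fp_natr_eq0 // dvdnn.
elim: n => [|n [b b2]]; first by exists 0; rewrite expr0n.
have [c /orP[/eqP|/eqP] c2] := sqr_or_opp n.+1%:R; first by exists c.
case/existsP: no; exists (b, c); rewrite /solutionB /= b2 c2 -natr1; apply/eqP; ring.
Qed.

Variable u0 : F * F.
Hypothesis u0P : solutionB u0.

(* Second intersection of the conic a^2 + b^2 = -1 with the line of direction
   [pt z] through the base point [u0]; tangents return [u0]. *)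
Definition conic_point (z : option F) : F * F :=
  let: (x, y) := pt z in
  let t := - 2%:R * (u0.1 * x + u0.2 * y) / (x ^+ 2 + y ^+ 2) in
  (u0.1 + t * x, u0.2 + t * y).

Let a0_neq0 : u0.1 != 0. Proof. by case: u0 u0P => a b; apply: sol_neq0. Qed.
Let b0_neq0 : u0.2 != 0. Proof. by case: u0 u0P => a b; apply: sol_neq0r. Qed.

Lemma pt_norm (z : option F) : (pt z).1 ^+ 2 + (pt z).2 ^+ 2 != 0.
Proof.
by apply/eqP => /aniso[e1 e2]; have := pt_neq0 z; rewrite e1 e2 eqxx.
Qed.

Lemma conic_point_sol z : solutionB (conic_point z).
Proof.
have := pt_norm z; rewrite /conic_point; case: (pt z) => x y /= n0.
rewrite /solutionB /=; set t := _ / _; set w := u0.1 * x + u0.2 * y.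
have tn : t * (x ^+ 2 + y ^+ 2) = - 2%:R * w by rewrite divfK.
have -> : (u0.1 + t * x) ^+ 2 + (u0.2 + t * y) ^+ 2 =
  u0.1 ^+ 2 + u0.2 ^+ 2 + t * (2%:R * w + t * (x ^+ 2 + y ^+ 2)) by rewrite /w; ring.
by rewrite tn mulNr subrr mulr0 addr0.
Qed.

Lemma conic_point_inj : injective conic_point.
Proof.
move=> z z'; rewrite /conic_point.
have := pt_norm z; have := pt_neq0 z; have := pt_norm z'; have := pt_neq0 z'.
move=> nz' n' nz n; apply: contra_eq => zz'; move: zz' nz' n' nz n.
rewrite -pt_ratio /same_ratio; case: (pt z) => x y; case: (pt z') => x' y' /=.
set t := _ / (x ^+ 2 + y ^+ 2); set t' := _ / (x' ^+ 2 + y' ^+ 2).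
move=> ne nz' n' nz n; apply: contraNneq ne => /eqP.
rewrite xpair_eqE !(inj_eq (addrI _)) => /andP[/eqP e1 /eqP e2].
(* For [t != 0] the displacement determines the direction. If both parameters vanish, both
   directions are tangent at [u0], and the tangent is unique. *)
have [t0 | t0] := eqVneq t 0; last first.
  rewrite -subr_eq0; apply/eqP/(mulfI t0); rewrite mulr0.
  by rewrite mulrBr mulrA e1 [x' * y]mulrC mulrA e2; ring.
have t'0 : t' = 0.
  apply/eqP; apply: contraLR nz' => t'0; move: e1 e2; rewrite t0 !mul0r.
  move=> /esym/eqP + /esym/eqP; rewrite (mulf_eq0 t' x') (mulf_eq0 t' y') (negPf t'0) /=.
  by move=> -> ->.
have two0 := two_neq0 pr_p odd_p.
have zero (w c : F) : - 2%:R * w / c = 0 -> c != 0 -> w = 0.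
  move=> /eqP; rewrite !mulf_eq0 invr_eq0 oppr_eq0 (negPf two0) /=.
  by case/orP => [/eqP // | /eqP->]; rewrite eqxx.
have h1 := zero _ _ t0 n; have h2 := zero _ _ t'0 n'.
rewrite -subr_eq0; apply/eqP/(mulfI b0_neq0); rewrite mulr0.
have -> : u0.2 * (x * y' - x' * y) = x * (u0.1 * x' + u0.2 * y') - x' * (u0.1 * x + u0.2 * y) by ring.
by rewrite h1 h2 !mulr0 subrr.
Qed.

Lemma conic_point_surj u : solutionB u -> exists z, conic_point z = u.
Proof.
move=> /eqP; case: u => a b /= s; move/eqP: u0P => s0.
have [-> | ne] := eqVneq (a, b) u0.
  (* The tangent direction at [u0], for which the second intersection is [u0] again. *)
  exists (Some (- u0.2 / u0.1)); rewrite /conic_point /=.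
  rewrite (_ : _ * (- _ / _) + _ = 0) ?mulr0 ?mul0r ?addr0; first by case: u0.
  by rewrite mulrCA divff // mulr1 mulr1 addNr.
have [e | nb] := eqVneq b u0.2.
  have dx : a - u0.1 != 0 by rewrite subr_eq0; apply: contraNneq ne => ->; rewrite e; case: u0.
  exists None; rewrite /conic_point /=.
  have ae : a = - u0.1.
    apply/eqP; rewrite -addr_eq0; apply/eqP/(mulfI dx); rewrite mulr0.
    have -> : (a - u0.1) * (a + u0.1) = (a ^+ 2 + b ^+ 2) - (u0.1 ^+ 2 + b ^+ 2) by ring.
    by rewrite s e s0 subrr.
  rewrite expr1n expr0n addr0 divr1 !mulr1 mulr0 addr0 mulr0 addr0 -e ae; congr pair; ring.
have dy : b - u0.2 != 0 by rewrite subr_eq0.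
exists (Some ((a - u0.1) / (b - u0.2))); rewrite /conic_point /=.
have e : - 2%:R * (u0.1 * (a - u0.1) + u0.2 * (b - u0.2)) = (a - u0.1) ^+ 2 + (b - u0.2) ^+ 2.
  apply/eqP; rewrite -subr_eq0 (_ : _ - _ = u0.1 ^+ 2 + u0.2 ^+ 2 - (a ^+ 2 + b ^+ 2)); last by ring.
  by rewrite s s0 subrr.
set q := _ / (b - u0.2); have qE : q * (b - u0.2) = a - u0.1 by rewrite divfK.
have tE : - 2%:R * (u0.1 * q + u0.2 * 1) / (q ^+ 2 + 1 ^+ 2) = b - u0.2.
  apply: (canLR (mulfK _)).
    by apply/eqP => /aniso[_ /eqP]; rewrite oner_eq0.
  apply: (mulIf dy); move: e; rewrite -qE => e.
  transitivity (- 2%:R * (u0.1 * (q * (b - u0.2)) + u0.2 * (b - u0.2))); first by ring.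
  by rewrite e; ring.
by rewrite tE mulr1 mulrC qE ![_.1 + _]addrC ![_.2 + _]addrC !subrK.
Qed.

Lemma card_solutionB : #|[set u : F * F | solutionB u]| = p.+1.
Proof.
have -> : [set u : F * F | solutionB u] = [set conic_point z | z in [set: option F]].
  apply/setP => u; rewrite inE; apply/idP/imsetP => [/conic_point_surj[z <-] | [z _ ->]].
    by exists z.
  exact: conic_point_sol.
by rewrite card_imset ?cardsT ?card_option ?card_Fp //; exact: conic_point_inj.
Qed.

End SolutionCount.

(** * Classification *)

Section ListedProjections.

Variable p : nat.
Local Notation F := 'F_p.

Lemma covmx_of_values d (l : seq 'cV[F]_d) (Z : 'M[F]_(d, 9)) : size l = 9%N ->
  (forall j k, Z j k = l`_k j 0) -> derived_projection (tree_voltage l) = covmx Z.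
Proof.
move=> sl ZE; have -> : Z = \matrix_(j, k) l`_k j 0 by apply/matrixP => j k; rewrite mxE ZE.
by rewrite /covmx /mx_volt cols_mx.
Qed.

Ltac entries :=
  move=> [[|[|[|j]]] hj] // [[|[|[|[|[|[|[|[|[|k]]]]]]]]] hk] //;
  rewrite !mxE /= ?mxE /= ?mxE /= ?mxE /=.

Ltac chi_entries :=
  move=> [[|[|[|[|[|[|[|[|[|k]]]]]]]]] hk] //; rewrite !mxE /= ?mxE /= ?mxE /= ?mxE /=.

Lemma projA_UA (i s : F) : projA i s = covmx (UA i s 1).
Proof. apply: covmx_of_values => //; entries; ring. Qed.

Lemma projB_UB (a b : F) : projB (a, b) = covmx (UB a b).
Proof. apply: covmx_of_values => //; entries; ring. Qed.

Lemma chi_mx_values (l : seq 'cV[F]_(1 + 2)) (theta : F) (U : 'M[F]_(2, 9)) : size l = 9%N ->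
  (forall k, chi theta 0 k = l`_k 0 0) -> (forall (j : 'I_2) k, U j k = l`_k (rshift 1 j) 0) ->
  derived_projection (tree_voltage l) = covmx (chi_mx theta U).
Proof.
move=> sl chiE UE; apply: (@covmx_of_values (1 + 2)) => // j k.
have [j' -> | j' ->] := @split_ordP 1 2 j.
  by rewrite /chi_mx col_mxEu (ord1 j') chiE; congr (fun_of_matrix _ _ _); apply: val_inj.
by rewrite /chi_mx col_mxEd UE.
Qed.

Lemma projC_chi (i nu theta : F) : projC i nu theta = covmx (chi_mx theta (UA i nu 1)).
Proof. apply: chi_mx_values => //; [chi_entries | entries]; ring. Qed.

Lemma projD_chi (theta delta : F) : projD theta delta = covmx (chi_mx theta (UB (-1) delta)).
Proof. apply: chi_mx_values => //; [chi_entries | entries]; ring. Qed.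

End ListedProjections.

(* The two-dimensional H-invariant subspaces on which the central involution
   rho^4 acts as -1, parametrized by T; kappa and rho permute them as K and R. *)
Record klein_family p (T : finType) (U : T -> 'M['F_p]_(2, 9)) (K R : T -> T) : Prop :=
  KleinFamily {
    family_KK : involutive K;
    family_RR : involutive R;
    family_RK : forall z, R (K z) = K (R z);
    family_split : split_family (fun V => exists z, V = U z);
    family_sub : forall z z', (U z <= U z')%MS = (z == z');
    family_K : forall z d (W : 'M['F_p]_(d, 9)), (U z *m mxK p <= W)%MS = (U (K z) <= W)%MS;
    family_R : forall z d (W : 'M['F_p]_(d, 9)), (U z *m mxR p <= W)%MS = (U (R z) <= W)%MS }.

(** * Covers attached to a Klein family *)

Section KleinFamily.

Variable p : nat.
Hypotheses (pr_p : prime p) (odd_p : odd p).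
Local Notation F := 'F_p.
Local Notation mxK := (mxK p).
Local Notation mxR := (mxR p).

Variables (T : finType) (U : T -> 'M[F]_(2, 9)) (K R : T -> T).
Hypothesis kf : klein_family U K R.
Let KK := family_KK kf.
Let RR := family_RR kf.
Let RKC := family_RK kf.
Let sf := family_split kf.
Let U_sub := family_sub kf.
Let U_K := family_K kf.
Let U_R := family_R kf.

Let famU z : exists z', U z = U z' := ex_intro _ z erefl.

Lemma KRKR z : R (K (R (K z))) = z.
Proof. by rewrite -RKC KK RR. Qed.

Lemma U_KR z d (W : 'M[F]_(d, 9)) : (U z *m (mxK *m mxR) <= W)%MS = (U (R (K z)) <= W)%MS.
Proof.
have sub : (U z *m mxK <= U (K z))%MS by rewrite U_K.
have /eqmxP e : (U z *m mxK == U (K z))%MS.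
  rewrite -(geq_leqif (mxrank_leqif_eq sub)) mxrankMfree; last first.
    by rewrite row_free_unit; exact/act_mx_unit/Aut_kappa.
  by rewrite (eqP (fam_free sf (famU _))) (eqP (fam_free sf (famU _))).
by rewrite -U_R mulmxA; apply/idP/idP; apply: submx_trans; rewrite submxMr // e.
Qed.

Definition klein_orbit z : {set T} := [set z; R z; K z; R (K z)].

Lemma mem_klein_orbit z : z \in klein_orbit z.
Proof. by rewrite !in_setU !in_set1 eqxx. Qed.

(** [iso_coset] leaves four automorphisms to consider. They move parameters by 1, [K], [R] and
    [R \o K], and inclusion of planes is equality of parameters. *)
Lemma iso_U z z' :
  isomorphic_projections (covmx (U z)) (covmx (U z')) <-> z' \in klein_orbit z.
Proof.
have freeU y := fam_free sf (famU y).
rewrite !inE; split=> [/(iso_coset (freeU z) (fam_Hstab sf (famU z)))[_ [C]] | ].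
  rewrite !inE => /or4P[]/eqP->; rewrite ?mulmx1 ?U_K ?U_R ?U_KR U_sub => /eqP <-;
    by rewrite ?KK ?RR ?KRKR eqxx ?orbT.
have inC C : C \in coset_mx p -> (U z' *m C <= U z)%MS ->
    isomorphic_projections (covmx (U z)) (covmx (U z')).
  by move=> CC; apply: coset_iso CC (freeU z').
rewrite -!orbA => /or4P[]/eqP zE.
- by apply: (inC 1%:M); rewrite ?inE ?eqxx // mulmx1 zE.
- by apply: (inC mxR); rewrite ?inE ?eqxx ?orbT // U_R zE RR.
- by apply: (inC mxK); rewrite ?inE ?eqxx ?orbT // U_K zE KK.
- by apply: (inC (mxK *m mxR)); rewrite ?inE ?eqxx ?orbT // U_KR zE KRKR.
Qed.

Lemma stabK_U z : stab (U z) mxK = (K z == z).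
Proof. by rewrite /stab U_K U_sub. Qed.
Lemma stabR_U z : stab (U z) mxR = (R z == z).
Proof. by rewrite /stab U_R U_sub. Qed.
Lemma stabKR_U z : stab (U z) (mxK *m mxR) = (R (K z) == z).
Proof. by rewrite /stab U_KR U_sub. Qed.

Lemma covmx_U z : K z != z -> R z != z ->
  [/\ elementary_abelian_covering p (covmx (U z)), connected_graph (cover_graph (covmx (U z))),
      minimal_semisymmetric (covmx (U z)), minimal_edge_transitive (covmx (U z)) &
      largest_lifting_group (covmx (U z)) = if R (K z) == z then grpM else grpH].
Proof.
move=> Kz Rz; have freeU := fam_free sf (famU z).
have sU : semisym_mx (U z).
  by rewrite /semisym_mx (fam_Hstab sf (famU z)) stabK_U Kz stabR_U.
split.
- exact: covmx_elementary_abelian.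
- exact/covmx_connected.
- apply/minimal_semisymmetric_covmx => //; apply: Hstab_minimal_semisym sU.
  exact (fam_minimal sf (famU z)).
- apply/minimal_edge_transitive_covmx => //; exact (fam_minimal sf (famU z)).
- case: ifP => KRz; first by apply: largest_group_M; rewrite ?stabKR_U.
  by apply: largest_group_H; rewrite ?stabKR_U ?KRz.
Qed.

(** The plane prevents kappa from lifting; [chi theta] prevents rho and [rho * kappa], since both
    send it to a multiple of [chi (- theta)]. *)
Lemma covmx_chi_U z (theta : F) : theta ^+ 2 = - 3%:R -> theta != 0 -> K z != z -> R z == z ->
  let Z := chi_mx theta (U z) in
  [/\ elementary_abelian_covering p (covmx Z), connected_graph (cover_graph (covmx Z)),
      minimal_semisymmetric (covmx Z), ~ minimal_edge_transitive (covmx Z) &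
      largest_lifting_group (covmx Z) = grpH].
Proof.
move=> th2 th0 Kz Rz; have freeZ := chi_mx_free pr_p odd_p sf theta (famU z).
have nK : ~~ stab (U z) mxK by rewrite stabK_U.
have sR : stab (U z) mxR by rewrite stabR_U.
split.
- exact: covmx_elementary_abelian.
- exact/covmx_connected.
- apply/minimal_semisymmetric_covmx => //; exact: (chi_mx_minimal pr_p odd_p sf).
- by move/(minimal_edge_transitive_covmx pr_p freeZ); exact: chi_mx_not_minimal_Hstab.
apply: largest_group_H => //; first exact: (chi_mx_semisym pr_p odd_p sf).
apply: contra (chi_opp_sub pr_p odd_p sf th0 (famU z)) => s.
rewrite -eqmx_opp -chi_R -mulNmx -chi_K -mulmxA.
by apply: stab_row s (chi_sub_chi_mx _ _).
Qed.

Lemma minimal_semisym_cases (P : projection GP83) :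
  elementary_abelian_covering p P -> connected_graph (cover_graph P) -> minimal_semisymmetric P ->
  exists2 z, K z != z &
    R z != z /\ isomorphic_projections P (covmx (U z)) \/
    R z == z /\ exists theta : F, [/\ theta ^+ 2 = - 3%:R, theta != 0 &
       isomorphic_projections P (covmx (chi_mx theta (U z)))].
Proof.
move=> elP conP minP; have [d [Z [freeZ PZ]]] := elementary_abelian_covmx pr_p elP conP.
have /(minimal_semisymmetric_covmx pr_p freeZ) minZ := equivalent_minimal semisym_invariant PZ minP.
have [V [[z ->{V}] nK cases]] := minimal_semisym_classification pr_p odd_p sf freeZ minZ.
exists z; first by rewrite -stabK_U.
have iso1 (Z' : 'M_(d, 9)) : row_free Z' -> (Z' <= Z)%MS -> isomorphic_projections P (covmx Z').
  move=> fZ' sub; apply: equivalent_trans_iso PZ _.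
  by apply: (@coset_iso _ _ _ _ 1%:M); rewrite ?inE ?eqxx ?mulmx1.
case: cases => [[d2 [nR sub]] | [d3 [sR [th [th2 th0 sub]]]]].
  left; split; first by rewrite -stabR_U.
  by move: Z iso1 sub {PZ freeZ minZ}; rewrite d2 => Z iso1 sub; apply: iso1 => //; exact (fam_free sf (famU z)).
right; split; first by rewrite -stabR_U.
exists th; split=> //; move: Z iso1 sub {PZ freeZ minZ}; rewrite d3 => Z iso1 sub.
by apply: iso1 => //; exact (chi_mx_free pr_p odd_p sf th (famU z)).
Qed.

(** Rho changes the sign of [theta] and keeps the plane, while kappa keeps the line of [chi theta]
    and moves the plane to [U (K z)]. Hence neither choice affects the isomorphism class. *)
Lemma iso_chi_U z z' (theta theta' : F) : R z = z ->
  z' = z \/ z' = K z -> theta' = theta \/ theta' = - theta ->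
  isomorphic_projections (covmx (chi_mx theta (U z))) (covmx (chi_mx theta' (U z'))).
Proof.
move=> Rz zz' tt'; have freeZ' := chi_mx_free pr_p odd_p sf theta' (famU z').
have chiZ : (chi theta <= chi_mx theta (U z))%MS := chi_sub_chi_mx _ _.
have UZ : (U z <= chi_mx theta (U z))%MS := fam_sub_chi_mx _ _.
have mulE (C : 'M[F]_9) : chi_mx theta' (U z') *m C = col_mx (chi theta' *m C) (U z' *m C).
  exact: mul_col_mx.
have go C : C \in coset_mx p -> (chi theta' *m C <= chi_mx theta (U z))%MS ->
    (U z' *m C <= chi_mx theta (U z))%MS ->
    isomorphic_projections (covmx (chi_mx theta (U z))) (covmx (chi_mx theta' (U z'))).
  by move=> CC h1 h2; apply: coset_iso CC freeZ' _; rewrite mulE -addsmxE addsmx_sub h1.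
case: zz' tt' go => -> [] -> go.
- by apply: (go 1%:M); rewrite ?inE ?eqxx ?mulmx1.
- by apply: (go mxR); rewrite ?inE ?eqxx ?orbT // ?chi_R ?opprK // U_R Rz.
- by apply: (go mxK); rewrite ?inE ?eqxx ?orbT // ?chi_K ?eqmx_opp // U_K KK.
- apply: (go (mxK *m mxR)); rewrite ?inE ?eqxx ?orbT //.
    by rewrite mulmxA chi_K mulNmx chi_R opprK eqmx_opp.
  by rewrite U_KR KK Rz.
Qed.

Definition free_points : {set T} := [set z | [&& K z != z, R z != z & R (K z) != z]].

Lemma free_points_stable z : z \in free_points -> R z \in free_points /\ K z \in free_points.
Proof.
rewrite !inE => /and3P[Kz Rz KRz].
have KR : K z != R z by rewrite -(inj_eq (inv_inj RR)) RR.
have [Ri Ki] := (inv_inj RR, inv_inj KK).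
split; apply/and3P; split.
- by rewrite -RKC (inj_eq Ri).
- by rewrite (inj_eq Ri).
- by rewrite (inj_eq Ri) -RKC.
- by rewrite (inj_eq Ki).
- by rewrite RKC (inj_eq Ki).
- by rewrite KK eq_sym.
Qed.

Lemma iso_free_points z z' : isomorphic_projections (covmx (U z)) (covmx (U z')) ->
  z \in free_points -> z' \in free_points.
Proof.
move=> /iso_U; rewrite !in_setU !in_set1 -!orbA => /or4P[]/eqP-> // zS.
- by have [] := free_points_stable zS.
- by have [] := free_points_stable zS.
- by have [_ /free_points_stable[]] := free_points_stable zS.
Qed.

(** A point fixed by two of the three involutions is fixed by [K] and [R], which [dis] forbids; so
    the three fixed sets are disjoint and their sizes are subtracted. *)
Lemma card_free_points n k r kr : (forall z, K z = z -> R z <> z) -> #|T| = n ->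
  #|[set z | K z == z]| = k -> #|[set z | R z == z]| = r -> #|[set z | R (K z) == z]| = kr ->
  #|free_points| = (n - (k + r + kr))%N.
Proof.
move=> dis <- <- <- <-; apply: (canRL (addnK _)); have cardE (P : pred T) : #|[set z | P z]| = (\sum_z P z)%N.
  by rewrite cardsE -sum1_card big_mkcond; apply: eq_bigr => z _; rewrite unfold_in; case: (P z).
rewrite !cardE -!big_split -sum1_card; apply: eq_bigr => z _ /=.
have [Kz | Kz] := eqVneq (K z) z; last have [Rz | Rz] /= := eqVneq (R z) z.
- by rewrite Kz /=; case: eqP => // /(dis z Kz).
- by rewrite RKC Rz (negPf Kz).
- by case: eqP.
Qed.

(** The predicate [good] restricts the representatives to listed parameters; in case (A) it discards
    the point at infinity, which has no assignment of its own. *)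
Lemma orbit_representatives (good : pred T) n :
  (forall z, z \in free_points -> exists2 w, w \in klein_orbit z & good w) ->
  #|free_points| = (n * 4)%N ->
  number_up_to_iso (fun P => exists2 z, good z && (z \in free_points) & P = covmx (U z)) n.
Proof.
move=> goodP cardE.
have stable := free_points_stable.
have free z : z \in free_points -> [/\ R z != z, K z != z & R (K z) != z].
  by rewrite inE => /and3P[].
have E := klein_count RR KK RKC stable free.
set O := [set _ | z in _] in E.
have On : n = #|O| by move: E; rewrite cardE => /eqP; rewrite eqn_pmul2r // => /eqP.
have orbE z : klein_orbit z = orbit (klein_action RR KK RKC) setT z by rewrite klein_orbitE.
have eq_orb z w : w \in klein_orbit z -> klein_orbit w = klein_orbit z.
  by rewrite !orbE => /orbit_eqP.
have rep k : exists z, [&& good z, z \in free_points & klein_orbit z == enum_val (cast_ord On k)].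
  have /imsetP[z zS ->] := enum_valP (cast_ord On k).
  have [w wz gw] := goodP z zS; exists w; rewrite gw (eq_orb _ _ wz) orbE eqxx andbT /=.
  move: wz; rewrite !in_setU !in_set1 -!orbA => /or4P[]/eqP-> //.
  - by have [] := stable z zS.
  - by have [] := stable z zS.
  - by have [_ /stable[]] := stable z zS.
pose f k := xchoose (rep k).
have fP k : [/\ good (f k), f k \in free_points & klein_orbit (f k) = enum_val (cast_ord On k)].
  by have /and3P[? ? /eqP] := xchooseP (rep k).
exists (fun k => covmx (U (f k))); split=> [k | k l /iso_U/eq_orb | P [z /andP[gz zS] ->]].
- by have [gk Sk _] := fP k; exists (f k); rewrite ?gk.
- by have [_ _ ->] := fP k; have [_ _ ->] := fP l => /enum_val_inj/cast_ord_inj.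
have zO : klein_orbit z \in O by rewrite orbE imset_f.
pose k := cast_ord (esym On) (enum_rank_in zO (klein_orbit z)).
have kE : enum_val (cast_ord On k) = klein_orbit z by rewrite cast_ordKV enum_rankK_in.
exists k; apply/iso_U; have [_ _] := fP k; rewrite kE => <-.
exact: mem_klein_orbit.
Qed.

End KleinFamily.

Section PointsA.

Variable p : nat.
Hypotheses (pr_p : prime p) (odd_p : odd p).
Local Notation F := 'F_p.
Variable i : F.
Hypothesis i2 : i ^+ 2 = -1.

Local Notation mobK := (mobK i).
Local Notation mobR := (mobR i).
Local Notation mobKR := (mobKR i).

Let two0 := two_neq0 pr_p odd_p.

Lemma mobRKC z : mobR (mobK z) = mobK (mobR z).
Proof. by rewrite mobR_K // mobK_R. Qed.

Lemma split_family_UAo : split_family (fun V => exists z, V = UAo i z).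
Proof.
have [h1 h2 h3] := split_family_A pr_p odd_p i2.
have famo z : famA i (UAo i z) by exists (pt z).1, (pt z).2; split; first exact: pt_neq0.
split=> [V [z ->] | V v [z ->] | d W a b c e HW vW v0 nall]; [exact: h1 | exact: h2 |].
have [V [[x [y [xy ->]]] VW v4V]] := h3 d W a b c e HW vW v0 nall.
pose z := if y == 0 then None else Some (x / y).
have zE : same_ratio (pt z) (x, y).
  rewrite /same_ratio /z; have [-> | y0] := eqVneq y 0; rewrite [pt _]/pt /fst /snd.
    by rewrite !mulr0.
  by rewrite mulr1 divfK.
have zE' : same_ratio (x, y) (pt z) by rewrite /same_ratio eq_sym -[_ == _]/(same_ratio _ _).
have sub : (UA i x y <= UAo i z)%MS.
  by rewrite /UAo UA_subP ?pt_neq0 //; move: zE zE'; case: (pt z).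
have sub' : (UAo i z <= UA i x y)%MS.
  by rewrite /UAo UA_subP ?pt_neq0 //; move: zE zE'; case: (pt z).
exists (UAo i z); split; [by exists z | exact: submx_trans VW |].
by move=> a' b' c' e' h; apply: submx_trans sub; exact: v4V.
Qed.

Lemma klein_family_A : klein_family (UAo i) mobK mobR.
Proof.
split; [exact: mobKK | exact: mobRR | exact: mobRKC | exact: split_family_UAo
  | exact: UAo_sub | exact: UAo_K | exact: UAo_R].
Qed.

Definition freeA := free_points mobK mobR.

Lemma mobK_fixed_set z : (mobK z == z) = (z \in [set Some (-1); Some i]).
Proof.
case: z => [s|]; first by rewrite mobK_fixed // !inE.
by have [-> _ _] := mob_None i; rewrite !inE.
Qed.

Lemma mobR_fixed_set nu z : nu ^+ 2 = - i -> (mobR z == z) = (z \in [set Some nu; Some (- nu)]).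
Proof.
move=> nu2; case: z => [s|]; last by have [_ -> _] := mob_None i; rewrite !inE.
by rewrite mobR_fixed // -nu2 eqf_sqr !inE.
Qed.

Lemma mobKR_fixed_set nu z : nu ^+ 2 = - i ->
  (mobR (mobK z) == z) = (z \in [set Some (- 1 + nu - nu ^+ 2); Some (- 1 - nu - nu ^+ 2)]).
Proof.
move=> nu2; rewrite mobR_K //; case: z => [s|]; last by have [_ _ ->] := mob_None i; rewrite !inE.
rewrite mobKR_fixed // -nu2 eqf_sqr !inE nu2 opprK !(inj_eq (@Some_inj _)) !subr_eq.
by congr (_ || _); congr (_ == _); ring.
Qed.

(** A fixed point [s] satisfies [s ^+ 2 = - i], hence [s ^+ 4 = -1]. *)
Lemma mobR_fixed_mod8 z : mobR z = z -> p = 1 %[mod 8].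
Proof.
move=> /eqP; case: z => [s|]; last by have [_ -> _] := mob_None i.
rewrite mobR_fixed // => /eqP s2; apply: (@pow4_opp1_mod8 p pr_p odd_p s).
by rewrite (exprM s 2 2) s2 sqrrN.
Qed.

Lemma mobKR_fixed_mod8 z : mobR (mobK z) = z -> p = 1 %[mod 8].
Proof.
rewrite mobR_K // => /eqP; case: z => [s|]; last by have [_ _ ->] := mob_None i.
rewrite mobKR_fixed // => /eqP s2; apply: (@pow4_opp1_mod8 p pr_p odd_p (s - (i - 1))).
by rewrite (exprM _ 2 2) s2 sqrrN.
Qed.

Lemma mobK_fixed_not_mobR z : mobK z = z -> mobR z <> z.
Proof.
move=> /eqP; rewrite mobK_fixed_set !inE => /orP[]/eqP-> /eqP; rewrite mobR_fixed // => /eqP h.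
  have i1 : i = -1 by rewrite -[i]opprK -h sqrrN expr1n.
  by move: i2; rewrite i1 sqrrN expr1n => /eqP; rewrite one_neq_opp1.
have i1 : i = 1 by apply: oppr_inj; rewrite -h.
by move: i2; rewrite i1 expr1n => /eqP; rewrite one_neq_opp1.
Qed.

(** Infinity is replaced by its image 0 under rho. *)
Lemma freeA_orbit z : z \in freeA -> exists2 w, w \in klein_orbit mobK mobR z & w != None.
Proof.
case: z => [s|] _; first by exists (Some s); rewrite ?in_setU ?in_set1 ?eqxx.
by exists (mobR None); rewrite ?in_setU ?in_set1 ?eqxx ?orbT.
Qed.

Lemma Some_neq (x y : F) : x - y != 0 -> Some x != Some y.
Proof. by rewrite subr_eq0. Qed.

Lemma mobK_fixed_card : #|[set z | mobK z == z]| = 2%N.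
Proof.
have -> : [set z | mobK z == z] = [set Some (-1); Some i] by apply/setP => z; rewrite inE mobK_fixed_set.
by rewrite cards2 eq_sym Some_neq // opprK addrC one_i_neq0.
Qed.

Lemma card_freeA r kr : #|[set z | mobR z == z]| = r -> #|[set z | mobR (mobK z) == z]| = kr ->
  #|freeA| = (p.+1 - (2 + r + kr))%N.
Proof.
have cT : #|{: option F}| = p.+1 by rewrite card_option card_Fp.
exact (card_free_points klein_family_A mobK_fixed_not_mobR cT mobK_fixed_card).
Qed.

Lemma card_freeA_mod5 : p = 5 %[mod 8] -> #|freeA| = ((p - 1) %/ 4 * 4)%N.
Proof.
move=> p5; have noR : #|[set z | mobR z == z]| = 0%N.
  by apply: eq_card0 => z; rewrite inE; apply/eqP => h; have := mobR_fixed_mod8 h; rewrite p5.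
have noKR : #|[set z | mobR (mobK z) == z]| = 0%N.
  by apply: eq_card0 => z; rewrite inE; apply/eqP => h; have := mobKR_fixed_mod8 h; rewrite p5.
by rewrite (card_freeA noR noKR); move: p5; lia.
Qed.

(** Each of the three involutions has two fixed points, so six of the [p + 1] points are removed.
    For [p = 5] modulo 8 only kappa has fixed points. *)
Lemma card_freeA_mod1 nu : nu ^+ 2 = - i -> p = 1 %[mod 8] -> #|freeA| = ((p - 5) %/ 4 * 4)%N.
Proof.
move=> nu2 p1; have nu0 : nu != 0.
  by apply: contraNneq (i_neq0 i2) => h; rewrite -oppr_eq0 -nu2 h expr0n.
have nn : 2%:R * nu != 0 by rewrite mulf_neq0.
have cR : #|[set z | mobR z == z]| = 2%N.
  have ne : Some nu != Some (- nu) by apply: Some_neq; rewrite opprK -mulr2n -mulr_natl.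
  have -> : 2%N = #|[set Some nu; Some (- nu)]| by rewrite cards2 ne.
  by apply: eq_card => z; rewrite inE (mobR_fixed_set _ nu2).
have cKR : #|[set z | mobR (mobK z) == z]| = 2%N.
  have ne : Some (- 1 + nu - nu ^+ 2) != Some (- 1 - nu - nu ^+ 2).
    apply: Some_neq.
    by have -> : - 1 + nu - nu ^+ 2 - (- 1 - nu - nu ^+ 2) = 2%:R * nu by ring.
  have -> : 2%N = #|[set Some (- 1 + nu - nu ^+ 2); Some (- 1 - nu - nu ^+ 2)]| by rewrite cards2 ne.
  by apply: eq_card => z; rewrite inE (mobKR_fixed_set _ nu2).
by rewrite (card_freeA cR cKR); move: p1 (prime_gt1 pr_p); lia.
Qed.

End PointsA.

Section PointsB.

Variable p : nat.
Hypotheses (pr_p : prime p) (odd_p : odd p) (p3 : p = 3 %[mod 4]).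
Local Notation F := 'F_p.

Let aniso := aniso_mod4 pr_p odd_p p3.
Let two0 := two_neq0 pr_p odd_p.

Local Notation conic := {u : F * F | solutionB u}.

(* Opaque, so that unifying [conicK w] with [conicR w] fails at once instead of
   normalizing the arithmetic of 'F_p. *)
Fact conicK_subproof : {f : conic -> conic | forall w, val (f w) = solK (val w)}.
Proof. by exists (fun w : conic => exist _ (solK (val w)) (solK_sol (valP w))). Qed.
Fact conicR_subproof : {f : conic -> conic | forall w, val (f w) = solR (val w)}.
Proof. by exists (fun w : conic => exist _ (solR (val w)) (solR_sol aniso (valP w))). Qed.

Definition conicK := sval conicK_subproof.
Definition conicR := sval conicR_subproof.

Lemma val_conicK w : val (conicK w) = solK (val w). Proof. exact: svalP conicK_subproof w. Qed.
Lemma val_conicR w : val (conicR w) = solR (val w). Proof. exact: svalP conicR_subproof w. Qed.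

Lemma conicKK : involutive conicK.
Proof. by move=> w; apply: val_inj; rewrite !val_conicK solKK. Qed.
Lemma conicRR : involutive conicR.
Proof. by move=> w; apply: val_inj; rewrite !val_conicR (solRR aniso (valP w)). Qed.
Lemma conicRKC w : conicR (conicK w) = conicK (conicR w).
Proof. by apply: val_inj; rewrite !(val_conicK, val_conicR) solR_K solK_R. Qed.

Lemma split_family_UBo : split_family (fun V => exists w : conic, V = UBo (val w)).
Proof.
have [h1 h2 h3] := split_family_B pr_p odd_p aniso.
have famo (w : conic) : famB (UBo (val w)).
  by case: w => -[a b] sol; exists a, b.
split=> [V [w ->] | V v [w ->] | d W a b c e HW vW v0 nall]; [exact: h1 | exact: h2 |].
have [V [[x [y [xy ->]]] VW v4V]] := h3 d W a b c e HW vW v0 nall.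
by exists (UB x y); split=> //; exists (exist _ (x, y) xy).
Qed.

Lemma klein_family_B : klein_family (fun w : conic => UBo (val w)) conicK conicR.
Proof.
split; [exact: conicKK | exact: conicRR | exact: conicRKC | exact: split_family_UBo | | |].
- by move=> w w'; rewrite (UBo_sub pr_p odd_p) val_eqE.
- by move=> w d W; rewrite val_conicK UBo_K.
- by move=> w d W; rewrite val_conicR (UBo_R pr_p odd_p aniso _ (valP w)).
Qed.

Lemma conicK_fixed w : conicK w != w.
Proof. by rewrite -val_eqE val_conicK (solK_fixed pr_p odd_p aniso (valP w)). Qed.

Lemma conicR_fixed w : (conicR w == w) = ((val w).1 == -1).
Proof. by rewrite -val_eqE val_conicR (solR_fixed aniso (valP w)). Qed.

Lemma conicKR_fixed w : (conicR (conicK w) == w) = ((val w).1 == 1).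
Proof. by rewrite -val_eqE val_conicR val_conicK solR_K (solKR_fixed aniso (valP w)). Qed.

Lemma sol_sqr1 (a b : F) : solutionB (a, b) -> a ^+ 2 = 1 -> b ^+ 2 = - 2%:R.
Proof. by move=> /sol_sqr-> ->; ring. Qed.

Lemma sol_mod8 (a b : F) : solutionB (a, b) -> a ^+ 2 = 1 -> p = 3 %[mod 8].
Proof. by move=> sol a1; apply: (@sqr_opp2_mod8 p pr_p odd_p b p3); exact: sol_sqr1 sol a1. Qed.

Definition freeB := free_points conicK conicR.

Lemma freeBE w : (w \in freeB) = ((val w).1 != -1) && ((val w).1 != 1).
Proof. by rewrite inE conicK_fixed conicR_fixed conicKR_fixed. Qed.

Lemma card_conic : #|{: conic}| = p.+1.
Proof.
have [u0 u0P] := solutionB_exists pr_p odd_p p3.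
by rewrite card_sig -(card_solutionB pr_p odd_p p3 u0P) cardsE.
Qed.

Lemma card_freeB r kr : #|[set w | conicR w == w]| = r ->
  #|[set w | conicR (conicK w) == w]| = kr -> #|freeB| = (p.+1 - (r + kr))%N.
Proof.
have noK : #|[set w | conicK w == w]| = 0%N.
  by apply: eq_card0 => w; rewrite !inE (negPf (conicK_fixed w)).
have disj w : conicK w = w -> conicR w <> w by move/eqP; rewrite (negPf (conicK_fixed w)).
exact (card_free_points klein_family_B disj card_conic noK).
Qed.

Lemma card_freeB_mod7 : p = 7 %[mod 8] -> #|freeB| = ((p + 1) %/ 4 * 4)%N.
Proof.
move=> p7; have no (w : conic) : (val w).1 ^+ 2 <> 1.
  case: w => -[a b] sol /= a1; have := sol_mod8 sol a1; by rewrite p7.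
have noR : #|[set w | conicR w == w]| = 0%N.
  apply: eq_card0 => w; rewrite !inE conicR_fixed; apply/eqP => h.
  by apply: (no w); rewrite h sqrrN expr1n.
have noKR : #|[set w | conicR (conicK w) == w]| = 0%N.
  apply: eq_card0 => w; rewrite !inE conicKR_fixed; apply/eqP => h.
  by apply: (no w); rewrite h expr1n.
by rewrite (card_freeB noR noKR); move: p7; lia.
Qed.

Lemma sol_r (a r : F) : a ^+ 2 = 1 -> r ^+ 2 = - 2%:R -> solutionB (a, r) && solutionB (a, - r).
Proof.
move=> a1 r2; rewrite /solutionB /= sqrrN a1 r2 andbb; apply/eqP; ring.
Qed.

Lemma card_fixed_abscissa (a r : F) : a ^+ 2 = 1 -> r ^+ 2 = - 2%:R ->
  #|[set w : conic | (val w).1 == a]| = 2%N.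
Proof.
move=> a1 r2; have /andP[sol sol'] := sol_r a1 r2.
have nr : (a, r) != (a, - r).
  rewrite xpair_eqE eqxx /=; apply/eqP => h; have := r2; have -> : r = 0.
    apply/eqP; move/eqP: h; rewrite -addr_eq0 -mulr2n -mulr_natl mulf_eq0 (negPf two0).
    by [].
  by rewrite expr0n => /esym/eqP; rewrite oppr_eq0 (negPf two0).
rewrite -(card_imset _ val_inj) -[RHS](_ : #|[set (a, r); (a, - r)]| = 2%N); last by rewrite cards2 nr.
apply: eq_card => u; rewrite !inE; apply/imsetP/orP => [[[[x y] xy]] | [/eqP->|/eqP->]].
- rewrite inE /= => /eqP xa ->; subst x; rewrite !xpair_eqE eqxx /=; apply/orP.
  by rewrite -eqf_sqr r2 (sol_sqr1 xy a1).
- by exists (exist _ (a, r) sol); rewrite ?inE.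
- by exists (exist _ (a, - r) sol'); rewrite ?inE.
Qed.

(** Kappa fixes no point of the conic; rho and [rho * kappa] fix the points with first coordinate -1
    and 1, two each since the second coordinate is a square root of -2. *)
Lemma card_freeB_mod3 (r : F) : r ^+ 2 = - 2%:R -> p = 3 %[mod 8] ->
  #|freeB| = ((p - 3) %/ 4 * 4)%N.
Proof.
move=> r2 p38.
have cR : #|[set w | conicR w == w]| = 2%N.
  rewrite -(@card_fixed_abscissa (-1) r) ?sqrrN ?expr1n //.
  by apply: eq_card => w; rewrite !inE conicR_fixed.
have cKR : #|[set w | conicR (conicK w) == w]| = 2%N.
  rewrite -(@card_fixed_abscissa 1 r) ?expr1n //.
  by apply: eq_card => w; rewrite !inE conicKR_fixed.
by rewrite (card_freeB cR cKR); move: p38 (prime_gt1 pr_p); lia.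
Qed.

End PointsB.

Section Congruences.

Variable n : nat.

Lemma mod8_1 : n = 1 %[mod 8] -> n = 1 %[mod 4]. Proof. lia. Qed.
Lemma mod8_5 : n = 5 %[mod 8] -> n = 1 %[mod 4]. Proof. lia. Qed.
Lemma mod8_3 : n = 3 %[mod 8] -> n = 3 %[mod 4]. Proof. lia. Qed.
Lemma mod24_1 : n = 1 %[mod 24] -> n = 1 %[mod 8]. Proof. lia. Qed.
Lemma mod24_19 : n = 19 %[mod 24] -> n = 3 %[mod 8]. Proof. lia. Qed.
Lemma mod4_1 : n = 1 %[mod 4] -> n = 1 %[mod 8] \/ n = 5 %[mod 8]. Proof. lia. Qed.
Lemma mod4_3 : n = 3 %[mod 4] -> n = 3 %[mod 8] \/ n = 7 %[mod 8]. Proof. lia. Qed.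
Lemma mod8_3_1 : n = 1 %[mod 8] -> n = 1 %[mod 3] -> n = 1 %[mod 24]. Proof. lia. Qed.
Lemma mod8_3_19 : n = 3 %[mod 8] -> n = 1 %[mod 3] -> n = 19 %[mod 24]. Proof. lia. Qed.

End Congruences.

Section Counting.

Variable X : sgraph.

Lemma number_up_to_iso_ext (S S' : projection X -> Prop) n :
  (forall P, S P <-> S' P) -> number_up_to_iso S n -> number_up_to_iso S' n.
Proof.
move=> SS' [f [fS f_inj f_all]]; exists f; split=> // [k | P]; first exact/SS'.
by move=> /SS'; exact: f_all.
Qed.

Lemma number_up_to_iso_add (S : projection X -> Prop) (Q : projection X) n :
  (forall P, S P -> ~ isomorphic_projections P Q) -> number_up_to_iso S n ->
  number_up_to_iso (fun P => S P \/ P = Q) n.+1.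
Proof.
move=> nQ [f [fS f_inj f_all]].
exists (fun k => oapp f Q (unlift ord_max k)); split=> [k | k l | P [/f_all[k Pk] | ->]].
- by case: unliftP => [j _ | _]; [left; exact: fS | right].
- case: unliftP => [j -> | ->]; case: unliftP => [j' -> | ->] //=.
  + by move/f_inj->.
  + by move/(nQ _ (fS j)).
  + by move/isomorphic_sym/(nQ _ (fS j')).
- by exists (lift ord_max k); rewrite liftK.
by exists ord_max; rewrite unlift_none; exact: isomorphic_refl.
Qed.

End Counting.

Section Classification.

Variables (p : nat) (pr_p : prime p) (odd_p : odd p).
Variables (i nu theta r delta : 'F_p).
Hypotheses (def_i : p = 1 %[mod 4] -> i ^+ 2 = -1)
  (def_nu : p = 1 %[mod 8] -> nu ^+ 2 = - i)
  (def_theta : p = 1 %[mod 24] \/ p = 19 %[mod 24] -> theta ^+ 2 = - 3%:R)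
  (def_r : p = 3 %[mod 8] -> r ^+ 2 = - 2%:R)
  (def_delta : p = 19 %[mod 24] -> delta ^+ 2 = - 2%:R).

Local Notation F := 'F_p.
Local Notation conic := {u : F * F | solutionB u}.
Local Notation L := (listed i nu theta r delta).
Local Notation projUA z := (covmx (UAo i z)).
Local Notation projUB w := (covmx (UBo (val w))).

Let kfA (p1 : p = 1 %[mod 4]) := klein_family_A pr_p odd_p (def_i p1).
Let kfB (p3 : p = 3 %[mod 4]) := klein_family_B pr_p odd_p p3.

Definition spA : option F := Some (- 1 + nu - nu ^+ 2).

Lemma paramA1E s : paramA1 i s = (p == 5 %[mod 8]) && (Some s \in freeA i).
Proof.
rewrite /paramA1; case: eqP => //= p5; have i2 := def_i (mod8_5 p5).
have nR z : (mobR i z == z) = false.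
  by apply/eqP => /(mobR_fixed_mod8 pr_p odd_p i2); rewrite p5.
have nKR z : (mobR i (mobK i z) == z) = false.
  by apply/eqP => /(mobKR_fixed_mod8 pr_p odd_p i2); rewrite p5.
by rewrite [in RHS]inE nR nKR mobK_fixed_set // !inE andbT.
Qed.

Lemma paramA2E s : paramA2 i nu s = (p == 1 %[mod 8]) && (Some s \in freeA i).
Proof.
rewrite /paramA2; case: eqP => //= p1; have i2 := def_i (mod8_1 p1).
have nu2 := def_nu p1.
rewrite [in RHS]inE mobK_fixed_set // (mobR_fixed_set i2 _ nu2).
rewrite (mobKR_fixed_set pr_p odd_p i2 _ nu2) !inE !negb_or -!andbA.
by [].
Qed.

(** On the conic a first coordinate [1] or [-1] forces the second to be a square root of -2. So the
    four excluded pairs are exactly the fixed points, and for [p = 7] modulo 8 the condition holds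
    by itself. *)
Lemma paramB1E (w : conic) : paramB1 r (val w) =
  [&& p == 3 %[mod 4], (val w).1 != -1 & (val w).1 != 1].
Proof.
rewrite /paramB1 (valP w); case: eqP => //= p3; case: w => -[a b] sol /=.
have a1 : (a != -1) && (a != 1) = (a ^+ 2 != 1) by rewrite sqrf_eq1 negb_or andbC.
rewrite a1; case: eqP => [p38 | np] /=; last first.
  by apply/esym/eqP => /(sol_mod8 pr_p odd_p p3 sol).
have r2 := def_r p38; rewrite !inE !xpair_eqE !negb_or !negb_and.
have [/eqP e | ne] := boolP (a ^+ 2 == 1); last first.
  by move: ne; rewrite -a1 => /andP[-> ->].
have : b ^+ 2 == r ^+ 2 by rewrite r2 (sol_sqr1 sol e).
rewrite eqf_sqr => /orP[]/eqP ->; move/eqP: e; rewrite sqrf_eq1 => /orP[]/eqP->;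
  by rewrite !eqxx /= ?andbF.
Qed.

(** The list rewritten through the two Klein families, with the excluded values of each family
    expressed as freeness of the point. *)
Definition listed_spec (f : cover_family) (P : projection GP83) : Prop :=
  match f with
  | FamA1 => p = 5 %[mod 8] /\ exists2 s, Some s \in freeA i & P = projUA (Some s)
  | FamA2 => p = 1 %[mod 8] /\ exists2 s, Some s \in freeA i & P = projUA (Some s)
  | FamA3 => p = 1 %[mod 8] /\ P = projUA spA
  | FamB1 => p = 3 %[mod 4] /\ exists2 w : conic,
      ((val w).1 != -1) && ((val w).1 != 1) & P = projUB w
  | FamB2 => p = 3 %[mod 8] /\ exists2 w : conic, val w = (1, r) & P = projUB w
  | FamC => p = 1 %[mod 24] /\ P = covmx (chi_mx theta (UAo i (Some nu)))
  | FamD => p = 19 %[mod 24] /\ exists2 w : conic, val w = (-1, delta) &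
      P = covmx (chi_mx theta (UBo (val w)))
  end.

Lemma projB_UBo (u : F * F) : projB u = covmx (UBo u).
Proof. by case: u => a b; exact: projB_UB. Qed.

Lemma listedP f P : L f P <-> listed_spec f P.
Proof.
case: f; rewrite /listed /listed_spec.
- split=> [[s] | [p5 [s fs ->]]].
    by rewrite paramA1E => /andP[/eqP p5 fs] ->; split=> //; exists s => //; exact: projA_UA.
  by exists s; [rewrite paramA1E p5 eqxx | rewrite projA_UA].
- split=> [[s] | [p5 [s fs ->]]].
    by rewrite paramA2E => /andP[/eqP p5 fs] ->; split=> //; exists s => //; exact: projA_UA.
  by exists s; [rewrite paramA2E p5 eqxx | rewrite projA_UA].
- by rewrite projA_UA.
- split=> [[ab pab ->] | [p3 [w wP ->]]].
    have /and3P[_ sol _] := pab; move: pab.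
    rewrite -[ab]/(val (exist _ ab sol : conic)) paramB1E => /andP[/eqP p3 ab1].
    by split=> //; exists (exist _ ab sol) => //; exact: projB_UBo.
  exists (val w); last by rewrite projB_UBo.
  by rewrite paramB1E p3 eqxx.
- split=> [[p3 ->] | [p3 [w wE ->]]]; last by rewrite wE -projB_UBo.
  have /andP[sol _] := sol_r (expr1n _ 2) (def_r p3).
  by split=> //; exists (exist _ (1, r) sol) => //; rewrite projB_UBo.
- by rewrite projC_chi.
split=> [[p3 ->] | [p3 [w wE ->]]]; last by rewrite wE projD_chi; split.
have m1 : (-1 : F) ^+ 2 = 1 by rewrite sqrrN expr1n.
have /andP[sol _] := sol_r m1 (def_delta p3).
by split=> //; exists (exist _ (-1, delta) sol) => //; rewrite projD_chi.
Qed.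

Lemma theta_neq0 : p = 1 %[mod 24] \/ p = 19 %[mod 24] -> theta != 0.
Proof.
move=> p24; apply/eqP => t0; have := def_theta p24.
rewrite t0 expr0n => /esym/eqP; rewrite oppr_eq0 Fp_natr_eq0 //.
rewrite dvdn_prime2 // => /eqP p3; move: p24; rewrite p3 => -[] //.
Qed.

Lemma spA_fixed (p1 : p = 1 %[mod 8]) :
  [/\ mobK i spA != spA, mobR i spA != spA & mobR i (mobK i spA) == spA].
Proof.
have i2 := def_i (mod8_1 p1).
have nu2 := def_nu p1.
have KR : mobR i (mobK i spA) == spA.
  by rewrite (mobKR_fixed_set pr_p odd_p i2 _ nu2) !inE eqxx.
have fix_both : mobK i spA = spA -> mobR i spA = spA -> False.
  exact (@mobK_fixed_not_mobR _ pr_p odd_p _ i2 spA).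
split=> //; apply/eqP => h; apply: (fix_both) => //; apply/eqP.
  by move: KR; rewrite h.
by move: KR; rewrite (mobRKC pr_p odd_p i2) h.
Qed.

Theorem listed_properties f P : L f P ->
  [/\ elementary_abelian_covering p P, connected_graph (cover_graph P),
      minimal_semisymmetric P, largest_lifting_group P = family_group f &
      if in_A f || in_B f then minimal_edge_transitive P else ~ minimal_edge_transitive P].
Proof.
move=> /listedP; case: f; rewrite /listed_spec.
- move=> [p5 [s fs ->]]; have p1 := mod8_5 p5.
  move: fs; rewrite inE => /and3P[Kz Rz KRz].
  by have := covmx_U pr_p (kfA p1) Kz Rz; rewrite (negPf KRz) => -[].
- move=> [p18 [s fs ->]]; have p1 := mod8_1 p18.
  move: fs; rewrite inE => /and3P[Kz Rz KRz].
  by have := covmx_U pr_p (kfA p1) Kz Rz; rewrite (negPf KRz) => -[].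
- move=> [p18 ->]; have p1 := mod8_1 p18.
  have [Kz Rz KRz] := spA_fixed p18.
  by have := covmx_U pr_p (kfA p1) Kz Rz; rewrite KRz => -[].
- move=> [p3 [w /andP[wm1 w1] ->]].
  have Rw : conicR pr_p odd_p p3 w != w by rewrite conicR_fixed.
  have KRw : (conicR pr_p odd_p p3 (conicK w) == w) = false by rewrite conicKR_fixed (negPf w1).
  by have := covmx_U pr_p (kfB p3) (conicK_fixed pr_p odd_p p3 w) Rw; rewrite KRw => -[].
- move=> [p38 [w wE ->]]; have p3 := mod8_3 p38.
  have Rw : conicR pr_p odd_p p3 w != w by rewrite conicR_fixed wE one_neq_opp1.
  have KRw : conicR pr_p odd_p p3 (conicK w) == w by rewrite conicKR_fixed wE eqxx.
  by have := covmx_U pr_p (kfB p3) (conicK_fixed pr_p odd_p p3 w) Rw; rewrite KRw => -[].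
- move=> [p24 ->]; have p18 := mod24_1 p24; have p1 := mod8_1 p18.
  have nuR : mobR i (Some nu) == Some nu.
    by rewrite (mobR_fixed_set (def_i p1) _ (def_nu p18)) !inE eqxx.
  have nuK : mobK i (Some nu) != Some nu.
    apply/eqP => h; apply: (@mobK_fixed_not_mobR _ pr_p odd_p _ (def_i p1) _ h); exact/eqP.
  have t24 : p = 1 %[mod 24] \/ p = 19 %[mod 24] by left.
  by have [] := covmx_chi_U pr_p odd_p (kfA p1) (def_theta t24) (theta_neq0 t24) nuK nuR.
move=> [p24 [w wE ->]]; have p3 := mod8_3 (mod24_19 p24).
have t24 : p = 1 %[mod 24] \/ p = 19 %[mod 24] by right.
have Rw : conicR pr_p odd_p p3 w == w by rewrite conicR_fixed wE eqxx.
by have [] := covmx_chi_U pr_p odd_p (kfB p3) (def_theta t24) (theta_neq0 t24)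
  (conicK_fixed pr_p odd_p p3 w) Rw.
Qed.

Lemma klein_orbit_A z : p = 1 %[mod 4] -> klein_orbit (mobK i) (mobR i) z = orbitA i z.
Proof. by move=> p1; rewrite orbitAE -(mobR_K pr_p odd_p (def_i p1)). Qed.

Lemma iso_UA z z' : p = 1 %[mod 4] ->
  isomorphic_projections (projUA z) (projUA z') <-> z' \in orbitA i z.
Proof. by move=> p1; rewrite -klein_orbit_A //; exact: iso_U (kfA p1) z z'. Qed.

Lemma klein_orbit_B p3 (w : conic) :
  [set val w' | w' in klein_orbit (@conicK p) (conicR pr_p odd_p p3) w] = orbitB (val w).
Proof.
rewrite orbitBE /klein_orbit !imsetU !imset_set1 !(val_conicK, val_conicR).
by rewrite solR_K.
Qed.

Lemma iso_UB (w w' : conic) : p = 3 %[mod 4] ->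
  isomorphic_projections (projUB w) (projUB w') <-> val w' \in orbitB (val w).
Proof.
move=> p3; rewrite -(klein_orbit_B p3) (mem_imset _ _ val_inj).
exact: iso_U (kfB p3) w w'.
Qed.

Lemma conic_eq (w w' : conic) : (val w).1 = (val w').1 -> (val w).1 ^+ 2 = 1 ->
  p = 3 %[mod 4] -> w' = w \/ w' = conicK w.
Proof.
case: w => -[a b] sol; case: w' => -[a' b'] sol' /= aa' a1 p3; subst a'.
have : b' ^+ 2 == b ^+ 2 by rewrite (sol_sqr1 sol a1) (sol_sqr1 sol' a1).
rewrite eqf_sqr => /orP[]/eqP e; [left | right]; apply: val_inj; rewrite ?val_conicK /=.
  by rewrite e.
by rewrite e.
Qed.

Lemma sqr_theta (th : F) : p = 1 %[mod 24] \/ p = 19 %[mod 24] -> th ^+ 2 = - 3%:R ->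
  theta = th \/ theta = - th.
Proof.
move=> p24 th2; have : theta ^+ 2 == th ^+ 2 by rewrite th2 (def_theta p24).
by rewrite eqf_sqr => /orP[]/eqP; [left | right].
Qed.

Theorem listed_complete (P : projection GP83) :
  elementary_abelian_covering p P -> connected_graph (cover_graph P) ->
  minimal_semisymmetric P -> exists f Q, L f Q /\ isomorphic_projections P Q.
Proof.
move=> elP conP minP; have [p1 | p3] := mod4_cases pr_p odd_p.
  have i2 := def_i p1; have RK := mobRKC pr_p odd_p i2.
  have [z Kz [[Rz PU] | [/eqP Rz [th [th2 th0 PU]]]]] :=
    minimal_semisym_cases pr_p odd_p (kfA p1) elP conP minP.
    have [/eqP KRz | KRz] := boolP (mobR i (mobK i z) == z).
      have p18 := mobKR_fixed_mod8 pr_p odd_p i2 KRz; have nu2 := def_nu p18.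
      exists FamA3, (projUA spA); split; first exact/listedP.
      apply: isomorphic_trans PU _; apply/(iso_U (kfA p1)).
      (* Rho permutes the two fixed points of [rho * kappa] and moves [z], so it exchanges them;
         [spA] is therefore [z] or its image. *)
      have KRz' : mobR i (mobK i (mobR i z)) == mobR i z by rewrite -RK KRz.
      have := KRz'; move/eqP: KRz; rewrite !(mobKR_fixed_set pr_p odd_p i2 _ nu2).
      rewrite !in_set2 -/spA => /orP[/eqP-> _ | /eqP zE]; first by rewrite !in_setU !in_set1 eqxx.
      case/orP => [/eqP<- | /eqP RzE]; first by rewrite !in_setU !in_set1 eqxx orbT.
      by move: Rz; rewrite RzE zE eqxx.
    have fz : z \in freeA i by rewrite inE Kz Rz.
    have [[s|//] zs _] := freeA_orbit fz; have iso := (iso_U (kfA p1) z (Some s)).2 zs.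
    have fs : Some s \in freeA i := iso_free_points (kfA p1) iso fz.
    have [p18 | p58]  := mod4_1 p1.
      exists FamA2, (projUA (Some s)); split; last exact: isomorphic_trans PU iso.
      by apply/listedP; split=> //; exists s.
    exists FamA1, (projUA (Some s)); split; last exact: isomorphic_trans PU iso.
    by apply/listedP; split=> //; exists s.
  have p18 := mobR_fixed_mod8 pr_p odd_p i2 Rz; have nu2 := def_nu p18.
  (* The plane fixed by rho gives [p = 1] modulo 8, and the square root of -3 gives [p = 1] modulo
     3. *)
  have p24 := mod8_3_1 p18 (sqr_opp3_mod3 pr_p odd_p th2 th0).
  exists FamC, (covmx (chi_mx theta (UAo i (Some nu)))); split; first exact/listedP.
  apply: isomorphic_trans PU _; apply: (iso_chi_U pr_p odd_p (kfA p1) Rz).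
    (* Kappa exchanges the two fixed points [nu] and [- nu] of rho, so both give the same cover. *)
    have KRz : mobR i (mobK i z) == mobK i z by rewrite RK Rz.
    have := KRz; move/eqP: Rz; rewrite !(mobR_fixed_set i2 _ nu2) !in_set2.
    move=> /orP[]/eqP zE /orP[]/eqP KzE; [by left | by left | by right |].
    by move: Kz; rewrite KzE zE eqxx.
  by apply: sqr_theta => //; left.
have [w Kw [[Rw PU] | [Rw [th [th2 th0 PU]]]]] :=
    minimal_semisym_cases pr_p odd_p (kfB p3) elP conP minP.
  have [KRw | KRw] := eqVneq (val w).1 1.
    have a1 : (val w).1 ^+ 2 = 1 by rewrite KRw expr1n.
    have p38 : p = 3 %[mod 8].
      by case: w a1 {Kw Rw PU KRw} => -[a b] sol a1; exact (sol_mod8 pr_p odd_p p3 sol a1).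
    have /andP[sol _] := sol_r (expr1n _ 2) (def_r p38).
    pose w0 : conic := exist _ (1, r) sol.
    exists FamB2, (projUB w0); split; first by apply/listedP; split=> //; exists w0.
    apply: isomorphic_trans PU _; apply/(iso_U (kfB p3)).
    have [->|->] := @conic_eq w w0 KRw a1 p3; by rewrite !in_setU !in_set1 eqxx ?orbT.
  exists FamB1, (projUB w); split=> //; apply/listedP; split=> //; exists w => //.
  by rewrite KRw andbT -(conicR_fixed pr_p odd_p p3).
have aw : (val w).1 = -1 by apply/eqP; rewrite -(conicR_fixed pr_p odd_p p3).
have a1 : (val w).1 ^+ 2 = 1 by rewrite aw sqrrN expr1n.
have p38 : p = 3 %[mod 8] by case: w a1 {Kw Rw PU aw} => -[a b] sol a1; exact (sol_mod8 pr_p odd_p p3 sol a1).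
have p24 := mod8_3_19 p38 (sqr_opp3_mod3 pr_p odd_p th2 th0).
have m1 : (-1 : F) ^+ 2 = 1 by rewrite sqrrN expr1n.
have /andP[sol _] := sol_r m1 (def_delta p24).
pose w0 : conic := exist _ (-1, delta) sol.
exists FamD, (covmx (chi_mx theta (UBo (val w0)))); split.
  by apply/listedP; split=> //; exists w0.
apply: isomorphic_trans PU _; apply: (iso_chi_U pr_p odd_p (kfB p3) (eqP Rw)).
  exact: (@conic_eq w w0 aw a1 p3).
by apply: sqr_theta => //; right.
Qed.

Definition family_dim (f : cover_family) : nat := if in_A f || in_B f then 2 else 3.

Lemma listed_covmx f P : listed_spec f P -> exists Z : 'M[F]_(family_dim f, 9), P = covmx Z.
Proof.
case: f => [[_ [s _ ->]]|[_ [s _ ->]]|[_ ->]|[_ [w _ ->]]|[_ [w _ ->]]|[_ ->]|[_ [w _ ->]]];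
  by eexists.
Qed.

Lemma not_iso_A s : p = 1 %[mod 8] -> Some s \in freeA i ->
  ~ isomorphic_projections (projUA (Some s)) (projUA spA).
Proof.
move=> p18 fs iso; have p1 := mod8_1 p18.
have := iso_free_points (kfA p1) iso fs.
by rewrite inE; have [_ _ ->] := spA_fixed p18; rewrite !andbF.
Qed.

Lemma not_iso_B (w w' : conic) : p = 3 %[mod 4] ->
  ((val w).1 != -1) && ((val w).1 != 1) -> val w' = (1, r) ->
  ~ isomorphic_projections (projUB w) (projUB w').
Proof.
move=> p3; rewrite -(freeBE pr_p odd_p p3) => fw w'E iso.
have := iso_free_points (kfB p3) iso fw.
by rewrite -/(freeB pr_p odd_p p3) freeBE w'E eqxx andbF.
Qed.

Theorem families_distinct f g P Q : f <> g -> L f P -> L g Q -> ~ isomorphic_projections P Q.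
Proof.
move=> fg /listedP Lf /listedP Lg iso.
have : family_dim f = family_dim g.
  have [Z PZ] := listed_covmx Lf; have [Z' QZ] := listed_covmx Lg.
  by move: iso; rewrite PZ QZ => -[a _ [b /graph_iso_dim]].
(* Among families of equal dimension the congruences on [p] are incompatible, except for (A2) with
   (A3) and (B1) with (B2). There a free point is compared with a fixed point of [rho * kappa]. *)
case: f fg Lf; case: g Lg => //= Lg _ Lf _; move: (Lf) (Lg) => [pf _] [pg _];
  try by clear - pf pg; exfalso; lia.
- have [[_ QE] [_ [s fs PE]]] := (Lg, Lf); apply: (not_iso_A pf fs); by rewrite -QE -PE.
- have [[_ [s fs QE]] [_ PE]] := (Lg, Lf); apply: (not_iso_A pf fs); rewrite -QE -PE.
  exact: isomorphic_sym.
- have [[_ [w' w'E QE]] [_ [w wP PE]]] := (Lg, Lf).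
  by apply: (not_iso_B pf wP w'E); rewrite -QE -PE.
- have [[_ [w wP QE]] [_ [w' w'E PE]]] := (Lg, Lf).
  by apply: (not_iso_B pg wP w'E); rewrite -QE -PE; exact: isomorphic_sym.
Qed.

Lemma card_orbitA z : p = 1 %[mod 4] -> z \in freeA i -> #|orbitA i z| = 4%N.
Proof.
move=> p1; rewrite -klein_orbit_A // inE => /and3P[Kz Rz KRz].
exact (klein_orbit_card (family_RR (kfA p1)) (family_KK (kfA p1)) (family_RK (kfA p1)) Rz Kz KRz).
Qed.

Lemma card_orbitB (w : conic) : p = 3 %[mod 4] ->
  ((val w).1 != -1) && ((val w).1 != 1) -> #|orbitB (val w)| = 4%N.
Proof.
move=> p3; rewrite -(freeBE pr_p odd_p p3) -(klein_orbit_B p3) (card_imset _ val_inj) inE.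
case/and3P=> Kw Rw KRw.
exact (klein_orbit_card (family_RR (kfB p3)) (family_KK (kfB p3)) (family_RK (kfB p3)) Rw Kw KRw).
Qed.

Lemma number_free_A n : p = 1 %[mod 4] -> #|freeA i| = (n * 4)%N ->
  number_up_to_iso (fun P => exists2 s, Some s \in freeA i & P = projUA (Some s)) n.
Proof.
move=> p1 cardE; have goodA z : z \in freeA i ->
    exists2 w, w \in klein_orbit (mobK i) (mobR i) z & w != None.
  exact: freeA_orbit.
have := orbit_representatives (kfA p1) goodA cardE.
apply: number_up_to_iso_ext => P; split=> [[[s|] //] | [s fs ->]].
  by rewrite /= => fs ->; exists s.
by exists (Some s).
Qed.

Lemma number_free_B n (p3 : p = 3 %[mod 4]) : #|freeB pr_p odd_p p3| = (n * 4)%N ->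
  number_up_to_iso (fun P => exists2 w : conic,
    ((val w).1 != -1) && ((val w).1 != 1) & P = projUB w) n.
Proof.
move=> cardE; have goodB w : w \in freeB pr_p odd_p p3 ->
    exists2 w', w' \in klein_orbit (@conicK p) (conicR pr_p odd_p p3) w & predT w'.
  by exists w; [exact: mem_klein_orbit |].
have := orbit_representatives (kfB p3) goodB cardE.
by apply: number_up_to_iso_ext => P; split=> -[w fw ->]; exists w => //;
  move: fw; rewrite -/(freeB pr_p odd_p p3) freeBE.
Qed.

Theorem number_listed_A : p = 1 %[mod 4] ->
  number_up_to_iso (fun P => exists2 f, in_A f & L f P) ((p - 1) %/ 4).
Proof.
move=> p1; have i2 := def_i p1.
have [p18 | p58]  := mod4_1 p1.
  (* The extra unit is the single cover of (A3), added to the [(p - 5) / 4] free orbits of (A2). *)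
  have -> : ((p - 1) %/ 4 = ((p - 5) %/ 4).+1)%N by clear - p18 pr_p; move: (prime_gt1 pr_p); lia.
  have cardE := card_freeA_mod1 pr_p odd_p i2 (def_nu p18) p18.
  have := number_up_to_iso_add _ (number_free_A p1 cardE) => /(_ (projUA spA)) num.
  apply: number_up_to_iso_ext (num _) => [P | P [s fs ->]]; last exact: not_iso_A.
  split=> [[[s fs ->] | ->] | [f fA /listedP]].
  - by exists FamA2 => //; apply/listedP; split=> //; exists s.
  - by exists FamA3 => //; apply/listedP.
  by case: f fA => //= _ [pf]; [move: p18; rewrite pf | left | right].
have cardE := card_freeA_mod5 pr_p odd_p i2 p58.
apply: number_up_to_iso_ext (number_free_A p1 cardE) => P; split=> [[s fs ->] | [f fA /listedP]].
  by exists FamA1 => //; apply/listedP; split=> //; exists s.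
by case: f fA => //= _ [pf] //; move: p58; rewrite pf.
Qed.

Theorem number_listed_B : p = 3 %[mod 4] ->
  number_up_to_iso (fun P => exists2 f, in_B f & L f P) ((p + 1) %/ 4).
Proof.
move=> p3; have [p38 | p78]  := mod4_3 p3.
  have -> : ((p + 1) %/ 4 = ((p - 3) %/ 4).+1)%N by clear - p38; lia.
  have cardE := card_freeB_mod3 pr_p odd_p p3 (def_r p38) p38.
  have /andP[sol _] := sol_r (expr1n _ 2) (def_r p38).
  pose w0 : conic := exist _ (1, r) sol.
  have := number_up_to_iso_add _ (number_free_B cardE) => /(_ (projUB w0)) num.
  apply: number_up_to_iso_ext (num _) => [P | P [w fw ->]]; last exact: not_iso_B.
  split=> [[[w fw ->] | ->] | [f fB /listedP]].
  - by exists FamB1 => //; apply/listedP; split=> //; exists w.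
  - by exists FamB2 => //; apply/listedP; split=> //; exists w0.
  case: f fB => //= _ [pf]; first by left.
  by move=> [w wE ->]; right; congr (covmx (UBo _)); exact: wE.
have cardE := card_freeB_mod7 pr_p odd_p p3 p78.
apply: number_up_to_iso_ext (number_free_B cardE) => P; split=> [[w fw ->] | [f fB /listedP]].
  by exists FamB1 => //; apply/listedP; split=> //; exists w.
by case: f fB => //= _ [pf] //; move: p78; rewrite pf.
Qed.

Lemma mod4_paramA s : paramA1 i s || paramA2 i nu s -> p = 1 %[mod 4] /\ Some s \in freeA i.
Proof.
rewrite paramA1E paramA2E => /orP[]/andP[/eqP h ->]; split=> //; [exact: mod8_5 | exact: mod8_1].
Qed.

Lemma paramB1_conic ab : paramB1 r ab -> exists2 w : conic, val w = ab &
  p = 3 %[mod 4] /\ ((val w).1 != -1) && ((val w).1 != 1).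
Proof.
move=> pab; have /and3P[_ sol _] := pab; exists (exist _ ab sol) => //.
by move: pab; rewrite -[ab]/(val (exist _ ab sol : conic)) paramB1E => /andP[/eqP].
Qed.

End Classification.

(* The square roots i, nu, theta, r (for the square root of -2 in (B)) and
   delta are arbitrary; each is constrained only for the primes p for which it
   exists and is used. *)
Theorem mainTheorem2 (p : nat) (p_prime : prime p) (p_odd : odd p)
  (i nu theta r delta : 'F_p)
  (def_i : p = 1 %[mod 4] -> i ^+ 2 = -1)
  (def_nu : p = 1 %[mod 8] -> nu ^+ 2 = - i)
  (def_theta : p = 1 %[mod 24] \/ p = 19 %[mod 24] -> theta ^+ 2 = - 3%:R)
  (def_r : p = 3 %[mod 8] -> r ^+ 2 = - 2%:R)
  (def_delta : p = 19 %[mod 24] -> delta ^+ 2 = - 2%:R) :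
  let L := listed i nu theta r delta in
  (* the listed projections are minimal semisymmetric covers *)
  (forall f P, L f P ->
     [/\ elementary_abelian_covering p P, connected_graph (cover_graph P),
         minimal_semisymmetric P & largest_lifting_group P = family_group f])
  (* completeness *)
  /\ (forall P : projection GP83,
        elementary_abelian_covering p P -> connected_graph (cover_graph P) ->
        minimal_semisymmetric P ->
        exists f Q, L f Q /\ isomorphic_projections P Q)
  (* different families *)
  /\ (forall (f g : cover_family) P Q, f <> g -> L f P -> L g Q -> ~ isomorphic_projections P Q)
  (* isomorphisms within (A1) and within (A2) *)
  /\ (forall s t : 'F_p,
        (paramA1 i s && paramA1 i t) || (paramA2 i nu s && paramA2 i nu t) ->
        (isomorphic_projections (projA i s) (projA i t)
           <-> Some t \in orbitA i (Some s)))
  /\ (p = 1 %[mod 4] ->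
        exists to : {action ('Z_2 * 'Z_2)%type &-> option 'F_p},
          forall z, orbit to setT z = orbitA i z)
  /\ (forall s : 'F_p, paramA1 i s || paramA2 i nu s ->
        #|orbitA i (Some s)| = 4%N)
  (* isomorphisms within (B1) *)
  /\ (forall ab cd : 'F_p * 'F_p, paramB1 r ab -> paramB1 r cd ->
        (isomorphic_projections (projB ab) (projB cd) <-> cd \in orbitB ab))
  /\ (p = 3 %[mod 4] ->
        exists to : {action ('Z_2 * 'Z_2)%type
                       &-> {ab : 'F_p * 'F_p | solutionB ab}},
          forall z, [set val w | w in orbit to setT z] = orbitB (val z))
  /\ (forall ab : 'F_p * 'F_p, paramB1 r ab -> #|orbitB ab| = 4%N)
  (* minimal edge-transitivity and counting *)
  /\ (forall f P, L f P -> in_A f || in_B f -> minimal_edge_transitive P)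
  /\ (p = 1 %[mod 4] ->
        number_up_to_iso (fun P => exists2 f, in_A f & L f P) ((p - 1) %/ 4))
  /\ (p = 3 %[mod 4] ->
        number_up_to_iso (fun P => exists2 f, in_B f & L f P) ((p + 1) %/ 4))
  /\ (forall P, L FamC P \/ L FamD P -> ~ minimal_edge_transitive P).
Proof.
move=> L.
have props := listed_properties p_prime p_odd def_i def_nu def_theta def_r def_delta.
split; first by move=> f P /props[].
split; first exact: (listed_complete p_prime p_odd def_i def_nu def_theta def_r def_delta).
split; first exact: (families_distinct p_prime p_odd def_i def_nu def_r def_delta).
split.
  move=> s t st; rewrite !projA_UA.
  have st' : paramA1 i s || paramA2 i nu s by case/orP: st => /andP[-> _]; rewrite ?orbT.
  have [p1 _] := mod4_paramA p_prime p_odd def_i def_nu st'.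
  exact: (iso_UA p_prime p_odd def_i (Some s) (Some t) p1).
split.
  move=> p1; have kf := klein_family_A p_prime p_odd (def_i p1).
  exists (klein_action (family_RR kf) (family_KK kf) (family_RK kf)) => z.
  by rewrite klein_orbitE -(klein_orbit_A p_prime p_odd def_i).
split.
  by move=> s /(mod4_paramA p_prime p_odd def_i def_nu)[p1 fs]; exact: (card_orbitA p_prime p_odd def_i).
split.
  move=> ab cd /(paramB1_conic p_prime p_odd def_r)[w <- [p3 _]].
  move=> /(paramB1_conic p_prime p_odd def_r)[w' <- _]; rewrite !projB_UBo.
  exact: iso_UB.
split.
  move=> p3; have kf := klein_family_B p_prime p_odd p3.
  exists (klein_action (family_RR kf) (family_KK kf) (family_RK kf)) => w.
  by rewrite klein_orbitE -(klein_orbit_B p_prime p_odd p3).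
split.
  move=> ab /(paramB1_conic p_prime p_odd def_r)[w <- [p3 wP]]; exact: card_orbitB.
split; first by move=> f P /props[_ _ _ _ h] fAB; rewrite fAB in h.
split; first exact: (number_listed_A p_prime p_odd theta def_i def_nu def_r def_delta).
split; first exact: (number_listed_B p_prime p_odd theta def_i def_nu def_r def_delta).
by move=> P [] /props[].
Qed.
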